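(* Let $d\ge 1$, let $\mathbf{X}=(X_1,X_2,\dots)$ be a sequence of $\mathbb{R}^d$-valued random vectors on a probability space $(\Omega,\mathbb{F},P)$, and let $S_n:=X_1+X_2+\dots+X_n$. Let $(A_n)_{n\ge1}$ be a sequence of linear operators ($d\times d$ real matrices) on $\mathbb{R}^d$ and $(b_n)_{n\ge1}$ a sequence of vectors in $\mathbb{R}^d$ such that (i) $\alpha(\mathbf{X};n)\to 0$ as $n\to\infty$, i.e. the sequence $\mathbf{X}$ is strongly mixing; (ii) the triangular array $(A_nX_j:\ 1\le j\le n,\ n\ge 1)$ is infinitesimal; (iii) $A_nS_n+b_n\Rightarrow\mu$ (convergence in distribution) for some full probability measure $\mu$ on $\mathbb{R}^d$. Then the limit distribution $\mu$ is operator-selfdecomposable; that is, there exists a one-parameter semigroup $\{e^{-tQ}: t\ge 0\}\subset \mathbf{D}(\mu)$ (for some real $d\times d$ matrix $Q$) with $\lim_{t\to\infty}e^{-tQ}=0$ (the zero matrix).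
   Context: $\mathbf{End}$ denotes the algebra of all linear operators ($d\times d$ real matrices) on $\mathbb{R}^d$. The probability space is assumed rich enough to carry all the random variables needed. Strong mixing: for sub-$\sigma$-fields $\mathcal{A},\mathcal{B}$ of $\mathbb{F}$ put $\alpha(\mathcal{A},\mathcal{B}):=\sup_{A\in\mathcal{A},B\in\mathcal{B}}|P(A\cap B)-P(A)P(B)|$, and for a sequence $\mathbf{X}=(X_1,X_2,\dots)$ put $\alpha(\mathbf{X};n):=\sup_{j\in\mathbb{N}}\alpha\big(\sigma(X_k,1\le k\le j),\,\sigma(X_k,k\ge j+n)\big)$. Infinitesimal: $(A_nX_j: 1\le j\le n,\ n\ge1)$ is infinitesimal if for every $\epsilon>0$, $\lim_{n\to\infty}\max_{1\le j\le n}P(\|A_nX_j\|\ge\epsilon)=0$. Full: a probability measure on $\mathbb{R}^d$ is full if its support is not contained in any proper hyperplane (a translate of a proper linear subspace) of $\mathbb{R}^d$. Urbanik decomposability semigroup: for a Borel probability measure $\mu$ on $\mathbb{R}^d$, $\mathbf{D}(\mu)$ is the set of all $A\in\mathbf{End}$ such that $\mu=A\mu\ast\nu$ for some Borel probability measure $\nu$ on $\mathbb{R}^d$, where $A\mu$ is the image of $\mu$ under $A$ and $\ast$ is convolution (equivalently, if $X$ has law $\mu$, then $X\stackrel{d}{=}AX+Y$ for some $Y$ independent of $X$). Operator-selfdecomposable: $\mu$ is operator-selfdecomposable if there exist vectors $b_n'\in\mathbb{R}^d$, operators $A_n'\in\mathbf{End}$ and a sequence of independent $\mathbb{R}^d$-valued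 random vectors $X_n'$ such that $(A_n'X_j':1\le j\le n,\ n\ge1)$ is infinitesimal and $A_n'(X_1'+\dots+X_n')+b_n'\Rightarrow\mu$. By a known theorem of Urbanik, a full measure $\mu$ is operator-selfdecomposable if and only if $\mathbf{D}(\mu)$ contains a one-parameter semigroup $\{\exp(-tQ):t\ge0\}$ with $\exp(-tQ)\to0$ as $t\to\infty$; this is the equivalence meant by ''that is'' in the claim. *)

(* Defs.v *)
From HB Require Import structures.
From mathcomp Require Import all_boot all_order all_algebra finmap.
From mathcomp Require Import all_classical all_reals all_analysis.

Set Implicit Arguments.
Unset Strict Implicit.
Unset Printing Implicit Defensive.

Import Order.TTheory GRing.Theory Num.Theory.
Import numFieldNormedType.Exports.

Local Open Scope classical_set_scope.
Local Open Scope ring_scope.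

(* Vectors of R^d are columns 'cV[R]_d, operators act by [mulmx], and norm and
   topology are the library's (sup norm of the entries).

   All sequences X, A, b below are indexed by n >= 1; their value at 0 is
   never used. *)

Section borel.
Context (R : realType) (m n : nat).

Definition borel_mx : set (set 'M[R]_(m, n)) := <<s open >>.

Let borel_mx0 : borel_mx set0.
Proof. exact: sigma_algebra0. Qed.

Let borel_mxC (B : set 'M[R]_(m, n)) : borel_mx B -> borel_mx (~` B).
Proof. exact: sigma_algebraC. Qed.

Let borel_mxU (F : (set 'M[R]_(m, n))^nat) :
  (forall i, borel_mx (F i)) -> borel_mx (\bigcup_i F i).
Proof. exact: sigma_algebra_bigcup. Qed.

Definition borel_mx_display : measure_display.
Proof. by constructor. Qed.

HB.instance Definition _ := @isMeasurable.Build borel_mx_display 'M[R]_(m, n)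
  borel_mx borel_mx0 borel_mxC borel_mxU.

End borel.

Section mulmx_measurable.
Context (R : realType) (d : nat) (A : 'M[R]_d).

Lemma continuous_mulmx : continuous (mulmx A : 'cV[R]_d -> 'cV[R]_d).
Proof.
have normE (y : 'cV[R]_d) : `|y| = \big[Num.max/0]_ij `|y ij.1 ij.2|.
  exact: mx_normrE.
pose M := \sum_i \sum_j `|A i j|.
have M0 : 0 <= M by apply: sumr_ge0 => i _; exact: sumr_ge0.
have MA (y : 'cV[R]_d) : `|A *m y| <= M * `|y|.
  rewrite [leLHS]normE; apply/bigmax_leP; split=> [|[i j] _] /=.
    exact: mulr_ge0.
  rewrite mxE (le_trans (ler_norm_sum _ _ _))//.
  rewrite (@le_trans _ _ (\sum_k `|A i k| * `|y|))//.
    apply: ler_sum => k _; rewrite normrM ler_wpM2l// normE.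
    exact: (le_bigmax _ (fun ij : 'I_d * 'I_1 => `|y ij.1 ij.2|) (k, j)).
  rewrite -mulr_suml ler_wpM2r// /M [leRHS](bigD1 i)//= lerDl.
  by apply: sumr_ge0 => k _; exact: sumr_ge0.
move=> x; apply/(@cvgrPdist_le _ _ _ (nbhs x)) => /= e e0; near=> y.
rewrite -mulmxBr (le_trans (MA _))// (@le_trans _ _ ((M + 1) * `|x - y|))//.
  by rewrite ler_wpM2r// lerDl.
rewrite mulrC -ler_pdivlMr ?ltr_wpDl//.
near: y; apply: (@cvgr_dist_le _ _ _ (nbhs x) _ id x) => //.
by rewrite divr_gt0// ltr_wpDl.
Unshelve. all: by end_near. Qed.

Lemma measurable_mulmx :
  measurable_fun setT (mulmx A : 'cV[R]_d -> 'cV[R]_d).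
Proof.
apply: (@measurability _ _ 'cV[R]_d 'cV[R]_d setT (mulmx A) open) => // _ [B oB <-].
rewrite setTI; apply: sub_sigma_algebra.
by move/continuousP: continuous_mulmx; exact.
Qed.

HB.instance Definition _ :=
  isMeasurableFun.Build _ _ _ _ (mulmx A : 'cV[R]_d -> 'cV[R]_d)
    measurable_mulmx.

End mulmx_measurable.

Section strong_mixing.
Context (R : realType) (dO : measure_display) (Omega : measurableType dO).
Variable P : probability Omega R.

Definition alpha_coef (F G : set (set Omega)) : \bar R :=
  ereal_sup [set `|P (E.1 `&` E.2) - P E.1 * P E.2|%E | E in F `*` G].

Definition sigma_of d (X : nat -> {RV P >-> 'cV[R]_d}) (K : set nat) :
    set (set Omega) :=
  <<s \bigcup_(k in K) g_sigma_algebra_preimage (X k) >>.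

Definition alpha_seq d (X : nat -> {RV P >-> 'cV[R]_d}) (n : nat) : \bar R :=
  ereal_sup [set alpha_coef (sigma_of X [set k | (1 <= k <= j)%N])
                            (sigma_of X [set k | (j + n <= k)%N])
            | j in [set j | (1 <= j)%N]].

Definition strongly_mixing d (X : nat -> {RV P >-> 'cV[R]_d}) : Prop :=
  alpha_seq X n @[n --> \oo] --> 0%E.

End strong_mixing.

Section limit_theorems.
Context (R : realType) (d : nat).
Context (dO : measure_display) (Omega : measurableType dO).
Variable P : probability Omega R.

Definition infinitesimal (A : nat -> 'M[R]_d) (X : nat -> {RV P >-> 'cV[R]_d})
    : Prop :=
  forall e : R, 0 < e ->
    \big[maxe/0%E]_(1 <= j < n.+1) P [set w | e <= `|A n *m X j w|]
      @[n --> \oo] --> 0%E.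

Definition partial_sum (X : nat -> {RV P >-> 'cV[R]_d}) (n : nat) (w : Omega)
    : 'cV[R]_d :=
  \sum_(1 <= j < n.+1) X j w.

Definition cvg_in_law (Y : nat -> Omega -> 'cV[R]_d)
    (mu : probability 'cV[R]_d R) : Prop :=
  forall f : 'cV[R]_d -> R, continuous f -> bounded_fun f ->
    (\int[P]_w (f (Y n w))%:E)%E @[n --> \oo] --> (\int[mu]_x (f x)%:E)%E.

Definition mutually_independent (X : nat -> {RV P >-> 'cV[R]_d}) : Prop :=
  forall (J : {fset nat}) (B : nat -> set 'cV[R]_d),
    (forall j, j \in J -> (1 <= j)%N) -> (forall j, measurable (B j)) ->
    P (\bigcap_(j in [set` J]) X j @^-1` B j)
      = (\prod_(j <- J) P (X j @^-1` B j))%E.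

End limit_theorems.

Section laws.
Context (R : realType) (d : nat).
Implicit Types mu nu : probability 'cV[R]_d R.

Definition support mu : set 'cV[R]_d :=
  [set x | forall U : set 'cV[R]_d, open U -> U x -> (0 < mu U)%E].

Definition full mu : Prop :=
  forall (W : {vspace 'cV[R]_d}) (a : 'cV[R]_d), W != fullv ->
    ~ (support mu `<=` [set a + w | w in [set` W]]).

Definition convolution mu nu (B : set 'cV[R]_d) : \bar R :=
  (mu \x nu)%E [set z | B (z.1 + z.2)].

(* [distribution mu (mulmx A)] is the image A mu of mu under A. *)
Definition decomposability mu : set 'M[R]_d :=
  [set A | exists nu : probability 'cV[R]_d R,
     forall B, measurable B ->
       mu B = convolution (distribution mu (mulmx A)) nu B].

Definition operator_selfdecomposable mu : Prop :=
  exists (dO : measure_display) (Omega : measurableType dO)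
    (P : probability Omega R) (X : nat -> {RV P >-> 'cV[R]_d})
    (A : nat -> 'M[R]_d) (b : nat -> 'cV[R]_d),
    [/\ mutually_independent X,
        infinitesimal A X &
        cvg_in_law P (fun n w => A n *m partial_sum X n w + b n) mu].

Definition expmx (Q : 'M[R]_d) : 'M[R]_d :=
  limn (series (fun k => k`!%:R^-1 *: Q ^+ k)).

End laws.

(* Main.v *)
(* Convergence is tested on bounded Lipschitz functions and all limits are taken
   along ultrafilters on nat.  If laws of U_k and U_k + V_k converge to A mu and
   B mu and U_k, V_k are asymptotically uncorrelated, then A mu is a convolution
   factor of B mu.  With U_k = A_n S_m and V_k = A_n (S_n - S_m), where m goes to
   infinity and m <= n, strong mixing and infinitesimality give that A_n A_m^-1
   has all its limit points in the compact semigroup D(mu), and that those of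
   A_(n+1) A_n^-1 are symmetries g (mu is a factor of g mu and conversely).
   Correcting A_n by symmetries one may assume A_(n+1) A_n^-1 -> 1, while
   A_n -> 0: D(mu) contains matrices at every small distance e from 1, and from
   the symmetries; rescaling them gives a generator X with e^(tX) in D(mu).
   The powers of e^X accumulate at an idempotent E, and one repeats the
   argument in the corner J D(mu) J for J = E: an idempotent J of D(mu) splits
   mu into J mu * (1 - J) mu, which extends the semigroup found in the corner to
   the whole space.  The rank of J decreases until J = 0.
   Conversely a decaying semigroup t |-> e^(-tQ) in D(mu) decomposes
   mu = (1 - 1/n)^Q mu * r_n, and independent noises of law r_n, realized on
   [0, 1[ by means of a measure preserving map from [0, 1[ to its square,
   display mu as operator-selfdecomposable. *)
Require Import Defs.
From HB Require Import structures.
From mathcomp Require Import all_boot all_order all_algebra finmap.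
From mathcomp Require Import all_classical all_reals all_analysis.
From mathcomp Require Import measurable_realfun ring lra zify.

Set Implicit Arguments.
Unset Strict Implicit.
Unset Printing Implicit Defensive.

Import Order.TTheory GRing.Theory Num.Theory.
Import numFieldNormedType.Exports.

Local Open Scope classical_set_scope.
Local Open Scope ring_scope.

(** Everything rests on the relation [factor], tested against bounded Lipschitz functions;
    characteristic functions never appear, and their usual role in cancelling a convolution is taken
    over by the extremal argument of [convolution_cancel]. Fullness enters through one fact: if
    [M mu] is a factor of a point mass, then [M = 0]. After division by norms this yields the
    compactness of D(mu), the invertibility of the late [A n], their convergence to [0] and the
    boundedness of the ratios A_n A_m^-1. The main obstacle is that D(mu) may contain a large group
    of symmetries, rotations for instance: a generator tangent to that group would give a semigroup
    that never decays. Hence the requirement that the rescaled matrices be as far from all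
    symmetries as from J. They are found at the first exit of J (A_n A_m^-1) J from a neighbourhood
    of the symmetries, and consecutive ratios close to 1 make this exit happen at a prescribed
    distance. Some e^(tX) J is then not a symmetry, which is what makes the idempotent limit of the
    powers differ from J and the rank really drop. *)

(** * Entrywise sup norm of matrices and convergence along filters *)

Section matrix_norm.
Context (R : realType).

Lemma ler_mx_entry m n (A : 'M[R]_(m, n)) i j : `|A i j| <= `|A|.
Proof.
have -> : `|A| = \big[Num.max/0]_ij `|A ij.1 ij.2| by exact: mx_normrE.
exact: (le_bigmax _ (fun ij : 'I_m * 'I_n => `|A ij.1 ij.2|) (i, j)).
Qed.

Lemma mx_norm_leP m n (A : 'M[R]_(m, n)) c : 0 <= c ->
  (forall i j, `|A i j| <= c) -> `|A| <= c.
Proof.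
move=> c0 Ac; have -> : `|A| = \big[Num.max/0]_ij `|A ij.1 ij.2|.
  exact: mx_normrE.
by apply/bigmax_leP; split => // -[i j] _; exact: Ac.
Qed.

(** For the sup norm of the entries the inner dimension cannot be avoided; it is the source of the
    factors [n%:R] and [d%:R] in the later estimates. *)
Lemma ler_mx_normM m n p (A : 'M[R]_(m, n)) (B : 'M[R]_(n, p)) :
  `|A *m B| <= n%:R * `|A| * `|B|.
Proof.
apply: mx_norm_leP => [|i j]; first by rewrite !mulr_ge0.
rewrite mxE (le_trans (ler_norm_sum _ _ _))//.
rewrite (@le_trans _ _ (\sum_(k < n) `|A| * `|B|))//.
  by apply: ler_sum => k _; rewrite normrM ler_pM// ler_mx_entry.
by rewrite sumr_const card_ord -mulrA mulr_natl.
Qed.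

Lemma cvg_mxP (T : Type) (F : set_system T) {FF : Filter F} m n
    (A : T -> 'M[R]_(m, n)) (M : 'M[R]_(m, n)) :
  A k @[k --> F] --> M <-> forall i j, A k i j @[k --> F] --> M i j.
Proof.
split=> [AM i j|AM].
  apply/cvgrPdist_le => e e0; move/cvgrPdist_le : AM => /(_ _ e0).
  apply: filterS => k; apply: le_trans.
  by have := ler_mx_entry (M - A k) i j; rewrite !mxE.
apply/cvgrPdist_le => e e0.
have : \forall k \near F, forall ij : 'I_m * 'I_n,
    `|M ij.1 ij.2 - A k ij.1 ij.2| <= e.
  apply: filter_forall => -[i j].
  by move/cvgrPdist_le : (AM i j) => /(_ _ e0).
apply: filterS => k MA; apply: mx_norm_leP => [|i j]; first exact: ltW.
by rewrite !mxE; exact: (MA (i, j)).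
Qed.

Lemma cvg_sumr (T : Type) (F : set_system T) {FF : Filter F} (I : Type)
    (r : seq I) (f : I -> T -> R) (l : I -> R) :
  (forall i, f i k @[k --> F] --> l i) ->
  \sum_(i <- r) f i k @[k --> F] --> \sum_(i <- r) l i.
Proof.
move=> fl; elim: r => [|i r IH].
  rewrite big_nil (_ : (fun k => _) = fun=> 0); first exact: cvg_cst.
  by apply/funext => k; rewrite big_nil.
rewrite big_cons (_ : (fun k => _) = fun k => f i k + \sum_(j <- r) f j k).
  exact: cvgD.
by apply/funext => k; rewrite big_cons.
Qed.

Lemma cvg_mulmx (T : Type) (F : set_system T) {FF : Filter F} m n p
    (A : T -> 'M[R]_(m, n)) (B : T -> 'M[R]_(n, p)) (M : 'M[R]_(m, n)) (N : 'M[R]_(n, p)) :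
  A k @[k --> F] --> M -> B k @[k --> F] --> N ->
  A k *m B k @[k --> F] --> M *m N.
Proof.
move=> /cvg_mxP AM /cvg_mxP BN; apply/cvg_mxP => i j.
under eq_fun do rewrite mxE.
by rewrite mxE; apply: cvg_sumr => l; exact: cvgM.
Qed.

(** Compactness of [[- c, c]] in its ultrafilter form, applied to the image of [F], which is again
    an ultrafilter. It replaces extractions of subsequences, so that several limits can be taken
    along the same [F]. *)
Lemma ultra_cvg_real (T : Type) (F : set_system T) {FF : UltraFilter F}
    (a : T -> R) (c : R) :
  (\forall k \near F, `|a k| <= c) -> exists l : R, a k @[k --> F] --> l.
Proof.
move=> ac.
have := @segment_compact R (- c) c; rewrite compact_ultra => cpt.
have UF : UltraFilter (a k @[k --> F]).
  split=> [|G GG sub]; first exact: fmap_proper_filter.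
  apply/seteqP; split=> // B GB.
  have [//|FB] := in_ultra_setVsetC (a @^-1` B) FF.
  have GC : G (~` B) by apply: sub.
  have : G set0 by rewrite -(setICr B); exact: filterI.
  by move/filter_not_empty.
have [|l [_ al]] := cpt (a k @[k --> F]) UF; last by exists l.
by apply: filterS ac => k /=; rewrite ler_norml in_itv.
Qed.

Lemma ultra_cvg_mx (T : Type) (F : set_system T) {FF : UltraFilter F} m n
    (A : T -> 'M[R]_(m, n)) (c : R) :
  (\forall k \near F, `|A k| <= c) -> exists M : 'M[R]_(m, n), A k @[k --> F] --> M.
Proof.
move=> Ac.
have /choice[M AM] : forall ij, exists l : R, A k ij.1 ij.2 @[k --> F] --> l.
  move=> ij; apply: (@ultra_cvg_real _ _ _ _ c).
  by apply: filterS Ac => k; apply: le_trans; exact: ler_mx_entry.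
exists (\matrix_(i, j) M (i, j)); apply/cvg_mxP => i j.
by rewrite mxE; exact: (AM (i, j)).
Qed.

End matrix_norm.

(** * Expectations of bounded measurable functions *)

Section bounded_integrals.
Context (R : realType).

(** Under a probability this implies integrability, and the class is stable under sums, products and
    composition: the side conditions of the real-valued integral become structural goals. *)
Definition bounded_measurable d (T : measurableType d) (f : T -> R) :=
  measurable_fun setT f /\ exists K : R, forall x, `|f x| <= K.

Section one_space.
Context d (T : measurableType d).
Implicit Types (P : probability T R) (f g : T -> R).
Local Notation bm := (@bounded_measurable _ T).

Lemma bm_cst (c : R) : bm (fun=> c).
Proof. by split => //; exists `|c|. Qed.

Lemma bmD f g : bm f -> bm g -> bm (fun x => f x + g x).
Proof.
move=> [mf [K fK]] [mg [L gL]]; split; first exact: measurable_funD.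
by exists (K + L) => x; rewrite (le_trans (ler_normD _ _))// lerD.
Qed.

Lemma bmN f : bm f -> bm (fun x => - f x).
Proof.
move=> [mf [K fK]]; split; first exact: measurableT_comp.
by exists K => x; rewrite normrN.
Qed.

Lemma bmB f g : bm f -> bm g -> bm (fun x => f x - g x).
Proof. by move=> bf bg; exact: bmD bf (bmN bg). Qed.

Lemma bmM f g : bm f -> bm g -> bm (fun x => f x * g x).
Proof.
move=> [mf [K fK]] [mg [L gL]]; split; first exact: measurable_funM.
by exists (K * L) => x; rewrite normrM ler_pM.
Qed.

Lemma bm_norm f : bm f -> bm (fun x => `|f x|).
Proof.
move=> [mf [K fK]]; split; first exact: measurableT_comp.
by exists K => x; rewrite normr_id.
Qed.

Lemma bm_indic (A : set T) : measurable A -> bm (\1_A).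
Proof.
move=> mA; split; first exact: measurable_indic.
by exists 1 => x; rewrite indicE; case: (_ \in _); rewrite ?normr1 ?normr0.
Qed.

Lemma bm_sum (I : Type) (r : seq I) (p : pred I) (F : I -> T -> R) :
  (forall i, p i -> bm (F i)) -> bm (fun x => \sum_(i <- r | p i) F i x).
Proof.
move=> bF; elim: r => [|i r IH].
  by under eq_fun do rewrite big_nil; exact: bm_cst.
case: (boolP (p i)) => pi; under eq_fun do rewrite big_cons ?pi ?(negbTE pi)//=.
  by apply: bmD => //; exact: bF.
exact: IH.
Qed.

Lemma bm_integrable P f : bm f -> P.-integrable setT (EFin \o f).
Proof.
move=> [mf [K fK]]; apply: measurable_bounded_integrable => //.
  by rewrite (le_lt_trans (probability_le1 P measurableT))// ltry.
exists K; split; first exact: num_real.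
by move=> y Ky x _; exact: le_trans (fK x) (ltW Ky).
Qed.

Lemma Ex_cst P (c : R) : \int[P]_x c = c.
Proof. by rewrite Rintegral_cst// [X in fine X]probability_setT mulr1. Qed.

Lemma ExD P f g : bm f -> bm g ->
  \int[P]_x (f x + g x) = \int[P]_x f x + \int[P]_x g x.
Proof. by move=> bf bg; rewrite RintegralD//; exact: bm_integrable. Qed.

Lemma ExB P f g : bm f -> bm g ->
  \int[P]_x (f x - g x) = \int[P]_x f x - \int[P]_x g x.
Proof. by move=> bf bg; rewrite RintegralB//; exact: bm_integrable. Qed.

Lemma ExZ P (c : R) f : bm f -> \int[P]_x (c * f x) = c * \int[P]_x f x.
Proof. by move=> bf; rewrite RintegralZl//; exact: bm_integrable. Qed.

Lemma ExZr P (c : R) f : bm f -> \int[P]_x (f x * c) = \int[P]_x f x * c.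
Proof. by move=> bf; rewrite RintegralZr//; exact: bm_integrable. Qed.

Lemma Ex_sum P (I : Type) (r : seq I) (F : I -> T -> R) :
  (forall i, bm (F i)) ->
  \int[P]_x (\sum_(i <- r) F i x) = \sum_(i <- r) \int[P]_x F i x.
Proof.
move=> bF; elim: r => [|i r IH].
  by rewrite big_nil; under eq_Rintegral do rewrite big_nil; rewrite Ex_cst.
rewrite big_cons -IH -ExD//; last exact: bm_sum.
by under eq_Rintegral do rewrite big_cons.
Qed.

Lemma le_Ex P f g : bm f -> bm g -> (forall x, f x <= g x) ->
  \int[P]_x f x <= \int[P]_x g x.
Proof.
by move=> bf bg fg; apply: le_Rintegral => //; exact: bm_integrable.
Qed.

Lemma le_norm_Ex P f g : bm f -> bm g -> (forall x, `|f x| <= g x) ->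
  `|\int[P]_x f x| <= \int[P]_x g x.
Proof.
move=> bf bg fg; rewrite (le_trans (le_normr_Rintegral _ _))//.
  exact: bm_integrable.
by apply: le_Ex => //; exact: bm_norm.
Qed.

Lemma norm_Ex_le P f (K : R) : bm f -> (forall x, `|f x| <= K) ->
  `|\int[P]_x f x| <= K.
Proof. by move=> bf fK; rewrite -(Ex_cst P K); apply: le_norm_Ex => //; exact: bm_cst. Qed.

Lemma Ex_indic P (A : set T) : measurable A -> \int[P]_x (\1_A x) = fine (P A).
Proof. by move=> mA; rewrite /Rintegral integral_indic// setIT. Qed.

Lemma EFin_Ex P f : bm f -> (\int[P]_x f x)%:E = (\int[P]_x (f x)%:E)%E.
Proof.
move=> bf; rewrite /Rintegral fineK//.
exact: integrable_fin_num (bm_integrable P bf).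
Qed.

Lemma Ex_cvg P (f_ : nat -> T -> R) f (K : R) :
  (forall n, measurable_fun setT (f_ n)) -> (forall n x, `|f_ n x| <= K) ->
  (forall x, f_ n x @[n --> \oo] --> f x) ->
  \int[P]_x f_ n x @[n --> \oo] --> \int[P]_x f x.
Proof.
move=> mf fK ff.
have mf' : measurable_fun setT f by apply: (measurable_fun_cvg mf) => x _.
have fK' x : `|f x| <= K.
  rewrite -(cvg_lim _ (cvg_norm (ff x)))//; apply: limr_le.
    by apply: is_cvg_norm; apply/cvg_ex; exists (f x).
  exact: nearW.
have bf : bm f by split => //; exists K.
have bfn n : bm (f_ n) by split => //; exists K.
have [|||||_ _] := @dominated_convergence _ T R P setT measurableT
  (fun n x => (f_ n x)%:E) (fun x => (f x)%:E) (fun=> K%:E).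
- by move=> n; apply/measurable_EFinP; exact: mf.
- by apply/measurable_EFinP.
- by apply: aeW => x _; apply: cvg_EFin (ff x); exact: nearW.
- exact: bm_integrable (bm_cst K).
- by apply: aeW => x n _; rewrite /= lee_fin.
rewrite -EFin_Ex// => /fine_cvgP[_].
by apply: cvg_trans; apply: near_eq_cvg; near=> n; rewrite /= -EFin_Ex.
Unshelve. all: by end_near. Qed.

End one_space.

Lemma bm_comp d1 d2 (T1 : measurableType d1) (T2 : measurableType d2)
    (phi : T1 -> T2) (f : T2 -> R) :
  measurable_fun setT phi -> bounded_measurable f ->
  bounded_measurable (f \o phi).
Proof.
move=> mphi [mf [K fK]]; split; first exact: measurableT_comp.
by exists K => x; exact: fK.
Qed.

(** Linear images, laws of sums and Dirac masses are all produced in this way. *)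
Lemma pushforward_prob d1 d2 (T1 : measurableType d1) (T2 : measurableType d2)
    (P : probability T1 R) (phi : T1 -> T2) : measurable_fun setT phi ->
  exists Q : probability T2 R, (forall B, Q B = P (phi @^-1` B)) /\
    forall f, bounded_measurable f -> \int[Q]_x f x = \int[P]_x f (phi x).
Proof.
move=> mphi; pose X : {mfun T1 >-> T2} := mfun_Sub (mem_set mphi).
exists (distribution P X); split => // f bf; rewrite /Rintegral.
rewrite integral_pushforward//=.
- by apply/measurable_EFinP; case: bf.
- by apply: bm_integrable; exact: (bm_comp mphi).
Qed.

Section product.
Context d1 d2 (T1 : measurableType d1) (T2 : measurableType d2).
Context (P : probability T1 R) (Q : probability T2 R).

Lemma bm_section1 (f : T1 * T2 -> R) x :
  bounded_measurable f -> bounded_measurable (fun y => f (x, y)).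
Proof. by move=> bf; exact: (bm_comp (measurable_pair1 x)). Qed.

Lemma bm_section2 (f : T1 * T2 -> R) y :
  bounded_measurable f -> bounded_measurable (fun x => f (x, y)).
Proof. by move=> bf; exact: (bm_comp (measurable_pair2 y)). Qed.

Lemma bm_Ex2 (f : T1 * T2 -> R) : bounded_measurable f ->
  bounded_measurable (fun y => \int[P]_x f (x, y)).
Proof.
move=> bf; split; last first.
  case: (bf) => _ [K fK]; exists K => y.
  by apply: norm_Ex_le => //; exact: bm_section2.
apply/measurable_EFinP.
have := measurable_fubini_G (bm_integrable (P \x Q)%E bf).
apply: eq_measurable_fun => x _.
by rewrite /fubini_G /= EFin_Ex//; exact: bm_section2.
Qed.

Lemma Ex_prod (f : T1 * T2 -> R) : bounded_measurable f ->
  \int[(P \x Q)%E]_z f z = \int[P]_x \int[Q]_y f (x, y).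
Proof.
move=> bf; rewrite [in LHS]/Rintegral -integral12_prod_meas1.
  rewrite [in RHS]/Rintegral; congr fine; apply: eq_integral => x _.
  by rewrite /fubini_F /= EFin_Ex//; exact: bm_section1.
exact: bm_integrable.
Qed.

Lemma Ex_swap (f : T1 * T2 -> R) : bounded_measurable f ->
  \int[P]_x \int[Q]_y f (x, y) = \int[Q]_y \int[P]_x f (x, y).
Proof.
move=> bf; rewrite /Rintegral; congr fine.
have := @Fubini _ _ _ _ R P Q (EFin \o f) (bm_integrable _ bf).
rewrite /fubini_F /fubini_G /= => FE.
transitivity (\int[P]_x \int[Q]_y (f (x, y))%:E)%E.
  by apply: eq_integral => x _; rewrite EFin_Ex//; exact: bm_section1.
rewrite FE; apply: eq_integral => y _.
by rewrite [in RHS]EFin_Ex//; exact: bm_section2.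
Qed.

End product.
End bounded_integrals.

(** * Bounded Lipschitz test functions *)

Section clip.
Context (R : realType).

(** [clip (|x| - r)] is a Lipschitz substitute for the indicator of the outside of a ball: [0] when
    [|x| <= r], [1] when [|x| >= r + 1]. Its integral measures tightness, and that of
    [clip (c * |x|)] measures smallness in probability. *)
Definition clip (t : R) : R := Num.max 0 (Num.min 1 t).

Lemma clip_ge0 t : 0 <= clip t.
Proof. by rewrite le_max lexx. Qed.

Lemma clip_le1 t : clip t <= 1.
Proof. by rewrite ge_max ler01 ge_min lexx. Qed.

Lemma norm_clip_le1 t : `|clip t| <= 1.
Proof. by rewrite ger0_norm ?clip_ge0// clip_le1. Qed.

Lemma clip0 t : t <= 0 -> clip t = 0.
Proof.
move=> t0; rewrite /clip min_r ?(le_trans t0)//.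
by rewrite max_l.
Qed.

Lemma clip1 t : 1 <= t -> clip t = 1.
Proof. by move=> t1; rewrite /clip min_l// max_r. Qed.

Lemma clip_id t : 0 <= t <= 1 -> clip t = t.
Proof. by move=> /andP[t0 t1]; rewrite /clip min_r// max_r. Qed.

Lemma clip_homo s t : s <= t -> clip s <= clip t.
Proof.
move=> st; rewrite /clip ge_max le_max lexx/= le_max; apply/orP; right.
by rewrite le_min ge_min lexx/= ge_min st orbT.
Qed.

Lemma clip_lip s t : `|clip s - clip t| <= `|s - t|.
Proof.
wlog st : s t / s <= t.
  move=> H; case/orP: (le_total s t) => st; first exact: H.
  by rewrite distrC [leRHS]distrC; exact: H.
rewrite distrC [leRHS]distrC ger0_norm ?subr_ge0 ?clip_homo//.
rewrite ger0_norm ?subr_ge0//.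
rewrite /clip; case: (leP 1 s) => s1; case: (leP 1 t) => t1;
  rewrite ?(max_r ler01)//; try lra.
- case: (leP 0 s) => s0; rewrite ?(max_r s0) ?(max_l (ltW s0)); lra.
- case: (leP 0 s) => s0; case: (leP 0 t) => t0; lra.
Qed.

End clip.

Section bounded_lipschitz.
Context (R : realType) (n : nat).
Implicit Types (f g : 'cV[R]_n -> R).

(** One constant bounds both the function and its slopes, so that each estimate carries a single
    [K]. *)
Definition bounded_lipschitz f := exists K : R, [/\ 0 <= K,
  forall x, `|f x| <= K & forall x y, `|f x - f y| <= K * `|x - y|].

Lemma bl_intro f K L : (forall x, `|f x| <= K) ->
  (forall x y, `|f x - f y| <= L * `|x - y|) -> bounded_lipschitz f.
Proof.
move=> fK fL; exists (Num.max 0 (Num.max K L)); split.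
- by rewrite le_max lexx.
- by move=> x; rewrite !le_max fK orbT.
- move=> x y; rewrite (le_trans (fL x y))// ler_wpM2r//.
  by rewrite !le_max lexx !orbT.
Qed.

Lemma bl_cst (c : R) : bounded_lipschitz (fun=> c).
Proof.
by apply: (@bl_intro _ `|c| 0) => // x y; rewrite subrr normr0 mul0r.
Qed.

Lemma blD f g : bounded_lipschitz f -> bounded_lipschitz g ->
  bounded_lipschitz (fun x => f x + g x).
Proof.
move=> [K [K0 fK fL]] [L [L0 gK gL]]; exists (K + L); split.
- exact: addr_ge0.
- by move=> x; rewrite (le_trans (ler_normD _ _))// lerD.
- move=> x y; rewrite opprD addrACA mulrDl (le_trans (ler_normD _ _))//.
  by rewrite lerD.
Qed.

Lemma blN f : bounded_lipschitz f -> bounded_lipschitz (fun x => - f x).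
Proof.
move=> [K [K0 fK fL]]; exists K; split => // [x|x y]; first by rewrite normrN.
by rewrite -opprD normrN.
Qed.

Lemma blM f g : bounded_lipschitz f -> bounded_lipschitz g ->
  bounded_lipschitz (fun x => f x * g x).
Proof.
move=> [K [K0 fK fL]] [L [L0 gK gL]].
apply: (@bl_intro _ (K * L) (K * L + L * K)) => [x|x y].
  by rewrite normrM ler_pM.
have -> : f x * g x - f y * g y = (f x - f y) * g x + f y * (g x - g y) by ring.
have -> : (K * L + L * K) * `|x - y| = K * `|x - y| * L + K * (L * `|x - y|).
  by ring.
by apply: (le_trans (ler_normD _ _)); rewrite !normrM lerD// ler_pM.
Qed.

Lemma blB f g : bounded_lipschitz f -> bounded_lipschitz g ->
  bounded_lipschitz (fun x => f x - g x).
Proof. by move=> bf bg; exact: blD bf (blN bg). Qed.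

Lemma bl_prod (I : Type) (r : seq I) (F : I -> 'cV[R]_n -> R) :
  (forall i, bounded_lipschitz (F i)) ->
  bounded_lipschitz (fun x => \prod_(i <- r) F i x).
Proof.
move=> bF; elim: r => [|i r IH].
  by under eq_fun do rewrite big_nil; exact: bl_cst.
by under eq_fun do rewrite big_cons; apply: blM.
Qed.

Lemma bl_clip (u : 'cV[R]_n -> R) L :
  (forall x y, `|u x - u y| <= L * `|x - y|) ->
  bounded_lipschitz (fun x => clip (u x)).
Proof.
move=> uL; apply: (@bl_intro _ 1 L) => [x|x y]; first exact: norm_clip_le1.
exact: le_trans (clip_lip _ _) (uL _ _).
Qed.

Lemma norm_lip (x y : 'cV[R]_n) : `| `|x| - `|y| | <= `|x - y|.
Proof. exact: ler_dist_dist. Qed.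

Lemma bl_clip_norm (a : 'cV[R]_n) (s c : R) :
  bounded_lipschitz (fun x => clip (c + s * `|x - a|)).
Proof.
apply: (@bl_clip _ `|s|) => x y.
rewrite [c + _]addrC addrKA -mulrBr normrM ler_wpM2l//.
by rewrite (le_trans (norm_lip _ _))// opprB addrA subrK.
Qed.

Lemma bl_continuous f : bounded_lipschitz f -> continuous f.
Proof.
move=> [K [K0 fK fL]] x; apply/(@cvgrPdist_le _ _ _ (nbhs x)) => e e0.
near=> y; rewrite (le_trans (fL x y))//.
rewrite (@le_trans _ _ ((K + 1) * `|x - y|))//.
  by rewrite ler_wpM2r// lerDl.
rewrite mulrC -ler_pdivlMr ?ltr_wpDl//.
near: y; apply: (@cvgr_dist_le _ _ _ (nbhs x) _ id x) => //.
by rewrite divr_gt0// ltr_wpDl.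
Unshelve. all: by end_near. Qed.

Lemma continuous_measurable_cV f : continuous f -> measurable_fun setT f.
Proof.
move=> /continuousP cf; apply: (measurability _ (RGenOpens.measurableE R)).
move=> _ [_ [a [b ->] <-]]; rewrite setTI.
by apply: sub_sigma_algebra; exact/cf/interval_open.
Qed.

Lemma bl_bm f : bounded_lipschitz f -> bounded_measurable f.
Proof.
move=> bf; split; first exact: continuous_measurable_cV (bl_continuous bf).
by case: bf => K [_ fK _]; exists K.
Qed.

Lemma open_measurable_cV (A : set 'cV[R]_n) : open A -> measurable A.
Proof. exact: sub_sigma_algebra. Qed.

End bounded_lipschitz.

Lemma bl_comp (R : realType) m n (f : 'cV[R]_n -> R)
    (phi : 'cV[R]_m -> 'cV[R]_n) L : bounded_lipschitz f ->
  (forall x y, `|phi x - phi y| <= L * `|x - y|) ->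
  bounded_lipschitz (f \o phi).
Proof.
move=> [K [K0 fK fL]] pL; apply: (@bl_intro _ _ _ K (K * L)) => [x|x y] //=.
by rewrite (le_trans (fL _ _))// -mulrA ler_wpM2l.
Qed.

Lemma bl_shift (R : realType) n (f : 'cV[R]_n -> R) a :
  bounded_lipschitz f -> bounded_lipschitz (fun x => f (a + x)).
Proof.
move=> bf; apply: (bl_comp (L := 1) (phi := fun x => a + x) bf) => x y.
by rewrite opprD addrACA subrr add0r mul1r.
Qed.

Lemma bl_mulmx (R : realType) m n (f : 'cV[R]_n -> R) (A : 'M[R]_(n, m)) :
  bounded_lipschitz f -> bounded_lipschitz (fun x : 'cV[R]_m => f (A *m x)).
Proof.
move=> bf.
apply: (bl_comp (L := m%:R * `|A|) (phi := fun x => A *m x) bf) => x y.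
by rewrite -mulmxBr; exact: ler_mx_normM.
Qed.

(** * Borel sets of R^n and uniqueness of laws *)

Section borel_cV.
Context (R : realType) (n : nat).

Lemma dense_seq_cV : exists a : nat -> 'cV[R]_n,
  forall x e, 0 < e -> exists i, `|x - a i| < e.
Proof.
exists (fun i => if (choice.unpickle i : option 'cV[rat]_n) is Some q
                 then map_mx ratr q else 0).
move=> x e e0.
have /choice[q xq] : forall i, exists q : rat, `|x i 0 - ratr q| <= e / 2.
  move=> i; have /rat_in_itvoo[q] : x i 0 < x i 0 + e / 2.
    by rewrite ltrDl divr_gt0.
  rewrite in_itv/= => /andP[xq qx]; exists q.
  by rewrite distrC ger0_norm ?subr_ge0 ?(ltW xq)// lerBlDl ltW.
exists (choice.pickle (\col_i q i)); rewrite choice.pickleK.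
rewrite (@le_lt_trans _ _ (e / 2))//; last by rewrite ltr_pdivrMr// ltr_pMr// ltr1n.
apply: mx_norm_leP => [|i j]; first by rewrite divr_ge0// ltW.
by rewrite !mxE (ord1 j).
Qed.

Lemma ball_cVE (a : 'cV[R]_n) r : ball a r = [set x | `|x - a| < r].
Proof.
by rewrite -ball_normE; apply/seteqP; split => x /=; rewrite distrC.
Qed.

Lemma open_ball_cV (a : 'cV[R]_n) r : open [set x : 'cV[R]_n | `|x - a| < r].
Proof. by rewrite -ball_cVE; exact: ball_open. Qed.

Lemma measurable_ball_cV (a : 'cV[R]_n) r : measurable [set x : 'cV[R]_n | `|x - a| < r].
Proof. exact: open_measurable_cV (@open_ball_cV a r). Qed.

Lemma natSinv_lt (e : R) : 0 < e -> exists l : nat, l.+1%:R^-1 < e.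
Proof.
move=> e0; have [l _ /(_ l (leqnn _))] := near_infty_natSinv_lt (PosNum e0).
by exists l.
Qed.

Lemma open_bigcup_ball (O : set 'cV[R]_n) : open O ->
  exists (c : nat -> 'cV[R]_n) (r : nat -> R),
    O = \bigcup_k [set x | `|x - c k| < r k].
Proof.
have [a da] := dense_seq_cV => oO.
pose B (k : nat * nat) := [set x : 'cV[R]_n | `|x - a k.1| < k.2.+1%:R^-1].
pose u k : nat * nat := odflt (0%N, 0%N) (choice.unpickle k).
exists (fun k => a (u k).1).
(* A ball that is not contained in [O] gets radius [0], hence becomes empty. *)
exists (fun k => if `[< B (u k) `<=` O >] then (u k).2.+1%:R^-1 else 0).
apply/seteqP; split=> [x Ox|x [k _ /=]]; last first.
  by case: asboolP => [+ kx|_]; [exact|rewrite normr_lt0].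
have [e /= e0 eO] : nbhs_ball x O by apply/nbhs_ballP; exact: open_nbhs_nbhs.
have [l le] := @natSinv_lt (e / 2) (divr_gt0 e0 (ltr0Sn _ 1)).
have [i xi] := da x l.+1%:R^-1 ltac:(by rewrite invr_gt0 ltr0Sn).
exists (choice.pickle (i, l)) => //=; rewrite /u choice.pickleK/=.
rewrite asboolT// => y /= yi; apply: eO; rewrite -ball_normE/=.
rewrite (@le_lt_trans _ _ (`|x - a i| + `|y - a i|))//.
  by rewrite (le_trans _ (ler_normB _ _))// opprB addrA subrK.
by rewrite [ltRHS](splitr e) ltrD// ?(lt_trans xi)// (lt_trans yi).
Qed.

Lemma measurable_cV_ball d (T : measurableType d) (phi : T -> 'cV[R]_n) :
  (forall c r, measurable [set t | `|phi t - c| < r]) ->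
  measurable_fun setT phi.
Proof.
move=> mphi; apply: (@measurability _ _ T 'cV[R]_n setT phi open) => //.
move=> _ [B oB <-].
have [c [r ->]] := open_bigcup_ball oB; rewrite setTI preimage_bigcup.
by apply: bigcup_measurable => k _; exact: mphi.
Qed.

Lemma measurable_cVP d (T : measurableType d) (phi : T -> 'cV[R]_n) :
  measurable_fun setT phi <-> forall i, measurable_fun setT (fun t => phi t i 0).
Proof.
split=> [mphi i|mphi].
  apply: (@measurableT_comp _ _ _ _ _ _ (fun x : 'cV[R]_n => x i 0)) mphi.
  by apply: continuous_measurable_cV => x; exact: coord_continuous.
apply: measurable_cV_ball => c r.
(* For [n = 0] the intersection over the coordinates is everything, while a ball of nonpositive
   radius is empty: hence the case on [r]. *)
rewrite (_ : [set t | _] = if 0 < r then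
  \bigcap_(j in [set: 'I_n]) [set t | `|phi t j 0 - c j 0| < r]
  else set0).
  case: ifPn => // _; apply: fin_bigcap_measurable => // j _.
  rewrite -[X in measurable X]setTI.
  apply: (@measurable_fun_ltr _ _ _ setT (fun t => `|phi t j 0 - c j 0|)
    (fun=> r) _ _ measurableT [set true]) => //.
  by apply: measurableT_comp => //; exact: measurable_funB.
case: ifPn => [r0|]; last first.
  rewrite -leNgt => r0; apply/seteqP; split => // t /=.
  by move=> /(le_lt_trans (normr_ge0 _)); rewrite ltNge r0.
apply/seteqP; split => t /=.
  move=> tl j _; apply: le_lt_trans tl.
  by have := ler_mx_entry (phi t - c) j 0; rewrite !mxE.
move=> tl; have -> : `|phi t - c| =
  \big[Num.max/0]_ij `|(phi t - c) ij.1 ij.2| by exact: mx_normrE.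
apply/bigmax_ltP; split => // -[j z] _ /=.
by rewrite (ord1 z) !mxE; exact: tl.
Qed.

Lemma measurable_cVD d (T : measurableType d) (phi psi : T -> 'cV[R]_n) :
  measurable_fun setT phi -> measurable_fun setT psi ->
  measurable_fun setT (fun t => phi t + psi t).
Proof.
move=> /measurable_cVP mphi /measurable_cVP mpsi; apply/measurable_cVP => i.
by under eq_fun do rewrite mxE; exact: measurable_funD.
Qed.

Lemma measurable_cV_mulmx d (T : measurableType d) (A : 'M[R]_n)
    (phi : T -> 'cV[R]_n) :
  measurable_fun setT phi -> measurable_fun setT (fun t => A *m phi t).
Proof. by move=> mphi; apply: measurableT_comp (measurable_mulmx A) mphi. Qed.

Lemma measurable_cV_sum d (T : measurableType d) (I : Type) (r : seq I)
    (phi : I -> T -> 'cV[R]_n) : (forall i, measurable_fun setT (phi i)) ->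
  measurable_fun setT (fun t => \sum_(i <- r) phi i t).
Proof.
move=> mphi; elim: r => [|i r IH].
  by under eq_fun do rewrite big_nil; exact: measurable_cst.
by under eq_fun do rewrite big_cons; exact: measurable_cVD.
Qed.

(** [G] collects the Borel sets whose indicator is a pointwise limit of Lipschitz functions bounded
    by [1]. It is stable under intersection and contains the balls, since the indicator of the ball
    of radius [r] at [a] is the limit of [clip (k (r - |x - a|))]. Balls generate the Borel sets,
    and measures that agree on a generating pi-system coincide. *)
Lemma eq_prob_bl (P Q : probability 'cV[R]_n R) :
  (forall f, bounded_lipschitz f -> \int[P]_x f x = \int[Q]_x f x) ->
  forall B, measurable B -> P B = Q B.
Proof.
move=> PQ; pose G := [set B : set 'cV[R]_n | measurable B /\
  exists f : nat -> 'cV[R]_n -> R, [/\ forall k, bounded_lipschitz (f k),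
    forall k x, `|f k x| <= 1 & forall x, f k x @[k --> \oo] --> (\1_B x : R)]].
have GT : G setT.
  split => //; exists (fun _ _ => 1); split => [k|k x|x].
  - exact: bl_cst.
  - by rewrite normr1.
  - by rewrite indicT; exact: cvg_cst.
have Gball a r : G [set x | `|x - a| < r].
  split; first exact: measurable_ball_cV.
  exists (fun k x => clip (k%:R * r + (- k%:R) * `|x - a|)); split.
  - by move=> k; exact: bl_clip_norm.
  - by move=> k x; exact: norm_clip_le1.
  move=> x; rewrite indicE; case: (ltP `|x - a| r) => xa.
    rewrite mem_set//=; apply/cvgrPdist_le => e e0.
    have [N] := @natSinv_lt (r - `|x - a|) ltac:(by rewrite subr_gt0).
    move=> NE; near=> k; rewrite clip1 ?subrr ?normr0 ?(ltW e0)//.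
    rewrite mulNr -mulrBr; apply: (@le_trans _ _ (N.+1%:R * (r - `|x - a|))).
      by rewrite mulrC -ler_pdivrMr// div1r ltW.
    rewrite ler_wpM2r ?subr_ge0 ?(ltW xa)// ler_nat.
    by near: k; exists N.+1.
  rewrite memNset/=; last by apply/negP; rewrite -leNgt.
  rewrite (_ : (fun k => _) = fun=> 0); first exact: cvg_cst.
  by apply/funext => k; rewrite clip0// mulNr subr_le0 ler_wpM2l.
have GI : setI_closed G.
  move=> A B [mA [f [bf f1 fA]]] [mB [g [bg g1 gB]]].
  split; first exact: measurableI.
  exists (fun k x => f k x * g k x); split => [k|k x|x].
  - exact: blM.
  - by rewrite normrM mulr_ile1.
  - by rewrite indicI; exact: cvgM.
move=> B mB; apply: (@g_sigma_algebra_measure_unique _ _ _ G _ (fun=> setT)).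
- by move=> A [].
- by [].
- by rewrite bigcup_const//; exists 0%N.
- exact: GI.
- move=> A [mA [f [bf f1 fA]]].
  have QfA := Ex_cvg (P := Q) (fun k => (bl_bm (bf k)).1) f1 fA.
  have := Ex_cvg (P := P) (fun k => (bl_bm (bf k)).1) f1 fA.
  under eq_fun do rewrite PQ//.
  move=> /(cvg_unique (@norm_hausdorff _ _) QfA); rewrite !Ex_indic// => QP.
  by rewrite -[LHS]fineK ?fin_num_measure// -QP fineK ?fin_num_measure.
- by move=> k; rewrite (le_lt_trans (probability_le1 P measurableT))// ltry.
- have : borel_mx B -> <<s G >> B; last exact.
  apply: (smallest_sub (smallest_sigma_algebra setT G)) => O oO.
  have [c [r ->]] := open_bigcup_ball oO.
  by apply: sigma_algebra_bigcup => k; apply: sub_sigma_algebra.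
Unshelve. all: by end_near. Qed.

End borel_cV.

(** * Limit laws realized on the unit interval *)

Section unit_interval.
Context (R : realType).

Let mI : @measurable _ (measurableTypeR R) `[0, 1[%classic.
Proof. exact: measurable_itv. Qed.

(** The underlying space stays [R]: maps defined on it need no subtype, and the complement of [[0,
    1[] has mass [0]. *)
Definition leb01 : set (measurableTypeR R) -> \bar R :=
  mrestr (@lebesgue_measure R) mI.

HB.instance Definition _ :=
  Measure.copy leb01 (mrestr (@lebesgue_measure R) mI).

Let leb01T : leb01 setT = 1%E.
Proof.
by rewrite /leb01 /mrestr setTI lebesgue_measure_itv/= lte_fin ltr01 oppr0 adde0.
Qed.

HB.instance Definition _ := @Measure_isProbability.Build _ _ _ leb01 leb01T.

Lemma leb01_itv (a b : R) : 0 <= a -> a <= b -> b <= 1 ->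
  leb01 `[a, b[ = (b - a)%:E.
Proof.
move=> a0 ab b1; rewrite /leb01 /mrestr setIidl; last first.
  move=> x /=; rewrite !in_itv/= => /andP[ax xb].
  by rewrite (le_trans a0)//= (lt_le_trans xb).
rewrite lebesgue_measure_itv/= lte_fin; case: ifPn => //.
rewrite -leNgt => ba; have -> : a = b by apply/eqP; rewrite eq_le ab.
by rewrite subrr.
Qed.

End unit_interval.

(** The latest bit is at the head, so that prolonging a word is a [cons]; [rev] restores the order
    of the indices. *)
Fixpoint bword (c : nat -> bool) (l : nat) : seq bool :=
  if l is l'.+1 then c l' :: bword c l' else [::].

Lemma size_bword c l : size (bword c l) = l.
Proof. by elim: l => //= l ->. Qed.

Lemma nth_bword c l j : (j < l)%N -> nth false (rev (bword c l)) j = c j.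
Proof.
elim: l j => // l IH j; rewrite ltnS leq_eqVlt => /orP[/eqP ->|jl] /=.
  by rewrite rev_cons nth_rcons size_rev size_bword ltnn eqxx.
by rewrite rev_cons nth_rcons size_rev size_bword jl IH.
Qed.

(** The locally constant functions on the Cantor space. When real-valued, their expectations are
    finite combinations of probabilities of words, hence pass to limits word by word. *)
Definition finitely_many_bits (A : Type) (h : (nat -> bool) -> A) :=
  exists l, forall c c', (forall j, (j < l)%N -> c j = c' j) -> h c = h c'.

Section random_bits.
Context (R : realType).

Section one_space.
Context d (T : measurableType d) (P : probability T R) (c : T -> nat -> bool).
Hypothesis mc : forall j, measurable [set x | c x j].

Lemma measurable_bword w : measurable [set x | bword (c x) (size w) = w].
Proof.
elim: w => [|b w IH]; first by rewrite (_ : [set _ | _] = setT)//; exact/seteqP.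
have -> : [set x | bword (c x) (size (b :: w)) = b :: w] =
    (if b then [set x | c x (size w)] else ~` [set x | c x (size w)]) `&`
    [set x | bword (c x) (size w) = w].
  apply/seteqP; split=> [x /= [<- ->]|x].
    by split => //; case: ifP => //= /negP.
  by case: b => -[/= cx ->]; rewrite ?cx//; move/negP/negbTE : cx => ->.
by apply: measurableI => //; case: b => //; exact: measurableC.
Qed.

Lemma bword_sum (h : seq bool -> R) l x : h (bword (c x) l) =
  \sum_(w : l.-tuple bool) h w * \1_[set x | bword (c x) (size w) = w] x.
Proof.
have sz : size (bword (c x) l) == l by rewrite size_bword.
rewrite (bigD1 (Tuple sz))//= indicE mem_set//=; last by rewrite size_bword.
rewrite mulr1 big1 ?addr0// => w /eqP wx; rewrite indicE memNset ?mulr0//=.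
by rewrite size_tuple => xw; apply: wx; apply/val_inj.
Qed.

Lemma bm_bword (h : seq bool -> R) l :
  bounded_measurable (fun x => h (bword (c x) l)).
Proof.
under eq_fun do rewrite bword_sum.
apply: bm_sum => w _; apply: bmM; first exact: bm_cst.
exact: bm_indic (measurable_bword w).
Qed.

Lemma Ex_bword (h : seq bool -> R) l : \int[P]_x h (bword (c x) l) =
  \sum_(w : l.-tuple bool)
    h w * fine (P [set x | bword (c x) (size w) = w]).
Proof.
under eq_Rintegral do rewrite bword_sum.
rewrite Ex_sum => [|w]; last first.
  by apply: bmM; [exact: bm_cst|exact: bm_indic (measurable_bword w)].
apply: eq_bigr => w _; rewrite ExZ ?Ex_indic//; first exact: measurable_bword.
exact: bm_indic (measurable_bword w).
Qed.

Lemma bm_bits (h : (nat -> bool) -> R) : finitely_many_bits h ->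
  bounded_measurable (fun x => h (c x)).
Proof.
move=> [l hl]; rewrite (_ : (fun x => _) =
    fun x => (h \o (fun w => nth false (rev w))) (bword (c x) l)).
  exact: bm_bword.
by apply/funext => x; apply: hl => j jl; rewrite nth_bword.
Qed.

End one_space.

Section tree.
Variable p : seq bool -> R.
Hypothesis p_ge0 : forall w, 0 <= p w.
Hypothesis p_nil : p [::] = 1.
Hypothesis p_cons : forall w, p w = p (false :: w) + p (true :: w).

(* The words of length l, ordered lexicographically from their last letter,
   cut [0, 1[ into consecutive intervals of lengths p w; tree_left w is the
   left end of the interval of w. *)
Fixpoint tree_left (w : seq bool) : R :=
  if w is b :: w' then tree_left w' + (if b then p (false :: w') else 0) else 0.

(** Binary search for the interval that contains [u]; a boundary point goes to the right-hand
    interval, in accordance with intervals closed on the left. *)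
Fixpoint tree_word (u : R) (l : nat) : seq bool :=
  if l is l'.+1 then
    let w := tree_word u l' in (tree_left w + p (false :: w) <= u) :: w
  else [::].

Definition tree_bit (u : R) (j : nat) : bool := head false (tree_word u j.+1).

Lemma tree_wordE u l : tree_word u l = bword (tree_bit u) l.
Proof. by elim: l => //= l <-. Qed.

Lemma tree_left_itv w : 0 <= tree_left w /\ tree_left w + p w <= 1.
Proof.
elim: w => [|b w [IH1 IH2]] /=; first by rewrite p_nil add0r.
have := p_ge0 (false :: w); have := p_ge0 (true :: w); have := p_cons w.
by case: b => /=; lra.
Qed.

Lemma tree_word_itv w :
  [set u | tree_word u (size w) = w] `&` `[0, 1[%classic =
  `[tree_left w, tree_left w + p w[%classic.
Proof.
elim: w => [|b w IH].
  by rewrite /= p_nil add0r (_ : [set _ | _] = setT) ?setTI//; exact/seteqP.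
have p0 := p_ge0 (false :: w); have p1 := p_ge0 (true :: w).
have pw := p_cons w.
have /seteqP[IH1 IH2] := IH; apply/seteqP; split => u /=.
  move=> [[bE wE] u01]; have /= := IH1 u (conj wE u01).
  rewrite !in_itv/= => /andP[wu uw]; move: bE; rewrite wE => <-.
  by case: (leP (tree_left w + p (false :: w)) u) => H; apply/andP; split; lra.
rewrite in_itv/= => /andP[H1 H2].
have uw : u \in `[tree_left w, tree_left w + p w[.
  by rewrite in_itv/=; apply/andP; split; case: (b) H1 H2; lra.
have [/= -> u01] := IH2 u uw; split => //; congr cons.
by case: (b) H1 H2 => H1 H2; [apply/idP; lra|apply/negbTE; rewrite -ltNge; lra].
Qed.

Lemma measurable_tree_bit j : measurable [set u | tree_bit u j].
Proof.
rewrite /tree_bit /=.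
have mw w : measurable [set u | tree_word u (size w) = w].
  elim: w => [|b w IH].
    by rewrite (_ : [set _ | _] = setT)//; exact/seteqP.
  have -> : [set u | tree_word u (size (b :: w)) = b :: w] =
      [set u | (tree_left w + p (false :: w) <= u) = b] `&`
      [set u | tree_word u (size w) = w].
    by apply/seteqP; split=> [u /= [<- ->]|u /= [<- ->]].
  apply: measurableI => //; case: b.
    rewrite (_ : [set _ | _] = `[tree_left w + p (false :: w), +oo[%classic)//.
    by apply/seteqP; split => u /=; rewrite in_itv/= andbT.
  rewrite (_ : [set _ | _] = `]-oo, tree_left w + p (false :: w)[%classic)//.
  by apply/seteqP; split => u /=; rewrite in_itv/= ltNge; case: leP.
rewrite (_ : [set u | _] = \bigcup_(w in [set: j.-tuple bool])
    [set u | tree_word u (size (true :: w)) = true :: w]).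
  by apply: fin_bigcup_measurable => // w _; exact: (mw (true :: w)).
apply/seteqP; split => [u /= uj|u /= [w _]]; last by rewrite size_tuple => -[].
have sz : size (tree_word u j) == j by rewrite tree_wordE size_bword.
by exists (Tuple sz) => //=; rewrite (eqP sz) uj.
Qed.

Lemma leb01_tree_bit w :
  leb01 [set u | bword (tree_bit u) (size w) = w] = (p w)%:E.
Proof.
have mw : measurable [set u | bword (tree_bit u) (size w) = w].
  exact: measurable_bword measurable_tree_bit w.
have [l0 l1] := tree_left_itv w.
have -> : leb01 [set u | bword (tree_bit u) (size w) = w] =
    leb01 `[tree_left w, tree_left w + p w[.
  rewrite /leb01 /mrestr -tree_word_itv -setIA setIid.
  by congr (lebesgue_measure (_ `&` _)); apply/seteqP; split => u /=;
    rewrite tree_wordE.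
by rewrite leb01_itv// ?lerDl// addrC addKr.
Qed.

End tree.

(** The limits [p w] of the probabilities of words inherit total mass [1] and the additivity
    [p w = p (false :: w) + p (true :: w)], so the tree of intervals realizes them. This plays the
    part of a Kolmogorov extension, on an explicit space. *)
Lemma ultralimit_of_bits (I : Type) (F : set_system I) {FF : UltraFilter F}
    d (T : measurableType d) (P : I -> probability T R)
    (c : I -> T -> nat -> bool) :
  (forall k j, measurable [set x | c k x j]) ->
  exists b : R -> nat -> bool, (forall j, measurable [set u | b u j]) /\
    forall h : (nat -> bool) -> R, finitely_many_bits h ->
      \int[P k]_x h (c k x) @[k --> F] --> \int[@leb01 R]_u h (b u).
Proof.
move=> mc.
pose q k w := fine (P k [set x | bword (c k x) (size w) = w]).
have q01 k w : `|q k w| <= 1.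
  have mw := measurable_bword (mc k) w.
  rewrite ger0_norm ?fine_ge0// -lee_fin fineK ?fin_num_measure//.
  exact: probability_le1.
have /choice[p qp] : forall w, exists l : R, q k w @[k --> F] --> l.
  by move=> w; apply: (@ultra_cvg_real _ _ _ _ _ 1); exact: nearW.
have p0 w : 0 <= p w.
  rewrite -(cvg_lim (@norm_hausdorff _ _) (qp w)).
  apply: limr_ge; first by apply/cvg_ex; exists (p w).
  by apply: nearW => k; rewrite fine_ge0.
have pnil : p [::] = 1.
  apply: (cvg_unique (@norm_hausdorff _ _) (qp [::])).
  rewrite (_ : q ^~ [::] = fun=> 1); first exact: cvg_cst.
  apply/funext => k; rewrite /q (_ : [set _ | _] = setT) ?probability_setT//.
  exact/seteqP.
have pcons w : p w = p (false :: w) + p (true :: w).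
  apply: (cvg_unique (@norm_hausdorff _ _) (qp w)).
  rewrite (_ : q ^~ w = fun k => q k (false :: w) + q k (true :: w)).
    exact: cvgD.
  apply/funext => k; rewrite /q -fineD ?fin_num_measure//;
    try exact: measurable_bword.
  rewrite -measureU//; try exact: measurable_bword.
    congr (fine (P k _)); apply/seteqP; split => [x /= ->|x /=].
      by case: (c k x (size w)); [right|left].
    by case=> -[].
  by apply/seteqP; split => // x /= [[->] _ []].
exists (tree_bit p); split; first exact: measurable_tree_bit.
move=> h [l hl].
have hE (c' : nat -> bool) : h c' =
    (h \o (fun w => nth false (rev w))) (bword c' l).
  by apply: hl => j jl; rewrite nth_bword.
under eq_Rintegral do rewrite hE.
rewrite Ex_bword; last exact: measurable_tree_bit.
rewrite (_ : (fun k => _) = fun k => \sum_(w : l.-tuple bool)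
    (h \o (fun w => nth false (rev w))) w * q k w); last first.
  apply/funext => k; under eq_Rintegral do rewrite hE.
  by rewrite Ex_bword.
apply: cvg_sumr => w; apply: cvgM; first exact: cvg_cst.
by rewrite [X in fine X](leb01_tree_bit p0 pnil pcons w).
Qed.

End random_bits.

(** * Prokhorov's theorem along an ultrafilter *)

Section prokhorov.
Context (R : realType) (n : nat).

(** Otherwise, for every [N], some [x N] in the ball is [e]-far from the first [N] points. An
    ultrafilter limit of these has a neighbour [a i] within [e / 2], against the choice of [x N] for
    large [N]. *)
Lemma finite_net (a : nat -> 'cV[R]_n) (r e : R) :
  (forall x e, 0 < e -> exists i, `|x - a i| < e) -> 0 < e ->
  exists N, forall x, `|x| <= r -> exists2 i, (i < N)%N & `|x - a i| < e.
Proof.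
move=> da e0; apply: contrapT => /forallNP H.
have /choice[x xH] : forall N, exists x, `|x| <= r /\
    forall i, (i < N)%N -> e <= `|x - a i|.
  move=> N; have /existsNP[x] := H N; rewrite not_implyE => -[xr xN].
  exists x; split => // i iN; rewrite leNgt; apply/negP => xi.
  by apply: xN; exists i.
have [F [UF Foo]] := ultraFilterLemma eventually_filter.
have [y xy] : exists y : 'cV[R]_n, x k @[k --> F] --> y.
  by apply: (@ultra_cvg_mx _ _ _ _ _ _ _ r); apply: nearW => k; case: (xH k).
have [i yi] := da y (e / 2) (divr_gt0 e0 (ltr0Sn _ 1)).
have /filter_ex[k [ik yk]] : \forall k \near F, (i < k)%N /\ `|y - x k| <= e / 2.
  apply: filterI; first by apply: Foo; exists i.+1.
  by move/cvgrPdist_le : xy; apply; rewrite divr_gt0.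
have [_ /(_ _ ik)] := xH k; apply/negP; rewrite -ltNge.
rewrite [ltRHS](splitr e) (le_lt_trans _ (ler_ltD yk yi))//.
by rewrite [X in _ <= X + _]distrC (le_trans _ (ler_normD _ _))// addrA subrK.
Qed.

Lemma bm_clip_norm d (T : measurableType d) (Z : T -> 'cV[R]_n) (s : R) :
  measurable_fun setT Z -> bounded_measurable (fun x => clip (`|Z x| - s)).
Proof.
move=> mZ; apply: (bm_comp (f := fun z : 'cV[R]_n => clip (`|z| - s)) mZ).
apply: bl_bm; apply: (bl_clip (L := 1)) => x y.
by rewrite mul1r opprB addrA subrK norm_lip.
Qed.

Lemma dist4_le (w wa za z c : R) :
  `|w - wa| + `|wa - za| + `|z - za| <= c -> `|w - z| <= c.
Proof.
apply: le_trans; rewrite (distrC z).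
by rewrite (le_trans _ (lerD (ler_normD _ _) (lexx _)))// addrA subrK
  (le_trans _ (ler_normD _ _))// addrA subrK.
Qed.

Section approximation.
Variable a : nat -> 'cV[R]_n.
Hypothesis dense_a : forall x e, 0 < e -> exists i, `|x - a i| < e.

Definition net_code (i l : nat) : nat := choice.pickle (i, l).

Definition net_decode (k : nat) : nat * nat :=
  odflt (0%N, 0%N) (choice.unpickle k).

Lemma net_codeK i l : net_decode (net_code i l) = (i, l).
Proof. by rewrite /net_decode choice.pickleK. Qed.

Definition radius l : R := l.+1%:R^-1.

Lemma radius_gt0 l : 0 < radius l.
Proof. by rewrite invr_gt0 ltr0Sn. Qed.

Definition net_bits (x : 'cV[R]_n) (j : nat) : bool :=
  `|x - a (net_decode j).1| < radius (net_decode j).2.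

Lemma net_bits_code x i l : net_bits x (net_code i l) = (`|x - a i| < radius l).
Proof. by rewrite /net_bits net_codeK. Qed.

Lemma measurable_net_bits d (T : measurableType d) (Z : T -> 'cV[R]_n) j :
  measurable_fun setT Z -> measurable [set t | net_bits (Z t) j].
Proof.
move=> mZ; rewrite -[X in measurable X]setTI; apply: (mZ measurableT
  [set x : 'cV[R]_n | `|x - a (net_decode j).1| < radius (net_decode j).2]).
exact: measurable_ball_cV.
Qed.

Definition net_miss l N (v : nat -> bool) : bool :=
  ~~ has (fun i => v (net_code i l)) (iota 0 N).

(** A discretization that reads finitely many bits. The value [0] after a miss is a placeholder:
    tightness makes misses improbable. *)
Definition net_point l N (v : nat -> bool) : 'cV[R]_n :=
  if net_miss l N v then 0
  else a (find (fun i => v (net_code i l)) (iota 0 N)).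

Lemma eq_net (v v' : nat -> bool) l N :
  (forall j, (j < \sum_(i < N) (net_code i l).+1)%N -> v j = v' j) ->
  {in iota 0 N, (fun i => v (net_code i l)) =1 (fun i => v' (net_code i l))}.
Proof.
move=> vv' i; rewrite mem_iota add0n => /= iN.
by apply: vv'; rewrite (bigD1 (Ordinal iN))//=; exact: ltn_addr.
Qed.

Lemma finite_net_miss A l N (h : bool -> A) :
  finitely_many_bits (fun v => h (net_miss l N v)).
Proof.
exists (\sum_(i < N) (net_code i l).+1)%N => v v' /eq_net E.
by congr (h (~~ _)); exact: eq_in_has E.
Qed.

Lemma finite_net_point A l N (h : 'cV[R]_n -> A) :
  finitely_many_bits (fun v => h (net_point l N v)).
Proof.
exists (\sum_(i < N) (net_code i l).+1)%N => v v' /eq_net E; congr h.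
by rewrite /net_point /net_miss (eq_in_has E) (eq_in_find E).
Qed.

Lemma net_pointP l N v : ~~ net_miss l N v ->
  exists2 i, v (net_code i l) & net_point l N v = a i.
Proof.
move=> nb; rewrite /net_point (negbTE nb); move: nb; rewrite negbK => hN.
have := nth_find 0%N hN; rewrite nth_iota ?add0n.
  by exists (find (fun i => v (net_code i l)) (iota 0 N)).
by move: hN; rewrite has_find size_iota.
Qed.

Lemma net_missPn l N (v : nat -> bool) i : (i < N)%N -> v (net_code i l) -> ~~ net_miss l N v.
Proof.
by move=> iN vi; rewrite negbK; apply/hasP; exists i => //; rewrite mem_iota.
Qed.

(** Two ball memberships that the triangle inequality forbids. A clash is visible in finitely many
    bits and never happens for a genuine point, so its probability also vanishes in the limit. *)
Definition net_clash i l i' l' (v : nat -> bool) : bool :=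
  [&& v (net_code i l), v (net_code i' l') &
      radius l + radius l' < `|a i - a i'|].

Lemma finite_net_clash i l i' l' A (h : bool -> A) :
  finitely_many_bits (fun v => h (net_clash i l i' l' v)).
Proof.
exists (net_code i l + net_code i' l').+1 => v v' vv'.
by rewrite /net_clash !vv' ?ltnS ?leq_addl ?leq_addr.
Qed.

Lemma net_bits_clash x i l i' l' : ~~ net_clash i l i' l' (net_bits x).
Proof.
apply/negP => /and3P[]; rewrite !net_bits_code => H1 H2; apply/negP.
rewrite -leNgt (le_trans _ (ltW (ltrD H1 H2)))//.
rewrite [X in _ <= X + _]distrC (le_trans _ (ler_normD _ _))//.
by rewrite addrA subrK.
Qed.

(** Without clashes, centres claimed at level [k] stay within [radius k + radius l] of each one
    claimed at level [l]; a limit of them as [k] grows is the wanted point. The bound [+ 2] in the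
    proof comes from [radius <= 1]. *)
Lemma net_limit v : (forall l, exists N, ~~ net_miss l N v) ->
  (forall i l i' l', ~~ net_clash i l i' l' v) ->
  exists w, forall i l, v (net_code i l) -> `|w - a i| <= radius l.
Proof.
move=> nm nc.
have close i l i' l' : v (net_code i l) -> v (net_code i' l') ->
    `|a i - a i'| <= radius l + radius l'.
  by move=> vi vi'; have := nc i l i' l'; rewrite /net_clash vi vi'/= -leNgt.
have /choice[f vf] : forall l, exists i, v (net_code i l).
  by move=> l; have [N /net_pointP[i vi _]] := nm l; exists i.
have [F [UF Foo]] := ultraFilterLemma eventually_filter.
have [w fw] : exists w : 'cV[R]_n, a (f k) @[k --> F] --> w.
  apply: (@ultra_cvg_mx _ _ _ _ _ _ _ (`|a (f 0%N)| + 2)); apply: nearW => k.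
  have := close _ _ _ _ (vf k) (vf 0%N).
  have := lerB_dist (a (f k)) (a (f 0%N)).
  have r1 j : radius j <= 1 by rewrite /radius invf_le1 ?ltr0Sn// ler1n.
  by have := r1 k; have := r1 0%N; lra.
exists w => i l vi; apply/ler_addgt0Pr => e e0.
have [m me] := natSinv_lt (divr_gt0 e0 (ltr0Sn R 1)).
have /filter_ex[k [mk wk]] :
    \forall k \near F, (m <= k)%N /\ `|w - a (f k)| <= e / 2.
  apply: filterI; first by apply: Foo; exists m.
  by move/cvgrPdist_le : fw; apply; rewrite divr_gt0.
have km : radius k < e / 2.
  by apply: le_lt_trans me; rewrite lef_pV2 ?posrE ?ltr0Sn// ler_nat ltnS.
have := close _ _ _ _ (vf k) vi; have := ler_normD (w - a (f k)) (a (f k) - a i).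
by rewrite addrA subrK; lra.
Qed.

End approximation.

Section random_bits_sets.
Context d (T : measurableType d) (P : probability T R) (c : T -> nat -> bool).
Hypothesis mc : forall j, measurable [set x | c x j].
Variable E : (nat -> bool) -> bool.
Hypothesis finE : finitely_many_bits E.

Lemma finite_indic : finitely_many_bits (fun v => (E v)%:R : R).
Proof. by have [l El] := finE; exists l => v v' /El ->. Qed.

Lemma bits_indicE : (fun t => (E (c t))%:R) = \1_[set t | E (c t)] :> (T -> R).
Proof.
apply/funext => t; rewrite indicE; congr (nat_of_bool _)%:R.
by apply/idP/idP => [|/set_mem//]; move/mem_set.
Qed.

Lemma measurable_bits : measurable [set t | E (c t)].
Proof.
have -> : [set t | E (c t)] = setT `&` (fun t => (E (c t))%:R : R) @^-1` [set 1].
  apply/seteqP; split => t /=; first by move=> ->.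
  by case: (E (c t)) => // -[_ /eqP]; rewrite eq_sym oner_eq0.
by apply: (bm_bits mc finite_indic).1.
Qed.

Lemma Ex_bits : \int[P]_t ((E (c t))%:R : R) = fine (P [set t | E (c t)]).
Proof. by rewrite bits_indicE Ex_indic//; exact: measurable_bits. Qed.

End random_bits_sets.

(* The events `|Z - a i| < (l+1)^-1 for a dense sequence a determine Z; their
   limiting joint law is realized on [0, 1[, and the limit of Z is
   reconstructed from it. *)
Section reconstruction.
Context (I : Type) (F : set_system I) {FF : UltraFilter F}.
Context d (T : measurableType d) (P : I -> probability T R).
Variable Z : I -> T -> 'cV[R]_n.
Hypothesis mZ : forall k, measurable_fun setT (Z k).
Hypothesis tZ : forall e, 0 < e -> exists r : R,
  \forall k \near F, \int[P k]_x clip (`|Z k x| - r) <= e.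
Variable a : nat -> 'cV[R]_n.
Hypothesis dense_a : forall x e, 0 < e -> exists i, `|x - a i| < e.
Variable b : R -> nat -> bool.
Hypothesis mb : forall j, measurable [set u | b u j].
Hypothesis cb : forall h : (nat -> bool) -> R, finitely_many_bits h ->
  \int[P k]_x h (net_bits a (Z k x)) @[k --> F] --> \int[@leb01 R]_u h (b u).

Let mc k j : measurable [set x | net_bits a (Z k x) j].
Proof. exact: measurable_net_bits. Qed.

Let finm l N := @finite_net_miss bool l N id.

Let q l N k := \int[P k]_x ((net_miss l N (net_bits a (Z k x)))%:R : R).
Let qb l N := \int[@leb01 R]_u ((net_miss l N (b u))%:R : R).

Let qqb l N : q l N k @[k --> F] --> qb l N.
Proof.
exact: (cb (finite_net_miss l N (fun t : bool => t%:R))).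
Qed.

(** A point of norm at most [s + 1] is caught by the finite net, and beyond [s + 1] the function
    [clip (|x| - s)] equals [1]: the tightness integral dominates the probability of a miss. *)
Let small_miss l e : 0 < e ->
  exists N, (\forall k \near F, q l N k <= e) /\ qb l N <= e.
Proof.
move=> e0; have [s sP] := tZ e0.
have [N NP] := finite_net (s + 1) dense_a (radius_gt0 l).
have qe : \forall k \near F, q l N k <= e.
  apply: filterS sP => k; apply: le_trans; apply: le_Ex.
  - exact: (bm_bits (mc k) (finite_net_miss l N (fun t : bool => t%:R))).
  - exact: bm_clip_norm.
  - move=> x; case: (leP `|Z k x| (s + 1)) => [/NP[i iN xi]|sx].
      rewrite (negbTE (net_missPn iN _)) ?clip_ge0//.
      by rewrite net_bits_code.
    by rewrite clip1; [case: net_miss|lra].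
exists N; split => //; rewrite -(cvg_lim (@norm_hausdorff _ _) (@qqb l N)).
by apply: limr_le => //; apply/cvg_ex; exists (qb l N).
Qed.

Let null_bits (E : (nat -> bool) -> bool) : finitely_many_bits E ->
  (forall x, ~~ E (net_bits a x)) -> (@leb01 R).-negligible [set t | E (b t)].
Proof.
move=> finE nE; have mE := measurable_bits mb finE.
apply/negligibleP => //; have := cb (finite_indic finE).
rewrite (_ : (fun k => _) = fun=> 0); last first.
  apply/funext => k; under eq_Rintegral do rewrite (negbTE (nE _)).
  exact: Ex_cst.
move/(cvg_unique (@norm_hausdorff _ _) (cvg_cst _)).
have -> : \int[@leb01 R]_u ((E (b u))%:R : R) = fine (leb01 [set t | E (b t)]).
  exact: (Ex_bits (@leb01 R) mb finE).
have fE : leb01 [set t | E (b t)] \is a fin_num.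
  exact: (fin_num_measure (@leb01 R) _ mE).
by move=> E0; change (leb01 [set t | E (b t)] = 0%E); rewrite -(fineK fE) -E0.
Qed.

Let null_miss l : (@leb01 R).-negligible (\bigcap_N [set t | net_miss l N (b t)]).
Proof.
have mv : measurable (\bigcap_N [set t | net_miss l N (b t)] : set (measurableTypeR R)).
  by apply: bigcapT_measurable => N; exact: (measurable_bits mb (finm l N)).
apply/negligibleP => //; apply/eqP; rewrite eq_le measure_ge0 andbT.
apply/lee_addgt0Pr => e e0; rewrite add0e.
have [N [_ Ne]] := small_miss l e0.
apply: (@le_trans _ _ (leb01 [set t | net_miss l N (b t)])).
  apply: le_measure; rewrite ?inE//; first exact: (measurable_bits mb (finm l N)).
  by move=> t; apply.
have mE := measurable_bits mb (finm l N).
have fE : leb01 [set t | net_miss l N (b t)] \is a fin_num.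
  exact: (fin_num_measure (@leb01 R) _ mE).
rewrite -(fineK fE) lee_fin; apply: le_trans Ne.
by rewrite /qb (Ex_bits (@leb01 R) mb (finm l N)).
Qed.

Let exceptional : exists N0 : set (measurableTypeR R), [/\ measurable N0,
  leb01 N0 = 0%E & forall t, ~ N0 t ->
    (forall l, exists N, ~~ net_miss l N (b t)) /\
    (forall i l i' l', ~~ net_clash a i l i' l' (b t))].
Proof.
pose B j : set (measurableTypeR R) := [set t | net_clash a (net_decode (net_decode j).1).1
  (net_decode (net_decode j).1).2 (net_decode (net_decode j).2).1
  (net_decode (net_decode j).2).2 (b t)].
have nB j : (@leb01 R).-negligible (B j).
  apply: (null_bits (finite_net_clash a _ _ _ _ id)) => x.
  exact: net_bits_clash.
have := negligibleU (negligible_bigcup null_miss) (negligible_bigcup nB).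
move=> [N0 [mN0 N00 sub]]; exists N0; split => // t nt.
have /not_orP[n1 n2] : ~ ((\bigcup_k \bigcap_N [set t | net_miss k N (b t)]) t
    \/ (\bigcup_k B k) t) by move=> H; exact/nt/sub.
split=> [l|i l i' l'].
  apply: contrapT => /forallNP H; apply: n1; exists l => // N _ /=.
  by apply: contrapT => /negP; exact: H.
apply/negP => H; apply: n2.
exists (net_code (net_code i l) (net_code i' l')) => //.
by rewrite /B /mkset net_codeK /fst /snd !net_codeK.
Qed.

Lemma prokhorov_net : exists W : R -> 'cV[R]_n,
  measurable_fun (setT : set (measurableTypeR R)) W /\
  forall f, bounded_lipschitz f ->
    \int[P k]_x f (Z k x) @[k --> F] --> \int[@leb01 R]_u f (W u).
Proof.
have [N0 [mN0 N00 N0P]] := exceptional.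
have /choice[W WP] : forall t, exists w : 'cV[R]_n, (N0 t -> w = 0) /\
    (~ N0 t -> forall i l, b t (net_code i l) -> `|w - a i| <= radius l).
  move=> t; have [nt|nt] := pselect (N0 t); first by exists 0.
  have [h1 h2] := N0P t nt; have [w wP] := net_limit h1 h2.
  by exists w.
have [E1 E2] : (forall l N, measurable [set t | net_miss l N (b t)]) /\
    (forall l N, measurable_fun (setT : set (measurableTypeR R))
       (fun t => net_point a l N (b t))).
  split=> l N; first exact: (measurable_bits mb (finm l N)).
  apply/measurable_cVP => i.
  exact: (bm_bits mb (finite_net_point a l N (fun x => x i 0))).1.
have mW : measurable_fun (setT : set (measurableTypeR R)) W.
  apply: measurable_cV_ball => c r.
  (* Outside the null set, [W t] lies in the ball of centre [c] and radius [r] exactly when some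
     claimed small ball fits inside it; this is a countable condition on bits. *)
  rewrite (_ : [set t | _] = (N0 `&` [set t | `|0 - c| < r]) `|`
      (~` N0 `&` \bigcup_k [set t | b t (net_code (net_decode k).1 (net_decode k).2) &&
        (`|a (net_decode k).1 - c| + radius (net_decode k).2 < r)])).
    apply: measurableU; apply: measurableI => //.
    - case: (boolP (`|0 - c| < r)) => cr.
        by rewrite (_ : [set _ | _] = setT)//; exact/seteqP.
      by rewrite (_ : [set _ | _] = set0)//; apply/seteqP; split.
    - exact: measurableC.
    - apply: bigcupT_measurable => k; case: (boolP (_ + _ < r)) => kr.
        rewrite (_ : [set t | _] =
          [set t | b t (net_code (net_decode k).1 (net_decode k).2)]).
          exact: mb.
        by apply/seteqP; split => t /=; rewrite andbT.
      by rewrite (_ : [set t | _] = set0)//; apply/seteqP; split => t //=; rewrite andbF.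
  apply/seteqP; split => t /=.
    move=> Wt; have [nt|nt] := pselect (N0 t).
      by left; split => //; move: Wt; rewrite (WP t).1.
    right; split => //.
    have [l ll] := natSinv_lt (divr_gt0 (ltac:(by rewrite subr_gt0; exact: Wt) :
      0 < r - `|W t - c|) (ltr0Sn R 1)).
    have [N mN] := (N0P t nt).1 l; have [i bi _] := net_pointP a mN.
    exists (net_code i l) => //=; rewrite net_codeK/= bi/=.
    have := (WP t).2 nt i l bi; rewrite distrC => Wi.
    have := ler_normD (a i - W t) (W t - c); rewrite addrA subrK.
    by move: ll Wi; rewrite -/(radius l); lra.
  case=> [[nt ct]|[nt [k _ /= /andP[bk kr]]]]; first by rewrite (WP t).1.
  have := ler_normD (W t - a (net_decode k).1) (a (net_decode k).1 - c).
  by rewrite addrA subrK; have := (WP t).2 nt _ _ bk; lra.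
have bW f' : bounded_lipschitz f' -> bounded_measurable (f' \o W).
  by move=> bf'; apply: (bm_comp mW); exact: bl_bm.
exists W; split => // f bf; have [K [K0 fK fL]] := bf.
have near_point l N (v : nat -> bool) w : (forall i, v (net_code i l) -> `|w - a i| <= radius l) ->
    `|f w - f (net_point a l N v)| <= K * radius l + 2 * K * (net_miss l N v)%:R.
  move=> wP; case: (boolP (net_miss l N v)) => [_|mN]; last first.
    have [i vi ->] := net_pointP a mN.
    by rewrite mulr0 addr0 (le_trans (fL _ _))// ler_wpM2l// wP.
  rewrite mulr1 (le_trans (ler_normB _ _))//.
  have := fK w; have := fK (net_point a l N v).
  by have := mulr_ge0 K0 (ltW (radius_gt0 l)); lra.
have bpZ l N k : bounded_measurable
    (fun x => f (net_point a l N (net_bits a (Z k x)))).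
  exact: (bm_bits (mc k) (finite_net_point a l N f)).
have bpb l N : bounded_measurable
    (fun t : measurableTypeR R => f (net_point a l N (b t))).
  exact: (bm_bits mb (finite_net_point a l N f)).
have bmZ l N k : bounded_measurable
    (fun x => (net_miss l N (net_bits a (Z k x)))%:R : R).
  exact: (bm_bits (mc k) (finite_net_miss l N (fun t : bool => t%:R))).
have bmb l N : bounded_measurable
    (fun t : measurableTypeR R => (net_miss l N (b t))%:R : R).
  exact: (bm_bits mb (finite_net_miss l N (fun t : bool => t%:R))).
have bfZ k : bounded_measurable (fun x => f (Z k x)).
  by apply: (bm_comp (mZ k)); exact: bl_bm.
have ZE l N k : `|\int[P k]_x f (Z k x) -
    \int[P k]_x f (net_point a l N (net_bits a (Z k x)))| <=
    K * radius l + 2 * K * q l N k.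
  rewrite -ExB// -ExZ// -(Ex_cst (P k) (K * radius l)) -ExD//; last 2 first.
    exact: bm_cst.
    by apply: bmM => //; exact: bm_cst.
  apply: le_norm_Ex; first exact: bmB.
    by apply: bmD; [exact: bm_cst|apply: bmM => //; exact: bm_cst].
  by move=> x; apply: near_point => i; rewrite net_bits_code => /ltW.
have WE l N : `|\int[@leb01 R]_t f (W t) -
    \int[@leb01 R]_t f (net_point a l N (b t))| <= K * radius l + 2 * K * qb l N.
  have -> : K * radius l + 2 * K * qb l N =
      \int[@leb01 R]_t (K * radius l + 2 * K * (net_miss l N (b t))%:R
                          + 2 * K * \1_N0 t).
    rewrite ExD; last 2 first.
    - by apply: bmD; [exact: bm_cst|apply: bmM => //; exact: bm_cst].
    - by apply: bmM; [exact: bm_cst|exact: bm_indic].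
    rewrite ExZ ?Ex_indic//; last exact: bm_indic.
    rewrite [X in fine X]N00 mulr0 addr0 ExD; last 2 first.
    - exact: bm_cst.
    - by apply: bmM => //; exact: bm_cst.
    by rewrite Ex_cst ExZ.
  rewrite -ExB//; last exact: bW.
  apply: le_norm_Ex.
  - by apply: bmB => //; exact: bW.
  - by apply: bmD; [apply: bmD; [exact: bm_cst|apply: bmM => //; exact: bm_cst]|
      apply: bmM; [exact: bm_cst|exact: bm_indic]].
  move=> t; rewrite indicE; case: (boolP (t \in N0)) => [_|/negP nt].
    rewrite (le_trans (ler_normB _ _))//.
    have := fK (W t); have := fK (net_point a l N (b t)).
    have := mulr_ge0 K0 (ltW (radius_gt0 l)).
    by case: (net_miss l N (b t)) => /=; rewrite ?mulr0 ?mulr1; lra.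
  rewrite mulr0 addr0; apply: near_point => i.
  by apply: (WP t).2 => /mem_set.
apply/cvgrPdist_le => e e0.
(* Each of the two discretizations costs at most [3 K e'], and the limit on finitely many bits costs
   [e / 4]; with [8 K e' <= e] the total is at most [e]. *)
pose e' := e / (8 * (K + 1)).
have e'0 : 0 < e' by rewrite divr_gt0// mulr_gt0// ltr_wpDl.
have Ke' : 8 * K * e' <= e.
  rewrite /e' mulrA ler_pdivrMr ?mulr_gt0 ?ltr_wpDl//; lra.
have [l ll] := natSinv_lt e'0; rewrite -/(radius l) in ll.
have [N [qN qbN]] := small_miss l e'0.
have /cvgrPdist_le /(_ _ (divr_gt0 e0 (ltr0Sn R 3))) :=
  cb (finite_net_point a l N f).
have Kr : K * radius l <= K * e' by rewrite ler_wpM2l// ltW.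
have Kqb : K * qb l N <= K * e' by rewrite ler_wpM2l.
apply: filterS2 qN => k qk.
have Kq : K * q l N k <= K * e' by rewrite ler_wpM2l.
move=> H; apply: (dist4_le (le_trans (lerD (lerD (WE l N) H) (ZE l N k)) _)).
move: Kr Kqb Kq Ke'; move: (K * radius l) (qb l N) (q l N k) => x y z.
by rewrite -mulrA; move: (K * e') => t; rewrite -!mulrA; lra.
Qed.

End reconstruction.

Theorem prokhorov (I : Type) (F : set_system I) {FF : UltraFilter F}
    d (T : measurableType d) (P : I -> probability T R)
    (Z : I -> T -> 'cV[R]_n) :
  (forall k, measurable_fun setT (Z k)) ->
  (forall e, 0 < e -> exists r : R,
     \forall k \near F, \int[P k]_x clip (`|Z k x| - r) <= e) ->
  exists W : R -> 'cV[R]_n,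
    measurable_fun (setT : set (measurableTypeR R)) W /\
    forall f, bounded_lipschitz f ->
      \int[P k]_x f (Z k x) @[k --> F] --> \int[@leb01 R]_u f (W u).
Proof.
move=> mZ tZ; have [a da] := @dense_seq_cV R n.
have [|b [mb cb]] := @ultralimit_of_bits R _ F _ _ _ P
    (fun k x => net_bits a (Z k x)).
  by move=> k j; exact: measurable_net_bits.
exact: (prokhorov_net mZ tZ da mb cb).
Qed.

End prokhorov.

(** * Convolution factors *)

Section laws_of_vectors.
Context (R : realType) (n : nat).

Lemma clip_subadd (a b : R) : clip (a + b) <= clip a + clip b.
Proof.
rewrite /clip; case: (leP 1 a) => a1; case: (leP 1 b) => b1;
  case: (leP 1 (a + b)) => ab1; rewrite ?(max_r (@ler01 R));
  try (case: (leP 0 a) => a0); try (case: (leP 0 b) => b0);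
  try (case: (leP 0 (a + b)) => ab0); lra.
Qed.

Lemma tight_vector d (T : measurableType d) (P : probability T R)
    (Z : T -> 'cV[R]_n) (e : R) : measurable_fun setT Z -> 0 < e ->
  exists r, 0 <= r /\ \int[P]_x clip (`|Z x| - r) <= e.
Proof.
move=> mZ e0.
have : \int[P]_x clip (`|Z x| - k%:R) @[k --> \oo] --> \int[P]_x (0 : R).
  apply: (@Ex_cvg R _ _ P _ _ 1) => [k|k x|x].
  - by case: (bm_clip_norm k%:R mZ).
  - exact: norm_clip_le1.
  - apply/cvgrPdist_le => e' e'0.
    near=> k; rewrite clip0 ?subrr ?normr0 ?(ltW e'0)// subr_le0.
    near: k; exists (Num.truncn `|Z x|).+1 => // k /= kx.
    by rewrite (le_trans (ltW (truncnS_gt _)))// ler_nat.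
move=> /cvgrPdist_le/(_ e e0)[k _ /(_ k (leqnn k))].
rewrite Ex_cst sub0r normrN => H; exists k%:R; split => //.
by rewrite (le_trans _ H)// ler_norm.
Unshelve. all: by end_near. Qed.

(** [psi i] is [1] within [e] of [a i] and [0] beyond [2 e]. Weighting it by the product of the
    earlier [1 - psi j] makes the sum telescope to [1] minus the full product, without dividing by a
    sum. The full product vanishes where the net covers, in particular for [|x| <= r + 1], which
    leaves the [clip] term. *)
Lemma partition_of_unity (r e : R) : 0 < e ->
  exists N (phi : nat -> 'cV[R]_n -> R) (a : nat -> 'cV[R]_n),
    (forall i, bounded_lipschitz (phi i)) /\
    forall (f : 'cV[R]_n -> R) (K : R), (forall x, `|f x| <= K) ->
      (forall x y, `|f x - f y| <= K * `|x - y|) -> forall x y,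
      `|f (x + y) - \sum_(i < N) phi i x * f (a i + y)|
        <= K * (2 * e) + K * clip (`|x| - r).
Proof.
move=> e0; have [a da] := @dense_seq_cV R n.
have [N NP] := finite_net (r + 1) da e0.
pose psi i x : R := clip (2 + (- e^-1) * `|x - a i|).
have psi01 i x : 0 <= psi i x <= 1 by rewrite clip_ge0 clip_le1.
pose phi i x := psi i x * \prod_(j < i) (1 - psi j x).
have blpsi i : bounded_lipschitz (psi i) by exact: bl_clip_norm.
exists N, phi, a; split.
  move=> i; apply: blM => //; apply: bl_prod => j.
  by apply: blB => //; exact: bl_cst.
move=> f K fK fL x y.
have K0 : 0 <= K by rewrite (le_trans _ (fK 0)).
have sumE m : \sum_(i < m) phi i x = 1 - \prod_(j < m) (1 - psi j x).
  elim: m => [|m IH]; first by rewrite !big_ord0 subrr.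
  by rewrite !big_ord_recr/= IH /phi; ring.
have prod01 m : 0 <= \prod_(j < m) (1 - psi j x) <= 1.
  elim: m => [|m /andP[IH0 IH1]]; first by rewrite big_ord0 ler01 lexx.
  have /andP[p0 p1] := psi01 m x.
  by rewrite big_ord_recr/= mulr_ge0 ?subr_ge0// mulr_ile1 ?subr_ge0// lerBlDl lerDr.
have phi0 i : 0 <= phi i x.
  by apply: mulr_ge0; [case/andP: (psi01 i x)|case/andP: (prod01 i)].
have near_a i : phi i x * `|f (x + y) - f (a i + y)| <= phi i x * (K * (2 * e)).
  case: (leP `|x - a i| (2 * e)) => [xa|xa].
    rewrite ler_wpM2l// (le_trans (fL _ _))// ler_wpM2l//.
    by rewrite opprD addrACA subrr addr0.
  rewrite /phi (_ : psi i x = 0) ?mul0r//.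
  by rewrite /psi clip0// mulNr subr_le0 mulrC ler_pdivlMr// ltW.
have -> : f (x + y) - \sum_(i < N) phi i x * f (a i + y) =
    \sum_(i < N) phi i x * (f (x + y) - f (a i + y)) +
    (\prod_(j < N) (1 - psi j x)) * f (x + y).
  rewrite [in RHS](eq_bigr (fun i : 'I_N =>
    phi i x * f (x + y) - phi i x * f (a i + y))) => [|i _]; last first.
    by rewrite mulrBr.
  by rewrite sumrB -mulr_suml sumE; ring.
rewrite (le_trans (ler_normD _ _))// lerD//.
  rewrite (le_trans (ler_norm_sum _ _ _))//.
  apply: (@le_trans _ _ (\sum_(i < N) phi i x * (K * (2 * e)))).
    by apply: ler_sum => i _; rewrite normrM ger0_norm.
  rewrite -mulr_suml sumE ler_piMl ?mulr_ge0 ?(ltW e0)//.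
  by rewrite lerBlDl lerDr; case/andP: (prod01 N).
rewrite normrM ger0_norm; last by case/andP: (prod01 N).
rewrite mulrC ler_pM//; first by case/andP: (prod01 N).
case: (leP `|x| (r + 1)) => [/NP[i iN xi]|xr].
  rewrite (bigD1 (Ordinal iN))//= (_ : psi i x = 1) ?subrr ?mul0r ?clip_ge0//.
  by rewrite /psi clip1// mulNr lerBrDr addrC -lerBrDr mulrC ler_pdivrMr//;
    rewrite addrK mul1r ltW.
by rewrite [in leRHS]clip1; [case/andP: (prod01 N)|lra].
Qed.

Lemma bl_Ex (Q : probability 'cV[R]_n R) (f : 'cV[R]_n -> R) :
  bounded_lipschitz f -> bounded_lipschitz (fun x => \int[Q]_y f (x + y)).
Proof.
move=> bf; have [K [K0 fK fL]] := bf.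
have bs (x : 'cV[R]_n) : bounded_measurable (fun y => f (x + y)).
  exact: bl_bm (bl_shift x bf).
apply: (@bl_intro _ _ _ K K) => [x|x y]; first exact: norm_Ex_le.
rewrite -ExB//; apply: norm_Ex_le; first exact: bmB.
by move=> z; rewrite (le_trans (fL _ _))// opprD addrACA subrr addr0.
Qed.

Lemma bm_mulmx_add (f : 'cV[R]_n -> R) (A B : 'M[R]_n) : bounded_lipschitz f ->
  bounded_measurable (fun z : 'cV[R]_n * 'cV[R]_n => f (A *m z.1 + B *m z.2)).
Proof.
move=> bf; apply: (bm_comp (phi := fun z => A *m z.1 + B *m z.2)).
  by apply: measurable_cVD; apply: measurable_cV_mulmx.
exact: bl_bm.
Qed.

(** Slutsky's argument: for [|Y k| <= r + 1] the change of matrix costs at most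
    [K n (r + 1) |M - M_ k|], and the mass outside is controlled through the tightness of the limit
    [mu]. *)
Lemma cvg_law_mulmx (I : Type) (F : set_system I) {FF : ProperFilter F}
    d (T : measurableType d) (P : I -> probability T R)
    (Y : I -> T -> 'cV[R]_n) (mu : probability 'cV[R]_n R)
    (M_ : I -> 'M[R]_n) (M : 'M[R]_n) :
  (forall k, measurable_fun setT (Y k)) ->
  (forall f, bounded_lipschitz f ->
     \int[P k]_x f (Y k x) @[k --> F] --> \int[mu]_x f x) ->
  M_ k @[k --> F] --> M ->
  forall f, bounded_lipschitz f ->
     \int[P k]_x f (M_ k *m Y k x) @[k --> F] --> \int[mu]_x f (M *m x).
Proof.
move=> mY cY cM f bf; have [K [K0 fK fL]] := bf.
have bfM k B : bounded_measurable (fun x => f (B *m Y k x)).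
  by apply: (bm_comp (mY k) (f := fun x => f (B *m x))); exact/bl_bm/bl_mulmx.
apply/cvgrPdist_le => e e0.
(* The tail of [mu], [e / (3 (2 K + 1))], and the error [e / (6 (2 K + 1))] in passing to [Y k] add
   up to [e / (2 (2 K + 1))], so the tail costs at most [e / 2]; the two other terms cost [e / 12]
   each. *)
have e30 : 0 < e / (3 * (2 * K + 1)).
  by rewrite divr_gt0// mulr_gt0// ltr_wpDl// mulr_ge0.
have [r [r0 rP]] := @tight_vector _ _ mu id _ (@measurable_id _ _ _) e30.
have blr : bounded_lipschitz (fun x : 'cV[R]_n => clip (`|x| - r)).
  by apply: (bl_clip (L := 1)) => x y; rewrite mul1r opprB addrA subrK norm_lip.
have e60 : 0 < e / (6 * (2 * K + 1)).
  by rewrite divr_gt0// mulr_gt0// ltr_wpDl// mulr_ge0.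
have /cvgrPdist_le/(_ _ e60) c1 := cY _ blr.
have /cvgrPdist_le/(_ (e / 12)) c2 := cY _ (bl_mulmx M bf).
have e12 : 0 < e / 12 by rewrite divr_gt0.
have {}c2 := c2 e12.
pose c := K * (n%:R * (r + 1)) + 1.
have c0 : 0 < c by rewrite ltr_wpDl// !mulr_ge0// addr_ge0.
have e12c : 0 < e / (12 * c) by rewrite divr_gt0// mulr_gt0.
move/cvgrPdist_le : cM => /(_ _ e12c) c3.
near=> k.
have d1 : `|\int[P k]_x f (M *m Y k x) - \int[P k]_x f (M_ k *m Y k x)| <=
    K * (n%:R * (r + 1)) * `|M - M_ k| + 2 * K * \int[P k]_x clip (`|Y k x| - r).
  rewrite -ExB// -ExZ; last exact: bm_clip_norm.
  rewrite -(Ex_cst (P k) (K * _ * _)) -ExD; last 2 first.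
  - exact: bm_cst.
  - by apply: bmM; [exact: bm_cst|exact: bm_clip_norm].
  apply: le_norm_Ex; first exact: bmB.
    apply: bmD; first exact: bm_cst.
    by apply: bmM; [exact: bm_cst|exact: bm_clip_norm].
  move=> x; case: (leP `|Y k x| (r + 1)) => Yr.
    rewrite (le_trans (fL _ _))// -mulmxBl.
    rewrite -[leLHS]addr0 lerD ?mulr_ge0 ?clip_ge0//.
    rewrite -mulrA ler_wpM2l// (le_trans (ler_mx_normM _ _))//.
    by rewrite -!mulrA ler_wpM2l// mulrC ler_wpM2r.
  rewrite clip1 ?mulr1; last lra.
  rewrite (le_trans (ler_normB _ _))//.
  have := fK (M *m Y k x); have := fK (M_ k *m Y k x).
  suff : 0 <= K * (n%:R * (r + 1)) * `|M - M_ k| by lra.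
  by rewrite !mulr_ge0// addr_ge0.
have h1 : `|\int[mu]_x clip (`|x| - r) - \int[P k]_x clip (`|Y k x| - r)| <=
    e / (6 * (2 * K + 1)) by near: k.
have h2 : `|\int[mu]_x f (M *m x) - \int[P k]_x f (M *m Y k x)| <= e / 12.
  by near: k.
have h3 : `|M - M_ k| <= e / (12 * c) by near: k.
rewrite -[X in `|X|](subrKA (\int[P k]_x f (M *m Y k x))).
rewrite (le_trans (ler_normD _ _))// (le_trans (lerD h2 d1))//.
have i1 : K * (n%:R * (r + 1)) * `|M - M_ k| <= e / 12.
  apply: (@le_trans _ _ (c * (e / (12 * c)))).
    by rewrite ler_pM// ?mulr_ge0 ?addr_ge0// /c lerDl.
  have -> : c * (e / (12 * c)) = e / 12 by field; rewrite gt_eqF.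
  by [].
have i2 : \int[P k]_x clip (`|Y k x| - r) <= e / (2 * (2 * K + 1)).
  move: h1 rP; rewrite ler_norml => /andP[+ _].
  have -> : e / (2 * (2 * K + 1)) = e / (3 * (2 * K + 1)) + e / (6 * (2 * K + 1)).
    by field; rewrite gt_eqF// ltr_wpDl// mulr_ge0.
  by rewrite lerBrDr addrC lerBlDr => H1 H2; rewrite (le_trans H1)// lerD2r.
have i3 : 2 * K * \int[P k]_x clip (`|Y k x| - r) <= e / 2.
  apply: (@le_trans _ _ ((2 * K + 1) * (e / (2 * (2 * K + 1))))).
    rewrite ler_pM ?mulr_ge0 ?lerDl//.
    by apply: Rintegral_ge0 => x _; exact: clip_ge0.
  have -> : (2 * K + 1) * (e / (2 * (2 * K + 1))) = e / 2.
    by field; rewrite gt_eqF// ltr_wpDl// mulr_ge0.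
  by [].
rewrite (le_trans (lerD (lexx _) (lerD i1 i3)))//.
by move: e0; clear; lra.
Unshelve. all: by end_near. Qed.

End laws_of_vectors.

Section factor_limit.
Context (R : realType) (n : nat).

Lemma cvg_norm_le (I : Type) (F : set_system I) {FF : ProperFilter F}
    (a b : I -> R) (x y : R) : a k @[k --> F] --> x -> b k @[k --> F] --> y ->
  (\forall k \near F, `|a k| <= b k) -> `|x| <= y.
Proof.
move=> /cvg_norm ax bY ab.
have ba : b k - `|a k| @[k --> F] --> y - `|x| by exact: cvgB.
rewrite -subr_ge0 -(cvg_lim (@norm_hausdorff _ _) ba).
apply: limr_ge; first exact: cvgP ba.
by apply: filterS ab => k; rewrite subr_ge0.
Qed.

Lemma bm_of_bl_comp d (T : measurableType d) (phi : T -> 'cV[R]_n)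
    (f : 'cV[R]_n -> R) :
  measurable_fun setT phi -> bounded_lipschitz f ->
  bounded_measurable (fun t => f (phi t)).
Proof. by move=> mphi bf; exact: (bm_comp mphi (bl_bm bf)). Qed.

(* f (x + y) is approximated uniformly on compacts by sum_i phi_i x f (a_i + y)
   for a partition of unity (phi_i), which reduces joint limits to products. *)
Theorem factor_limit (I : Type) (F : set_system I) {FF : UltraFilter F}
    d (T : measurableType d) (P : I -> probability T R)
    (U V : I -> T -> 'cV[R]_n) (mu : probability 'cV[R]_n R) (A B : 'M[R]_n) :
  (forall k, measurable_fun setT (U k)) ->
  (forall k, measurable_fun setT (V k)) ->
  (forall f, bounded_lipschitz f ->
     \int[P k]_x f (U k x) @[k --> F] --> \int[mu]_x f (A *m x)) ->
  (forall f, bounded_lipschitz f ->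
     \int[P k]_x f (U k x + V k x) @[k --> F] --> \int[mu]_x f (B *m x)) ->
  (forall f g, bounded_lipschitz f -> bounded_lipschitz g ->
     \int[P k]_x (f (U k x) * g (V k x)) -
       \int[P k]_x f (U k x) * \int[P k]_x g (V k x) @[k --> F] --> (0 : R)) ->
  exists nu : probability 'cV[R]_n R,
    (forall g, bounded_lipschitz g ->
       \int[P k]_x g (V k x) @[k --> F] --> \int[nu]_x g x) /\
    (forall f, bounded_lipschitz f ->
       \int[mu]_x f (B *m x) = \int[mu]_x \int[nu]_y f (A *m x + y)).
Proof.
move=> mU mV cU cUV cov.
have bln r : bounded_lipschitz (fun x : 'cV[R]_n => clip (`|x| - r)).
  by apply: (bl_clip (L := 1)) => x y; rewrite mul1r opprB addrA subrK norm_lip.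
have mAx (C : 'M[R]_n) : measurable_fun setT (fun x : 'cV[R]_n => C *m x).
  exact: measurable_mulmx.
have mUV k : measurable_fun setT (fun x => U k x + V k x).
  exact: measurable_cVD.
(* Tightness of [V] is inherited from [U] and [U + V]: [|V| - (r + s)] is at most the sum of
   [|U| - r] and [|U + V| - s], and [clip] is subadditive. *)
have tV e : 0 < e -> exists r : R,
    \forall k \near F, \int[P k]_x clip (`|V k x| - r) <= e.
  move=> e0; have e4 : 0 < e / 4 by rewrite divr_gt0.
  have [r [_ rP]] := tight_vector mu (mAx A) e4.
  have [s [_ sP]] := tight_vector mu (mAx B) e4.
  move/cvgrPdist_le : (cU _ (bln r)) => /(_ _ e4) c1.
  move/cvgrPdist_le : (cUV _ (bln s)) => /(_ _ e4) c2.
  exists (r + s); apply: filterS (filterI c1 c2) => k [{}c1 {}c2].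
  apply: (@le_trans _ _ (\int[P k]_x clip (`|U k x| - r) +
                         \int[P k]_x clip (`|U k x + V k x| - s))).
    rewrite -ExD; try exact: bm_clip_norm.
    apply: le_Ex; first exact: bm_clip_norm.
      by apply: bmD; exact: bm_clip_norm.
    move=> x; apply: le_trans (clip_subadd _ _); apply: clip_homo.
    rewrite opprD addrACA lerD2r.
    by have := ler_normB (U k x + V k x) (U k x); rewrite addrAC subrr add0r addrC.
  have tri (a b : R) : `|a - b| <= e / 4 -> a <= e / 4 -> b <= e / 2.
    by rewrite ler_norml => /andP[]; lra.
  by rewrite [leRHS]splitr lerD//; [exact: tri c1 rP|exact: tri c2 sP].
have [W [mW cW]] := prokhorov mV tV.
have [nu [_ nuE]] := pushforward_prob (@leb01 R) mW.
have cV g : bounded_lipschitz g ->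
    \int[P k]_x g (V k x) @[k --> F] --> \int[nu]_x g x.
  by move=> bg; rewrite nuE; [exact: cW|exact: bl_bm].
exists nu; split => // f bf; have [K [K0 fK fL]] := bf.
apply/eqP; rewrite -subr_eq0 -normr_le0; apply/ler_addgt0Pr => e e0.
rewrite add0r.
(* Both integrals of [f] are compared with [lim] at the price [3 K e / c] each, and [6 K <= c]. *)
pose c := 8 * (K + 1).
have c0 : 0 < c by rewrite mulr_gt0// ltr_wpDl.
have ec : 0 < e / c by rewrite divr_gt0.
have [r [r0 rP]] := tight_vector mu (mAx A) ec.
have [N [phi [a [blphi approx]]]] := partition_of_unity n r ec.
have {approx}approx := approx f K fK fL.
pose h (x y : 'cV[R]_n) := \sum_(i < N) phi i x * f (a i + y).
have bfa i : bounded_lipschitz (fun y => f (a i + y)) by exact: bl_shift.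
have bh k : bounded_measurable (fun x => h (U k x) (V k x)).
  apply: bm_sum => i _; apply: bmM; first exact: (bm_of_bl_comp (mU k) (blphi i)).
  exact: (bm_of_bl_comp (mV k) (bfa i)).
have hE x : \int[nu]_y h x y = \sum_(i < N) phi i x * \int[nu]_y f (a i + y).
  rewrite Ex_sum => [|i]; last first.
    by apply: bmM; [exact: bm_cst|exact: (bl_bm (bfa i))].
  by apply: eq_bigr => i _; rewrite ExZ//; exact: (bl_bm (bfa i)).
pose lim := \int[mu]_x \int[nu]_y h (A *m x) y.
have ch : \int[P k]_x h (U k x) (V k x) @[k --> F] --> lim.
  have -> : lim = \sum_(i < N)
      (\int[mu]_x phi i (A *m x)) * \int[nu]_y f (a i + y).
    rewrite /lim; under eq_Rintegral do rewrite hE.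
    rewrite Ex_sum => [|i]; last first.
      apply: bmM; last exact: bm_cst.
      exact: (bm_of_bl_comp (mAx A) (blphi i)).
    apply: eq_bigr => i _; rewrite ExZr//.
    exact: (bm_of_bl_comp (mAx A) (blphi i)).
  rewrite (_ : (fun k => _) = fun k => \sum_(i < N)
    \int[P k]_x (phi i (U k x) * f (a i + V k x))); last first.
    apply/funext => k; rewrite Ex_sum// => i.
    apply: bmM; first exact: (bm_of_bl_comp (mU k) (blphi i)).
    exact: (bm_of_bl_comp (mV k) (bfa i)).
  apply: cvg_sumr => i.
  have H : (\int[P k]_x (phi i (U k x) * f (a i + V k x)) -
      \int[P k]_x phi i (U k x) * \int[P k]_x f (a i + V k x)) +
      \int[P k]_x phi i (U k x) * \int[P k]_x f (a i + V k x) @[k --> F] -->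
      0 + \int[mu]_x phi i (A *m x) * \int[nu]_x f (a i + x).
    apply: cvgD; first exact: cov (blphi i) (bfa i).
    by apply: cvgM; [exact: cU|exact: (cV _ (bfa i))].
  rewrite add0r in H; apply: cvg_trans H; apply: near_eq_cvg.
  by apply: nearW => k /=; rewrite subrK.
have L : `|\int[mu]_x f (B *m x) - lim| <=
    K * (2 * (e / c)) + K * \int[mu]_x clip (`|A *m x| - r).
  apply: (@cvg_norm_le I F _ (fun k =>
      \int[P k]_x f (U k x + V k x) - \int[P k]_x h (U k x) (V k x))
    (fun k => K * (2 * (e / c)) + K * \int[P k]_x clip (`|U k x| - r))).
  - by apply: cvgB => //; exact: cUV.
  - apply: cvgD; first exact: cvg_cst.
    by apply: cvgM; [exact: cvg_cst|exact: (cU _ (bln r))].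
  apply: nearW => k.
  rewrite -ExB//; last exact: (bm_of_bl_comp (mUV k) bf).
  rewrite -ExZ; last exact: bm_clip_norm.
  rewrite -(Ex_cst (P k) (K * (2 * _))) -ExD; last 2 first.
  - exact: bm_cst.
  - by apply: bmM; [exact: bm_cst|exact: bm_clip_norm].
  apply: le_norm_Ex => //.
  - by apply: bmB => //; exact: (bm_of_bl_comp (mUV k) bf).
  - apply: bmD; first exact: bm_cst.
    by apply: bmM; [exact: bm_cst|exact: bm_clip_norm].
have bx x : bounded_measurable (fun y => f (A *m x + y)).
  exact: bl_bm (bl_shift (A *m x) bf).
have bhx x : bounded_measurable (h (A *m x)).
  by apply: bm_sum => i _; apply: bmM; [exact: bm_cst|exact: bl_bm].
have bF : bounded_measurable (fun x => \int[nu]_y f (A *m x + y)).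
  exact: bm_of_bl_comp (mAx A) (bl_Ex nu bf).
have bH : bounded_measurable (fun x => \int[nu]_y h (A *m x) y).
  rewrite (_ : (fun x => _) = fun x => \sum_(i < N)
      phi i (A *m x) * \int[nu]_y f (a i + y)).
    apply: bm_sum => i _; apply: bmM; last exact: bm_cst.
    exact: (bm_of_bl_comp (mAx A) (blphi i)).
  by apply/funext => x; exact: hE.
have M : `|(\int[mu]_x \int[nu]_y f (A *m x + y)) - lim| <=
    K * (2 * (e / c)) + K * \int[mu]_x clip (`|A *m x| - r).
  rewrite -ExB// -ExZ; last exact: bm_clip_norm.
  rewrite -(Ex_cst mu (K * (2 * _))) -ExD; last 2 first.
  - exact: bm_cst.
  - by apply: bmM; [exact: bm_cst|exact: bm_clip_norm].
  apply: le_norm_Ex.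
  - exact: bmB.
  - apply: bmD; first exact: bm_cst.
    by apply: bmM; [exact: bm_cst|exact: bm_clip_norm].
  move=> x; rewrite -ExB//; apply: norm_Ex_le; first exact: bmB.
  by move=> y; exact: approx.
have Kr : K * \int[mu]_x clip (`|A *m x| - r) <= K * (e / c).
  by rewrite ler_wpM2l.
rewrite -[X in `|X|](subrKA lim) (le_trans (ler_normD _ _))//.
rewrite [X in _ + X]distrC (le_trans (lerD L M))//.
rewrite (@le_trans _ _ (6 * (K * (e / c))))//; last first.
  rewrite (_ : 6 * (K * (e / c)) = e * (6 * K / c)); last by ring.
  by rewrite ler_piMr ?(ltW e0)// ler_pdivrMr// mul1r /c; move: K0; clear; lra.
by move: Kr; clear; lra.
Qed.

End factor_limit.

(** * The factor relation between linear images of mu *)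

Section factor.
Context (R : realType) (n : nat) (mu : probability 'cV[R]_n R).
Implicit Types A B C M : 'M[R]_n.

(* The image of mu under A is a convolution factor of its image under B. *)
Definition factor A B := exists nu : probability 'cV[R]_n R,
  forall f, bounded_lipschitz f ->
    \int[mu]_x f (B *m x) = \int[mu]_x \int[nu]_y f (A *m x + y).

Lemma factor_refl A : factor A A.
Proof.
have [nu [_ nuE]] := pushforward_prob mu (@measurable_cst _ _ _ _ setT (0 : 'cV[R]_n)).
exists nu => f bf; apply: eq_Rintegral => x _.
by rewrite nuE /= ?addr0 ?Ex_cst//; exact: bl_bm (bl_shift (A *m x) bf).
Qed.

Lemma factor_mull M A B : factor A B -> factor (M *m A) (M *m B).
Proof.
move=> [nu nuE]; have [nu' [_ nu'E]] := pushforward_prob nu (measurable_mulmx M).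
exists nu' => f bf; under eq_Rintegral do rewrite -mulmxA.
rewrite (nuE (fun x => f (M *m x))); last exact: bl_mulmx.
apply: eq_Rintegral => x _; rewrite nu'E; last first.
  exact: bl_bm (bl_shift (M *m A *m x) bf).
by apply: eq_Rintegral => y _; rewrite mulmxDr mulmxA.
Qed.

Lemma factor_trans B A C : factor A B -> factor B C -> factor A C.
Proof.
move=> [nu1 nu1E] [nu2 nu2E].
have madd : measurable_fun setT (fun z : 'cV[R]_n * 'cV[R]_n => z.1 + z.2).
  exact: measurable_cVD.
have [nu [_ nuE]] := pushforward_prob (nu1 \x nu2)%E madd.
exists nu => f bf; rewrite nu2E//.
rewrite (nu1E (fun u => \int[nu2]_z f (u + z))); last exact: bl_Ex.
apply: eq_Rintegral => x _; rewrite nuE; last exact: bl_bm (bl_shift (A *m x) bf).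
rewrite Ex_prod; last by apply: (bm_of_bl_comp madd (bl_shift (A *m x) bf)).
by apply: eq_Rintegral => y _; apply: eq_Rintegral => z _; rewrite addrA.
Qed.

(** On the product of [mu] and the noise [nu k] the two summands are independent, so the covariances
    in [factor_limit] vanish identically; the tightness of the noises also comes from there. *)
Lemma factor_closed_ultra (I : Type) (F : set_system I) {FF : UltraFilter F}
    (A_ B_ : I -> 'M[R]_n) A B :
  (\forall k \near F, factor (A_ k) (B_ k)) ->
  A_ k @[k --> F] --> A -> B_ k @[k --> F] --> B -> factor A B.
Proof.
move=> facAB cA cB.
have /choice[nu nuE] : forall k, exists nu : probability 'cV[R]_n R,
    factor (A_ k) (B_ k) -> forall f, bounded_lipschitz f ->
    \int[mu]_x f (B_ k *m x) = \int[mu]_x \int[nu]_y f (A_ k *m x + y).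
  by move=> k; have [[nu nuE]|] := pselect (factor (A_ k) (B_ k));
    [exists nu|exists mu].
have m1 k : measurable_fun setT (fun z : 'cV[R]_n * 'cV[R]_n => A_ k *m z.1).
  exact: measurable_cV_mulmx.
have m2 (k : I) : measurable_fun setT (fun z : 'cV[R]_n * 'cV[R]_n => z.2).
  exact: measurable_snd.
have cid (C_ : I -> 'M[R]_n) (C : 'M[R]_n) : C_ k @[k --> F] --> C -> forall f, bounded_lipschitz f ->
    \int[mu]_x f (C_ k *m x) @[k --> F] --> \int[mu]_x f (C *m x).
  move=> cC; apply: (@cvg_law_mulmx R n I F _ _ _ (fun=> mu) (fun=> id)) => //.
  by move=> f bf; exact: cvg_cst.
have [|||||nu' [_ nu'E]] := @factor_limit R n I F _ _ _
    (fun k => (mu \x nu k)%E) (fun k z => A_ k *m z.1) (fun k z => z.2) mu A B.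
- exact: m1.
- exact: m2.
- move=> f bf; apply: cvg_trans (cid _ _ cA f bf); apply: near_eq_cvg.
  apply: nearW => k; rewrite Ex_prod; last exact: bm_of_bl_comp (m1 k) bf.
  by apply: eq_Rintegral => x _ /=; rewrite Ex_cst.
- move=> f bf; apply: cvg_trans (cid _ _ cB f bf); apply: near_eq_cvg.
  apply: filterS facAB => k /nuE -> //.
  by rewrite Ex_prod//; apply: (bm_of_bl_comp (measurable_cVD (m1 k) (m2 k)) bf).
- move=> f g bf bg; apply/cvgrPdist_le => e e0; apply: nearW => k.
  have b1 := bm_of_bl_comp (m1 k) bf; have b2 := bm_of_bl_comp (m2 k) bg.
  suff -> : \int[(mu \x nu k)%E]_z (f (A_ k *m z.1) * g z.2) =
      \int[(mu \x nu k)%E]_z f (A_ k *m z.1) * \int[(mu \x nu k)%E]_z g z.2.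
    by rewrite subrr subrr normr0 ltW.
  rewrite !Ex_prod//=; last exact: bmM.
  under [X in _ = X * _]eq_Rintegral do rewrite Ex_cst.
  rewrite Ex_cst -ExZr; last exact: (bm_of_bl_comp (measurable_mulmx (A_ k)) bf).
  apply: eq_Rintegral => x _; rewrite ExZ//; exact: bl_bm.
- by exists nu'.
Qed.

Lemma factor_closed (I : Type) (F : set_system I) {FF : ProperFilter F}
    (A_ B_ : I -> 'M[R]_n) A B :
  (\forall k \near F, factor (A_ k) (B_ k)) ->
  A_ k @[k --> F] --> A -> B_ k @[k --> F] --> B -> factor A B.
Proof.
move=> facAB cA cB; have [G [UG FG]] := ultraFilterLemma FF.
apply: (@factor_closed_ultra I G _ A_ B_); first exact: FG.
- by apply: cvg_trans cA => U; exact: FG.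
- by apply: cvg_trans cB => U; exact: FG.
Qed.

End factor.

(** * Fullness, cancellation of convolutions and idempotents of D(mu) *)

Section degenerate.
Context (R : realType).

Lemma Ex_eq0 d (T : measurableType d) (P : probability T R) (f : T -> R) :
  bounded_measurable f -> (forall x, 0 <= f x) -> \int[P]_x f x = 0 ->
  {ae P, forall x, f x = 0}.
Proof.
move=> bf f0 Ef0.
have : ae_eq P setT (EFin \o f) (cst 0%E).
  apply/ae_eq_integral_abs => //; first by apply/measurable_EFinP; case: bf.
  transitivity (\int[P]_x (f x)%:E)%E.
    by apply: eq_integral => x _ /=; rewrite ger0_norm.
  by rewrite -EFin_Ex// Ef0.
by apply: filterS => x /= /(_ I)[].
Qed.

Lemma Ex_ae_eq d (T : measurableType d) (P : probability T R) (f g : T -> R) :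
  bounded_measurable f -> bounded_measurable g ->
  {ae P, forall x, f x = g x} -> \int[P]_x f x = \int[P]_x g x.
Proof.
move=> [mf _] [mg _] fg; rewrite /Rintegral; congr fine.
apply: ae_eq_integral => //; try exact/measurable_EFinP.
by apply: filterS fg => x /= -> .
Qed.

Lemma ae_ex d (T : measurableType d) (P : probability T R) (p : T -> Prop) :
  {ae P, forall x, p x} -> exists x, p x.
Proof.
move=> pP; apply: contrapT => /forallNP np.
have : P.-negligible setT by case: pP => A mA; exists A; case: mA => mA A0 sub;
  split => // x _; apply: sub => /=; exact: np.
move/(negligibleP _ measurableT) => /eqP; rewrite [X in X == _]probability_setT.
by rewrite onee_eq0.
Qed.

Context (n : nat).

Lemma compact_closed_bounded_cV (S : set 'cV[R]_n) (c : R) :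
  closed S -> (forall x, S x -> `|x| <= c) -> compact S.
Proof.
move=> cS Sc; rewrite compact_ultra => F UF FS.
have [x Fx] : exists x : 'cV[R]_n, k @[k --> F] --> x.
  by apply: (@ultra_cvg_mx _ _ _ _ _ _ _ c); apply: filterS FS => y; exact: Sc.
exists x; split; last by apply: cvg_trans Fx => A.
by apply: cS => U /Fx FU; exact: filter_ex (filterI FS FU).
Qed.

Context (mu : probability 'cV[R]_n R).

(** [M x = c] almost everywhere, hence on the support, because the set where it fails is open. The
    support then lies in a translate of the kernel of [M], and fullness makes this kernel the whole
    space. *)
Lemma full_degenerate (M : 'M[R]_n) (c : 'cV[R]_n) : full mu ->
  \int[mu]_x clip (`|M *m x - c|) = 0 -> M = 0.
Proof.
move=> fmu E0; apply: contrapT => M0.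
have bc : bounded_measurable (fun x => clip (`|M *m x - c|)).
  apply: (bm_of_bl_comp (measurable_mulmx M) (f := fun x => clip (`|x - c|))).
  apply: (bl_clip (L := 1)) => x y.
  by rewrite mul1r (le_trans (norm_lip _ _))// opprB addrA subrK.
have ae0 := Ex_eq0 bc (fun x => clip_ge0 _) E0.
have suppM (x : 'cV[R]_n) : Defs.support mu x -> M *m x = c.
  move=> sx; apply: contrapT => Mxc.
  pose U := (fun y : 'cV[R]_n => M *m y) @^-1` (~` [set c]).
  have oU : open U.
    move/continuousP : (@continuous_mulmx R n M); apply.
    apply: closed_openC; apply: compact_closed; first exact: norm_hausdorff.
    exact: compact_set1.
  have := sx U oU Mxc; rewrite lt_neqAle => /andP[/eqP + _]; apply; apply/esym.
  apply/negligibleP; first exact: open_measurable_cV.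
  case: ae0 => A [mA A0 sub]; exists A; split => // y Uy; apply: sub => /= cy.
  apply: Uy; apply/eqP; rewrite -subr_eq0 -normr_eq0; apply/eqP.
  have [y1|y1] := leP 1 (`|M *m y - c|).
    by move: cy; rewrite clip1// => /eqP; rewrite oner_eq0.
  by rewrite clip_id in cy => //; rewrite normr_ge0 ltW.
pose W : {vspace 'cV[R]_n} := lker (linfun (mulmx M)).
have WP x : x \in W = (M *m x == 0) by rewrite memv_ker lfunE.
have Wf : W != fullv.
  apply/eqP => WE; apply: M0; apply/matrixP => i j; rewrite mxE.
  have := WP (delta_mx j 0); rewrite WE memvf => /esym/eqP/matrixP/(_ i 0).
  rewrite !mxE (bigD1 j)//= mxE !eqxx mulr1 big1 ?addr0// => k /negbTE kj.
  by rewrite mxE kj mulr0.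
(* An empty support lies in every translate, so fullness excludes it too. *)
have [[a sa]|ns] := pselect (exists a, Defs.support mu a).
  apply: (fmu W a Wf) => x sx; exists (x - a); last by rewrite addrC subrK.
  by rewrite /= WP mulmxBr (suppM _ sx) (suppM _ sa) subrr.
by apply: (fmu W 0 Wf) => x sx; case: ns; exists x.
Qed.

(** A sum of independent vectors that is almost surely [0] has constant summands: by Fubini, for
    almost every noise value [y] the vector [M x] equals [- y] almost everywhere, and one such [y]
    suffices. *)
Lemma factor_0 (M : 'M[R]_n) : full mu -> factor mu M 0 -> M = 0.
Proof.
move=> fmu [nu nuE].
have bcn : bounded_lipschitz (fun x : 'cV[R]_n => clip (`|x|)).
  by apply: (bl_clip (L := 1)) => x y; rewrite mul1r norm_lip.
have := nuE _ bcn; under eq_Rintegral do rewrite mul0mx normr0 clip0//.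
rewrite Ex_cst; have mF : bounded_measurable
    (fun z : 'cV[R]_n * 'cV[R]_n => clip (`|M *m z.1 + z.2|)).
  apply: (bm_of_bl_comp (phi := fun z : 'cV[R]_n * 'cV[R]_n => M *m z.1 + z.2) _ bcn).
  by apply: measurable_cVD; [exact: measurable_cV_mulmx|exact: measurable_snd].
rewrite (Ex_swap mu nu mF) => /esym/Ex_eq0 H.
have [||y yE] := ae_ex (H _ _).
- exact: (bm_Ex2 mu nu mF).
- by move=> y; apply: Rintegral_ge0 => x _; exact: clip_ge0.
by apply: (full_degenerate (c := - y) fmu); rewrite opprK.
Qed.

(** Were D(mu) unbounded, the matrices [A k / |A k|] would have a limit [M] of norm [1], while
    [M mu] would be a factor of the limit of [mu] shrunk by [|A k|], the point mass at [0]. *)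
Lemma factor_bounded : full mu ->
  exists c : R, forall A, factor mu A 1%:M -> `|A| <= c.
Proof.
move=> fmu; apply: contrapT => /forallNP H.
have /choice[A AH] : forall k : nat, exists A, factor mu A 1%:M /\ k.+1%:R < `|A|.
  move=> k; have /existsNP[A] := H k.+1%:R; rewrite not_implyE => -[fA /negP].
  by rewrite -ltNge => kA; exists A.
have A0 k : 0 < `|A k| by apply: lt_trans (AH k).2; rewrite ltr0Sn.
have [F [UF Foo]] := ultraFilterLemma eventually_filter.
pose B k := `|A k|^-1 *: A k.
have nB k : `|B k| = 1.
  by rewrite normrZ ger0_norm ?invr_ge0// mulVf// gt_eqF.
have [M BM] : exists M : 'M[R]_n, B k @[k --> F] --> M.
  by apply: (@ultra_cvg_mx _ _ _ _ _ _ _ 1); apply: nearW => k; rewrite nB.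
have M0 : M = 0.
  apply: factor_0 => //.
  apply: (@factor_closed _ _ _ _ F _ B (fun k => `|A k|^-1 *: 1%:M)) => //.
    apply: nearW => k; have := factor_mull (`|A k|^-1%:M) (AH k).1.
    by rewrite !mul_scalar_mx.
  apply/cvgrPdist_le => e e0; apply: Foo.
  have [N Ne] := natSinv_lt e0.
  exists N => // k /= Nk; rewrite sub0r normrN normrZ ger0_norm ?invr_ge0//.
  apply: (@le_trans _ _ (`|A k|^-1 * 1)).
    rewrite ler_wpM2l ?invr_ge0//; apply: mx_norm_leP => // i j.
    by rewrite mxE; case: eqP; rewrite ?mulr1n ?normr1 ?mulr0n ?normr0.
  rewrite mulr1 (le_trans _ (ltW Ne))// lef_pV2 ?posrE ?ltr0Sn//.
  by rewrite (le_trans _ (ltW (AH k).2))// ler_nat ltnS.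
have : `|M| = 1.
  have nBM : `|B k| @[k --> F] --> `|M| by exact: cvg_norm.
  apply: (cvg_unique (@norm_hausdorff _ _) nBM).
  rewrite /= (_ : (fun k => _) = fun=> 1); first exact: cvg_cst.
  by apply/funext => k; exact: nB.
by rewrite M0 normr0 => /esym/eqP; rewrite oner_eq0.
Qed.

Lemma factor_0l (B : 'M[R]_n) : factor mu 0 B.
Proof.
have [nu [_ nuE]] := pushforward_prob mu (measurable_mulmx B).
exists nu => f bf; under [RHS]eq_Rintegral do under eq_Rintegral do rewrite mul0mx add0r.
by rewrite Ex_cst nuE//; exact: bl_bm.
Qed.

(* The translates of the positive function h0 = 1/(1+|.|) have averages H that
   vanish at infinity, so H has a compact nonempty set of maximizers; if D y is
   a noise that leaves the law of J x unchanged, this set is stable under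
   x |-> x - D y for almost all y, and looking at its extremal points in the
   coordinate directions shows that D y = 0. *)
Lemma convolution_cancel (nu : probability 'cV[R]_n R) (J D : 'M[R]_n) :
  (forall f, bounded_lipschitz f ->
    \int[mu]_x f (J *m x) = \int[mu]_x \int[nu]_y f (J *m x + D *m y)) ->
  {ae nu, forall y, D *m y = 0}.
Proof.
move=> H0.
pose h0 (z : 'cV[R]_n) := (1 + `|z|)^-1.
have h00 z : 0 < h0 z by rewrite invr_gt0 ltr_wpDr.
have h01 z : h0 z <= 1 by rewrite invf_le1 ?ltr_wpDr// lerDl.
have blh0 : bounded_lipschitz h0.
  apply: (@bl_intro _ _ _ 1 1) => [x|x y]; first by rewrite ger0_norm// ltW.
  have -> : h0 x - h0 y = (`|y| - `|x|) * (h0 x * h0 y).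
    by rewrite /h0; field; rewrite !gt_eqF// ltr_wpDr.
  rewrite normrM mul1r -[leRHS]mulr1 ler_pM//; first by rewrite distrC norm_lip.
  by rewrite ger0_norm ?mulr_ge0 ?(ltW (h00 _))// mulr_ile1// ltW.
have blh0x x : bounded_lipschitz (fun u => h0 (x - u)).
  apply: (bl_comp (L := 1) (phi := fun u => x - u) blh0) => u v.
  by rewrite opprB addrC addrA subrK distrC mul1r.
pose H x := \int[mu]_z h0 (x - J *m z).
have bmh x : bounded_measurable (fun z => h0 (x - J *m z)).
  exact: (bm_of_bl_comp (measurable_mulmx J) (blh0x x)).
have blH : bounded_lipschitz H.
  have [nu' [_ nu'E]] := pushforward_prob mu (measurable_mulmx (- J)).
  rewrite (_ : H = fun x => \int[nu']_y h0 (x + y)); first exact: bl_Ex.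
  apply/funext => x; rewrite nu'E; last exact: (bl_bm (bl_shift x blh0)).
  by apply: eq_Rintegral => z _; rewrite mulNmx.
have cH : continuous H by exact: bl_continuous.
have H00 : 0 < H 0.
  rewrite lt_neqAle Rintegral_ge0 ?andbT; last by move=> z _; exact: ltW.
  apply/eqP => /esym/(Ex_eq0 (bmh 0)) H1.
  have [z] := ae_ex (H1 (fun z => ltW (h00 _))).
  by move/eqP; rewrite gt_eqF.
(* The part [|J z| > s + 1] contributes at most [H 0 / 3] by tightness; on the rest [|x - J z|]
   exceeds [(H 0 / 3)^-1], so [h0] is below [H 0 / 3]. *)
have [r rH] : exists r : R, forall x, r < `|x| -> H x < H 0.
  have H03 : 0 < H 0 / 3 by rewrite divr_gt0.
  have [s [s0 sP]] := tight_vector mu (measurable_mulmx J) H03.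
  exists (s + 1 + (H 0 / 3)^-1) => x xr.
  apply: (@le_lt_trans _ _ (H 0 / 3 + H 0 / 3)); last by move: H00; clear; lra.
  rewrite -[X in _ <= _ + X](Ex_cst mu).
  apply: (le_trans _ (lerD sP (lexx _))); rewrite -ExD; last 2 first.
  - exact: bm_clip_norm (measurable_mulmx J).
  - exact: bm_cst.
  apply: le_Ex => //.
    by apply: bmD; [exact: bm_clip_norm (measurable_mulmx J)|exact: bm_cst].
  move=> z; case: (leP (`|J *m z|) (s + 1)) => zs; last first.
    rewrite (le_trans (h01 _))// clip1; first by rewrite lerDl ltW.
    by move: zs; clear; lra.
  rewrite (@le_trans _ _ (H 0 / 3))// ?lerDr ?clip_ge0//.
  rewrite -[leRHS]invrK lef_pV2 ?posrE ?invr_gt0// ?ltr_wpDr//.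
  have := lerB_dist x (J *m z); move: xr zs; move: (_^-1) => t; lra.
pose ball0 := [set x : 'cV[R]_n | `|x| <= `|r|].
have cptb : compact ball0.
  apply: (@compact_closed_bounded_cV _ `|r|) => //.
  by apply: (closed_comp (f := fun x : 'cV[R]_n => `|x|) _ (@closed_le _ `|r|)) => x _;
    exact: norm_continuous.
have [||x0 /set_mem x0b x0max] := @compact_EVT_max _ R H ball0 _ cptb.
- by exists 0; rewrite /ball0/= normr0.
- exact: continuous_subspaceT.
have Hmax x : H x <= H x0.
  case: (leP (`|x|) (`|r|)) => xr; first by apply: x0max; exact: mem_set.
  apply: (@le_trans _ _ (H 0)).
    by rewrite ltW// rH// (le_lt_trans (ler_norm _)).
  by apply: x0max; apply: mem_set; rewrite /ball0/= normr0.
pose M := [set x | H x = H x0].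
have Mb x : M x -> `|x| <= `|r|.
  move=> Mx; rewrite leNgt; apply/negP => xr.
  have := rH x (le_lt_trans (ler_norm _) xr); rewrite Mx ltNge => /negP; apply.
  exact: Hmax.
have cptM : compact M.
  apply: (compact_closed_bounded_cV _ Mb).
  by apply: (closed_comp (f := H) _ (@closed_eq _ (H x0))) => x _; exact: cH.
(* [H x] is the [nu]-average of [H (x - D y)], and values bounded by the maximum average to it only
   if almost all of them equal it. *)
have stableM x : M x -> {ae nu, forall y, M (x - D *m y)}.
  move=> Mx.
  have bHy : bounded_measurable (fun y => H (x - D *m y)).
    apply: (bm_of_bl_comp (measurable_mulmx D) (f := fun u => H (x - u))).
    apply: (bl_comp (L := 1) (phi := fun u => x - u) blH) => u v.
    by rewrite opprB addrC addrA subrK distrC mul1r.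
  have bF : bounded_measurable
      (fun z : 'cV[R]_n * 'cV[R]_n => h0 (x - (J *m z.1 + D *m z.2))).
    exact: (bm_mulmx_add J D (blh0x x)).
  have HE : H x = \int[nu]_y H (x - D *m y).
    rewrite {1}/H (H0 _ (blh0x x)) (Ex_swap mu nu bF).
    apply: eq_Rintegral => y _; apply: eq_Rintegral => z _.
    by rewrite opprD addrA addrAC.
  have bD : bounded_measurable (fun y => H x0 - H (x - D *m y)).
    by apply: bmB; [exact: bm_cst|exact: bHy].
  have := Ex_eq0 bD (fun y => _) _; move=> /(_ nu)/= ae.
  apply: filterS (ae _ _) => [y /eqP|y|]; first by rewrite subr_eq0 eq_sym => /eqP.
    by rewrite subr_ge0.
  have bHc : bounded_measurable (fun _ : 'cV[R]_n => H x0) by exact: bm_cst.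
  by rewrite (ExB nu bHc bHy) Ex_cst -HE Mx subrr.
have sgn (s : R) (i : 'I_n) : {ae nu, forall y, 0 <= s * (D *m y) i 0}.
  have [||x /set_mem Mx xmax] :=
      @compact_EVT_max _ R (fun x : 'cV[R]_n => s * x i 0) M _ cptM.
  - by exists x0.
  - apply: continuous_subspaceT => x.
    apply: (@cvgM R _ (nbhs x) _ (fun=> s) (fun x1 : 'cV[R]_n => x1 i 0)).
      exact: cvg_cst.
    exact: coord_continuous.
  apply: filterS (stableM x Mx) => y My.
  have := xmax _ (mem_set My); rewrite !mxE mulrBr -subr_ge0.
  by rewrite opprB addrC subrK.
have : {ae nu, forall y, forall i : 'I_n, 0 <= 1 * (D *m y) i 0 /\
    0 <= -1 * (D *m y) i 0}.
  by apply: filter_forall => i; exact: filterI (sgn 1 i) (sgn (-1) i).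
apply: filterS => y yE; apply/matrixP => i j; rewrite (ord1 j) [RHS]mxE.
have [] := yE i; rewrite mul1r mulN1r oppr_ge0 => H1 H2.
by apply/eqP; rewrite eq_le H1 H2.
Qed.

(** Applying [J] to [mu = J mu * nu] gives [J mu = J mu * J nu], so [J] kills the noise by
    cancellation. Applying [1 - J] to the same identity then identifies [nu] with [(1 - J) mu]. *)
Lemma factor_idem_split (J : 'M[R]_n) : J *m J = J -> factor mu J 1%:M ->
  forall f, bounded_lipschitz f ->
  \int[mu]_x f x = \int[mu]_x \int[mu]_y f (J *m x + (1%:M - J) *m y).
Proof.
move=> JJ [nu nuE].
have {}nuE f : bounded_lipschitz f ->
    \int[mu]_x f x = \int[mu]_x \int[nu]_y f (J *m x + y).
  by move=> bf; rewrite -nuE//; apply: eq_Rintegral => x _; rewrite mul1mx.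
have Jnu : {ae nu, forall y, J *m y = 0}.
  apply: (@convolution_cancel nu J J) => f bf.
  rewrite (nuE (fun x => f (J *m x))); last exact: bl_mulmx.
  by apply: eq_Rintegral => x _; apply: eq_Rintegral => y _;
    rewrite mulmxDr mulmxA JJ.
have nuJ g : bounded_lipschitz g ->
    \int[nu]_y g y = \int[mu]_y g ((1%:M - J) *m y).
  move=> bg; have bgJ := bl_mulmx (1%:M - J) bg.
  rewrite (nuE (fun x => g ((1%:M - J) *m x)))//.
  transitivity (\int[nu]_y g ((1%:M - J) *m y)).
    apply: Ex_ae_eq; [exact: bl_bm|exact: bl_bm|].
    by apply: filterS Jnu => y Jy; rewrite mulmxBl mul1mx Jy subr0.
  rewrite -[LHS](Ex_cst mu); apply: eq_Rintegral => x _.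
  apply: eq_Rintegral => y _; rewrite mulmxDr mulmxA.
  by rewrite (_ : (1%:M - J) *m J = 0) ?mul0mx ?add0r// mulmxBl mul1mx JJ subrr.
move=> f bf; rewrite nuE//; apply: eq_Rintegral => x _.
by rewrite (nuJ (fun y => f (J *m x + y)))//; exact: bl_shift.
Qed.

(** With [mu] split as [J mu * (1 - J) mu], only the first component is decomposed: the matrix acts
    as [C] after [J] and as the identity after [1 - J]. *)
Lemma factor_extend (J C : 'M[R]_n) : J *m J = J -> factor mu J 1%:M ->
  C *m J = C -> factor mu C J -> factor mu (C + 1%:M - J) 1%:M.
Proof.
move=> JJ fJ CJ [nu nuE]; have split := factor_idem_split JJ fJ.
exists nu => f bf; under eq_Rintegral do rewrite mul1mx.
have blnu := bl_Ex nu bf.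
rewrite (split f bf) (split (fun u => \int[nu]_z f ((C + 1%:M - J) *m u + z))).
  have b1 := bm_mulmx_add J (1%:M - J) bf.
  have b2 := bm_mulmx_add C (1%:M - J) blnu.
  rewrite (Ex_swap mu mu b1).
  transitivity (\int[mu]_x \int[mu]_y \int[nu]_z f (C *m x + (1%:M - J) *m y + z)).
    rewrite [RHS](Ex_swap mu mu b2); apply: eq_Rintegral => y _ /=.
    have bfy := bl_shift ((1%:M - J) *m y) bf.
    under eq_Rintegral do rewrite addrC.
    rewrite (nuE _ bfy); apply: eq_Rintegral => x _; apply: eq_Rintegral => z _.
    by rewrite addrCA addrA.
  apply: eq_Rintegral => x _; apply: eq_Rintegral => y _; apply: eq_Rintegral => z _.
  have E1 : (C + 1%:M - J) *m J = C.
    by rewrite mulmxBl mulmxDl CJ mul1mx JJ addrK.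
  have E2 : (C + 1%:M - J) *m (1%:M - J) = 1%:M - J.
    by rewrite mulmxBr mulmx1 E1; apply/matrixP => i j; rewrite !mxE; ring.
  by rewrite [in RHS]mulmxDr !mulmxA E1 E2.
exact: (bl_mulmx (C + 1%:M - J) blnu).
Qed.

Lemma factor_compl (J : 'M[R]_n) : J *m J = J -> factor mu J 1%:M ->
  factor mu (1%:M - J) 1%:M.
Proof.
move=> JJ fJ; rewrite -[1%:M - J]add0r addrA.
exact: (factor_extend JJ fJ (mul0mx _ J) (factor_0l J)).
Qed.

Lemma factor_mul (A B : 'M[R]_n) : factor mu A 1%:M -> factor mu B 1%:M ->
  factor mu (A *m B) 1%:M.
Proof.
move=> fA fB; apply: factor_trans fA.
by have := factor_mull A fB; rewrite mulmx1.
Qed.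

End degenerate.

(** * Matrix exponentials *)

Section matrix_exponential.
Context (R : realType) (d : nat).
Implicit Types X Y A P : 'M[R]_d.

Lemma mulmx_ring A B : A *m B = A * B :> 'M[R]_d. Proof. by []. Qed.

Lemma norm1mx_le : `|1 : 'M[R]_d| <= 1.
Proof.
apply: mx_norm_leP => // i j.
by rewrite mxE; case: eqP; rewrite ?mulr1n ?normr1 ?mulr0n ?normr0.
Qed.

Lemma norm_exprmx X k : `|X ^+ k| <= (d%:R * `|X|) ^+ k.
Proof.
elim: k => [|k IH]; first by rewrite !expr0; exact: norm1mx_le.
rewrite !exprS (le_trans (ler_mx_normM _ _))//.
by rewrite ler_wpM2l// mulr_ge0.
Qed.

Lemma exprZmx (c : R) X k : (c *: X) ^+ k = c ^+ k *: X ^+ k.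
Proof.
elim: k => [|k IH]; first by rewrite !expr0 scale1r.
by rewrite !exprS IH -!mulmx_ring -scalemxAl -scalemxAr scalerA.
Qed.

(** The same [K] cuts off the exponential series and all binomial expansions of (1 + E)^n, whose
    coefficients are dominated by [1 / i!]. *)
Lemma exp_tail (M e : R) : 0 <= M -> 0 < e -> exists K, forall m,
  \sum_(K <= i < m) (i`!%:R^-1 * M ^+ i) <= e.
Proof.
move=> M0 e0.
have nd : nondecreasing_seq (series (exp_coeff M)).
  by apply: nondecreasing_series => k _ _; exact: exp_coeff_ge0.
have ce := @is_cvg_series_exp_coeff R M.
have /cvgrPdist_le/(_ e e0)[K _ /(_ K (leqnn K)) HK] :
  series (exp_coeff M) @ \oo --> limn (series (exp_coeff M)) by [].
exists K => m; case: (leqP K m) => Km; last by rewrite big_geq ?(ltW e0)// ltnW.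
have -> : \sum_(K <= i < m) (i`!%:R^-1 * M ^+ i) =
    series (exp_coeff M) m - series (exp_coeff M) K.
  rewrite !seriesEnat exp_coeffE [X in _ = X - _](big_cat_nat (n := K))//=.
  by rewrite addrAC subrr add0r.
have := nondecreasing_cvgn_le nd ce m; move: HK; rewrite ler_norml => /andP[_].
by move: (limn _) => l; lra.
Qed.

Definition exp_term X (k : nat) : 'M[R]_d := k`!%:R^-1 *: X ^+ k.

Lemma norm_exp_term X k : `|exp_term X k| <= k`!%:R^-1 * (d%:R * `|X|) ^+ k.
Proof.
by rewrite normrZ ger0_norm ?invr_ge0// ler_wpM2l ?invr_ge0// norm_exprmx.
Qed.

Lemma cvg_expmx X : series (exp_term X) @ \oo --> expmx X.
Proof.
suff : cvgn (series (exp_term X)) by [].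
have cij i j : cvgn (series (fun k => exp_term X k i j)).
  apply: normed_cvg; apply: (series_le_cvg (v_ := exp_coeff (d%:R * `|X|))).
  - by move=> k; exact: normr_ge0.
  - by move=> k; apply: exp_coeff_ge0; rewrite mulr_ge0.
  - move=> k; rewrite exp_coeffE (le_trans (ler_mx_entry _ _ _))//.
    exact: norm_exp_term.
  - exact: is_cvg_series_exp_coeff.
apply/cvg_ex; exists (\matrix_(i, j) limn (series (fun k => exp_term X k i j))).
apply/cvg_mxP => i j; rewrite mxE.
rewrite (_ : (fun k => _) = series (fun k => exp_term X k i j)); first exact: cij.
by apply/funext => k; rewrite /series/= summxE.
Qed.

Lemma expmx_partial X (M e : R) K : d%:R * `|X| <= M ->
  (forall m, \sum_(K <= i < m) (i`!%:R^-1 * M ^+ i) <= e) ->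
  `|expmx X - \sum_(0 <= i < K) exp_term X i| <= e.
Proof.
move=> XM He; have dX0 : 0 <= d%:R * `|X| by rewrite mulr_ge0.
have e0 : 0 <= e by have := He K; rewrite big_geq.
apply: mx_norm_leP => // i j; apply/ler_addgt0Pr => e' e'0.
have /cvgrPdist_le/(_ e' e'0)[m0 _ Hm] := @cvg_expmx X.
pose m := maxn m0 K; have := Hm m (leq_maxl _ _).
have -> : series (exp_term X) m = \sum_(0 <= i < K) exp_term X i +
    \sum_(K <= i < m) exp_term X i.
  by rewrite /series/= (big_cat_nat _ (leq_maxr m0 K)).
set S := \sum_(0 <= i < K) _; set T := \sum_(K <= i < m) _ => H.
have TE : `|T| <= e.
  apply: (le_trans _ (He m)); apply: (le_trans (ler_norm_sum _ _ _)).
  apply: ler_sum => k _; apply: (le_trans (norm_exp_term X k)).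
  by rewrite ler_wpM2l ?invr_ge0// lerXn2r// ?nnegrE// (le_trans dX0).
apply: (le_trans (ler_mx_entry _ _ _)).
have -> : expmx X - S = T + (expmx X - (S + T)).
  by apply/matrixP => u v; rewrite !mxE; ring.
by apply: (le_trans (ler_normD _ _)); rewrite lerD.
Qed.

(* 'C(n, i) / n ^ i *)
Definition bin_ratio (n i : nat) : R := 'C(n, i)%:R / n%:R ^+ i.

Lemma bin_ratioS n i : bin_ratio n i.+1 =
  bin_ratio n i * (i.+1%:R^-1 * ((n - i)%:R / n%:R)).
Proof.
have : i.+1%:R * 'C(n, i.+1)%:R = (n - i)%:R * 'C(n, i)%:R :> R.
  by rewrite -!natrM mul_bin_left.
move=> H; rewrite /bin_ratio exprS invfM.
have -> : 'C(n, i.+1)%:R = i.+1%:R^-1 * ((n - i)%:R * 'C(n, i)%:R) :> R.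
  by rewrite -H mulKf// pnatr_eq0.
ring.
Qed.

Lemma bin_ratio_le n i : 0 <= bin_ratio n i <= i`!%:R^-1.
Proof.
elim: i => [|i /andP[IH0 IH1]]; first by rewrite /bin_ratio bin0 expr0 divr1 invr1 ler01 lexx.
rewrite bin_ratioS; apply/andP; split; first by rewrite !mulr_ge0// invr_ge0.
rewrite factS natrM invfM mulrC ler_pM ?mulr_ge0 ?invr_ge0//.
rewrite ler_piMr ?invr_ge0//; case: n {IH0 IH1} => [|n].
  by rewrite invr0 mulr0.
by rewrite ler_pdivrMr ?ltr0Sn// mul1r ler_nat leq_subr.
Qed.

Lemma cvg_bin_ratio (I : Type) (F : set_system I) {FF : ProperFilter F}
    (n_ : I -> nat) i : (forall N, \forall k \near F, (N <= n_ k)%N) ->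
  bin_ratio (n_ k) i @[k --> F] --> (i`!%:R^-1 : R).
Proof.
move=> noo; elim: i => [|i IH].
  rewrite (_ : (fun k => _) = fun=> 1); first by rewrite invr1; exact: cvg_cst.
  by apply/funext => k; rewrite /bin_ratio bin0 expr0 divr1.
rewrite (_ : (fun k => _) = fun k =>
    bin_ratio (n_ k) i * (i.+1%:R^-1 * ((n_ k - i)%:R / (n_ k)%:R))); last first.
  by apply/funext => k; rewrite bin_ratioS.
rewrite factS natrM invfM mulrC; apply: cvgM => //.
rewrite -[X in _ --> X]mulr1; apply: cvgM; first exact: cvg_cst.
apply/cvgrPdist_le => e e0; have [N Ne] := natSinv_lt (divr_gt0 e0 (ltr0Sn R i)).
near=> k.
have nk : (maxn N.+1 i <= n_ k)%N by near: k; exact: noo.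
have n0 : (0 < n_ k)%N by rewrite (leq_trans _ nk)// leq_max.
have iN : (i <= n_ k)%N by rewrite (leq_trans _ nk)// leq_maxr.
have -> : 1 - (n_ k - i)%:R / (n_ k)%:R = i%:R / (n_ k)%:R :> R.
  by rewrite natrB//; field; rewrite pnatr_eq0 -lt0n.
rewrite ger0_norm; last by rewrite divr_ge0.
rewrite (@le_trans _ _ (i.+1%:R * N.+1%:R^-1))//.
  rewrite ler_pM// ?ler_nat// lef_pV2 ?posrE ?ltr0n// ler_nat.
  by rewrite (leq_trans _ nk)// leq_maxl.
by rewrite mulrC -ler_pdivlMr ?ltr0Sn// ltW.
Unshelve. all: by end_near. Qed.

Lemma exprD1mx X n : (0 < n)%N ->
  (1 + X) ^+ n = \sum_(0 <= i < n.+1) bin_ratio n i *: (n%:R *: X) ^+ i.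
Proof.
move=> n0; rewrite exprDn_comm; last exact: GRing.commr_sym (GRing.commr1 X).
rewrite big_mkord; apply: eq_bigr => i _; rewrite expr1n mul1r exprZmx scalerA.
rewrite /bin_ratio mulfVK ?scaler_nat//.
by rewrite expf_neq0// pnatr_eq0 -lt0n.
Qed.

(** The matrices [E k] are known to first order only: later they are [A - J] with [A] in D(mu), and
    need not commute with [Z]. The binomial expansion involves powers of the single matrix [E k], so
    termwise convergence and the common tail suffice. *)
Theorem cvg_exprD1_expmx (I : Type) (F : set_system I) {FF : ProperFilter F}
    (n_ : I -> nat) (E : I -> 'M[R]_d) Z :
  (forall N, \forall k \near F, (N <= n_ k)%N) ->
  (n_ k)%:R *: E k @[k --> F] --> Z ->
  (1 + E k) ^+ n_ k @[k --> F] --> expmx Z.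
Proof.
move=> noo nE; apply/cvgrPdist_le => e e0.
(* Eventually [(n_ k)%:R *: E k] is within [1] of [Z], so [M] serves for both tails. *)
pose M := d%:R * (`|Z| + 1).
have M0 : 0 <= M by rewrite mulr_ge0// addr_ge0.
have e3 : 0 < e / 3 by rewrite divr_gt0.
have [K HK] := exp_tail M0 e3.
have c1 : \sum_(0 <= i < K) bin_ratio (n_ k) i *: ((n_ k)%:R *: E k) ^+ i
    @[k --> F] --> \sum_(0 <= i < K) exp_term Z i.
  elim: (K) => [|K' IH].
    rewrite big_geq// (_ : (fun k => _) = fun=> 0); first exact: cvg_cst.
    by apply/funext => k; rewrite big_geq.
  rewrite big_nat_recr//= (_ : (fun k => _) = fun k =>
      \sum_(0 <= i < K') bin_ratio (n_ k) i *: ((n_ k)%:R *: E k) ^+ i +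
      bin_ratio (n_ k) K' *: ((n_ k)%:R *: E k) ^+ K'); last first.
    by apply/funext => k; rewrite big_nat_recr.
  apply: cvgD => //; apply: cvgZ; first exact: cvg_bin_ratio.
  elim: (K') => [|K'' IH2].
    by rewrite expr0 (_ : (fun k => _) = fun=> 1); [exact: cvg_cst|apply/funext].
  rewrite exprS (_ : (fun k => _) = fun k =>
      ((n_ k)%:R *: E k) *m ((n_ k)%:R *: E k) ^+ K''); last first.
    by apply/funext => k; rewrite exprS.
  exact: cvg_mulmx.
move/cvgrPdist_le : (c1) => /(_ _ e3) {}c1.
move/cvgrPdist_le : nE => /(_ _ ltr01) nE1.
near=> k.
have nk : (K.+1 <= n_ k)%N by near: k; exact: noo.
have H1 : `|\sum_(0 <= i < K) exp_term Z i -
    \sum_(0 <= i < K) bin_ratio (n_ k) i *: ((n_ k)%:R *: E k) ^+ i| <= e / 3.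
  by near: k.
have H2 : `|Z - (n_ k)%:R *: E k| <= 1 by near: k.
have H3 : d%:R * `|(n_ k)%:R *: E k| <= M.
  rewrite ler_wpM2l//.
  have := lerB_dist ((n_ k)%:R *: E k) Z; move: H2; rewrite distrC; lra.
have H4 : d%:R * `|Z| <= M by rewrite ler_wpM2l// lerDl.
rewrite exprD1mx ?(leq_trans _ nk)//.
rewrite (big_cat_nat _ (n := K))//=; last by rewrite (leq_trans _ (leqW nk)).
set T := \sum_(K <= i < _) _.
have TE : `|T| <= e / 3.
  apply: (le_trans _ (HK (n_ k).+1)); apply: (le_trans (ler_norm_sum _ _ _)).
  apply: ler_sum => i _; rewrite normrZ; have /andP[b0 b1] := bin_ratio_le (n_ k) i.
  rewrite ger0_norm// ler_pM// (le_trans (norm_exprmx _ _))//.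
  by rewrite lerXn2r ?nnegrE ?mulr_ge0.
have HZ := expmx_partial H4 HK; move: H1 HZ.
set S := \sum_(0 <= i < K) exp_term Z i; set S' := \sum_(0 <= i < K) _.
move=> H1 HZ; have -> : expmx Z - (S' + T) = (expmx Z - S) + (S - S') - T.
  by rewrite addrA subrK opprD addrA.
apply: (le_trans (ler_normB _ _)).
apply: (le_trans (lerD (ler_normD _ _) (lexx _))).
apply: (le_trans (lerD (lerD HZ H1) TE)).
by move: e0; clear; lra.
Unshelve. all: by end_near. Qed.

Lemma cvg_ext (I : Type) (F : set_system I) (V : topologicalType)
    (f g : I -> V) (l : V) : (forall k, f k = g k) ->
  f k @[k --> F] --> l -> g k @[k --> F] --> l.
Proof. by move=> /funext ->. Qed.

Let inv_succ (k : nat) : R := k.+1%:R^-1.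

Let cvg_inv_succ : inv_succ k @[k --> \oo] --> (0 : R).
Proof.
apply/cvgrPdist_le => e e0; have [N Ne] := natSinv_lt e0.
exists N => // k /= Nk; rewrite sub0r normrN ger0_norm ?invr_ge0//.
by rewrite (le_trans _ (ltW Ne))// lef_pV2 ?posrE ?ltr0Sn// ler_nat ltnS.
Qed.

(** The second-order term absorbs the cross product in (1 + X/k)(1 + Y/k), which yields the addition
    formula by uniqueness of limits instead of a Cauchy product of series. *)
Lemma cvg_exprD1 X Y : (1 + inv_succ k *: X + (inv_succ k ^+ 2) *: Y) ^+ k.+1
  @[k --> \oo] --> expmx X.
Proof.
have := @cvg_exprD1_expmx _ \oo _ S
  (fun k => inv_succ k *: X + (inv_succ k ^+ 2) *: Y) X.
move=> H; apply: (cvg_ext _ (H _ _ _)).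
- by move=> k; rewrite addrA.
- by move=> N; exists N => // k /= /leqW.
rewrite (_ : (fun k => _) = fun k => X + inv_succ k *: Y).
  rewrite -[X in _ --> X]addr0; apply: cvgD; first exact: cvg_cst.
  by rewrite -(scale0r Y); apply: cvgZr_tmp; exact: cvg_inv_succ.
apply/funext => k; rewrite scalerDr !scalerA /inv_succ mulfV ?pnatr_eq0// scale1r.
by rewrite expr2 mulrA mulfV ?pnatr_eq0// mul1r.
Qed.

Lemma expmx0 : expmx (0 : 'M[R]_d) = 1.
Proof.
have := @cvg_exprD1 0 0; rewrite (_ : (fun k => _) = fun=> 1).
  by move/(cvg_unique (@norm_hausdorff _ _)); apply; exact: cvg_cst.
by apply/funext => k; rewrite !scaler0 !addr0 expr1n.
Qed.

Lemma expmxD X Y : X * Y = Y * X -> expmx (X + Y) = expmx X * expmx Y.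
Proof.
move=> XY; apply: (cvg_unique (@norm_hausdorff _ _) (@cvg_exprD1 (X + Y) (X * Y))).
have cX := @cvg_exprD1 X 0; have cY := @cvg_exprD1 Y 0.
apply: (cvg_ext _ (cvg_mulmx cX cY)) => k.
rewrite !scaler0 !addr0 mulmx_ring -exprMn_comm; last first.
  apply: GRing.commrD; first exact: GRing.commr1.
  apply/GRing.commr_sym/GRing.commrD; first exact: GRing.commr1.
  rewrite /GRing.comm -!mulmx_ring -!scalemxAl -!scalemxAr.
  by rewrite !mulmx_ring XY scalerA mulrC -scalerA.
congr (_ ^+ _); rewrite mulrDl mul1r mulrDr mulr1 -!addrA; congr (_ + _).
rewrite addrCA addrA scalerDr; congr (_ + _).
by rewrite -!mulmx_ring -scalemxAl -scalemxAr scalerA.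
Qed.

Lemma expmx_comm A X : A * X = X * A -> A * expmx X = expmx X * A.
Proof.
move=> AX; have cX := @cvg_exprD1 X 0.
have cA : A @[k --> \oo] --> A by exact: cvg_cst.
apply: (cvg_unique (@norm_hausdorff _ _) (cvg_mulmx cA cX)).
apply: (cvg_ext _ (cvg_mulmx cX cA)) => k; rewrite !mulmx_ring; apply/esym.
apply: GRing.commrX; rewrite scaler0 addr0; apply: GRing.commrD.
  exact: GRing.commr1.
by rewrite /GRing.comm -!mulmx_ring -scalemxAl -scalemxAr !mulmx_ring AX.
Qed.

Lemma expmxN X : expmx X * expmx (- X) = 1.
Proof. by rewrite -expmxD ?subrr ?expmx0// mulrN mulNr. Qed.

(** For [Y] a multiple of [X], already [(1 + Y P) ^ m = (1 + Y) ^ m P + (1 - P)]; it remains to pass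
    to the limit. *)
Lemma expmx_idem X P : X * P = P * X -> P * P = P ->
  expmx (X * P) = expmx X * P + (1 - P).
Proof.
move=> XP PP; apply: (cvg_unique (@norm_hausdorff _ _) (@cvg_exprD1 (X * P) 0)).
have cP : P @[k --> \oo] --> P by exact: cvg_cst.
have c1P : (1 - P) @[k --> \oo] --> (1 - P) by exact: cvg_cst.
apply: (cvg_ext _ (cvgD (cvg_mulmx (@cvg_exprD1 X 0) cP) c1P)) => k /=.
rewrite !scaler0 !addr0; set Y := inv_succ k *: X.
have -> : inv_succ k *: (X * P) = Y * P.
  by rewrite -!mulmx_ring scalemxAl.
have YP : Y * P = P * Y.
  by rewrite /Y -!mulmx_ring -scalemxAl -scalemxAr !mulmx_ring XP.
rewrite mulmx_ring; elim: (k.+1) => [|m IH].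
  by rewrite !expr0 mul1r addrC subrK.
have PQ : P * (1 - P) = 0 by rewrite mulrBr mulr1 PP subrr.
have E2 : (1 + Y * P) * (1 - P) = 1 - P.
  by rewrite mulrDl mul1r -mulrA PQ mulr0 addr0.
have E3 : Y * P * ((1 + Y) ^+ m * P) = Y * (1 + Y) ^+ m * P.
  have cPX : P * (1 + Y) ^+ m = (1 + Y) ^+ m * P.
    by apply: GRing.commrX; apply: GRing.commrD; [exact: GRing.commr1|exact/esym].
  by rewrite -!mulrA [P * (_ * P)]mulrA cPX -!mulrA PP.
rewrite !exprS -IH [in RHS]mulrDr E2; congr (_ + _).
by rewrite [in RHS]mulrDl mul1r E3 mulrDl mul1r mulrDl.
Qed.

(** For [x <= 1] and [i >= 2] one has [x ^ i <= x ^ 2], and the sum of all [1 / i!] is [expR 1]. *)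
Lemma expmx_small X : d%:R * `|X| <= 1 ->
  `|expmx X - 1 - X| <= expR 1 * (d%:R * `|X|) ^+ 2.
Proof.
move=> X1; set x := d%:R * `|X|.
have x0 : 0 <= x by rewrite mulr_ge0.
have -> : expmx X - 1 - X = expmx X - \sum_(0 <= i < 2) exp_term X i.
  rewrite !big_nat_recl// big_geq// /exp_term expr0 expr1 fact0 invr1 !scale1r.
  by rewrite addr0 opprD addrA.
apply: (expmx_partial (lexx _)) => m.
have e1 := @is_cvg_series_exp_coeff R 1.
have nd : nondecreasing_seq (series (exp_coeff (1 : R))).
  by apply: nondecreasing_series => k _ _; exact: exp_coeff_ge0.
rewrite (@le_trans _ _ (\sum_(2 <= i < m) (x ^+ 2 * exp_coeff 1 i)))//.
  rewrite big_nat_cond [leRHS]big_nat_cond; apply: ler_sum => i /andP[/andP[i2 _] _].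
  rewrite exp_coeffE expr1n mulr1 mulrC ler_pM2r ?invr_gt0 ?ltr0n ?fact_gt0//.
  by rewrite -(subnKC i2) exprD ler_piMr ?exprn_ge0// exprn_ile1.
rewrite -mulr_sumr mulrC ler_wpM2r ?exprn_ge0//.
apply: le_trans (nondecreasing_cvgn_le nd e1 m).
rewrite seriesEnat; case: (leqP 2 m) => m2; last first.
  by rewrite big_geq ?sumr_ge0// 1?ltnW// => i _; exact: exp_coeff_ge0.
rewrite [leRHS](big_cat_nat (n := 2))//= lerDr.
by apply: sumr_ge0 => i _; exact: exp_coeff_ge0.
Qed.

End matrix_exponential.

(** * Decaying one-parameter semigroups *)

Section idempotent_limit.
Context (R : realType) (d : nat).

Lemma lim_norm_le (I : Type) (F : set_system I) {FF : ProperFilter F}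
    (A : I -> 'M[R]_d) (M : 'M[R]_d) (e : R) : A i @[i --> F] --> M ->
  (\forall i \near F, `|A i| <= e) -> `|M| <= e.
Proof.
move=> AM Ae; have nAM : `|A i| @[i --> F] --> `|M| by exact: cvg_norm.
rewrite -(cvg_lim (@norm_hausdorff _ _) nAM).
by apply: limr_le => //; exact: cvgP nAM.
Qed.

Lemma lim_norm_ge (I : Type) (F : set_system I) {FF : ProperFilter F}
    (A : I -> 'M[R]_d) (M : 'M[R]_d) (e : R) : A i @[i --> F] --> M ->
  (\forall i \near F, e <= `|A i|) -> e <= `|M|.
Proof.
move=> AM Ae; have nAM : `|A i| @[i --> F] --> `|M| by exact: cvg_norm.
rewrite -(cvg_lim (@norm_hausdorff _ _) nAM).
by apply: limr_ge => //; exact: cvgP nAM.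
Qed.

Lemma cvg_mulmxl (I : Type) (F : set_system I) {FF : Filter F}
    (A : I -> 'M[R]_d) (M C : 'M[R]_d) :
  A i @[i --> F] --> M -> C * A i @[i --> F] --> C * M.
Proof. by move=> AM; apply: cvg_mulmx => //; exact: cvg_cst. Qed.

Lemma cvg_mulmxr (I : Type) (F : set_system I) {FF : Filter F}
    (A : I -> 'M[R]_d) (M C : 'M[R]_d) :
  A i @[i --> F] --> M -> A i * C @[i --> F] --> M * C.
Proof. by move=> AM; apply: cvg_mulmx => //; exact: cvg_cst. Qed.

Lemma cvg_near_choice (a : nat -> nat) (A : nat -> 'M[R]_d) (M : 'M[R]_d)
    (F : set_system nat) {FF : ProperFilter F} :
  \oo `<=` F -> (forall k, `|A (a k) - M| <= k.+1%:R^-1) ->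
  A (a k) @[k --> F] --> M.
Proof.
move=> Foo AM; apply/cvgrPdist_le => e e0; have [N Ne] := natSinv_lt e0.
apply: Foo; exists N => // k /= Nk; rewrite distrC (le_trans (AM k))//.
by rewrite (le_trans _ (ltW Ne))// lef_pV2 ?posrE ?ltr0Sn// ler_nat ltnS.
Qed.

(** Exponents [a k] and [b k >= 2 a k + k] are chosen with the same limit [C] of powers. With [E]
    and [G] the limits for [b - a] and [b - 2 a] one has [E C = C], [G C = E] and [E G = G E],
    whence [E E = E G C = G E C = E]. The extra [k] sends [b - a] to infinity. *)
Lemma idempotent_limit (B : 'M[R]_d) (c : R) : (forall n, `|B ^+ n| <= c) ->
  exists (F : set_system nat) (n_ : nat -> nat) (E : 'M[R]_d),
    [/\ ProperFilter F, forall N, \forall k \near F, (N <= n_ k)%N,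
        B ^+ n_ k @[k --> F] --> E & E * E = E].
Proof.
move=> Bc.
have [U [UU Uoo]] := ultraFilterLemma eventually_filter.
have [C BC] : exists C : 'M[R]_d, B ^+ k @[k --> U] --> C.
  by apply: (@ultra_cvg_mx _ _ _ _ _ _ _ c); apply: nearW => k.
have ex N k : exists n, (N <= n)%N /\ `|B ^+ n - C| <= k.+1%:R^-1.
  have k0 : 0 < k.+1%:R^-1 :> R by rewrite invr_gt0 ltr0Sn.
  have /filter_ex[n [Nn Bn]] :
      \forall n \near U, (N <= n)%N /\ `|C - B ^+ n| <= k.+1%:R^-1.
    apply: filterI; first by apply: Uoo; exists N.
    by move/cvgrPdist_le : BC; apply.
  by exists n; rewrite distrC.
have /choice[a aP] : forall k, exists n, (k <= n)%N /\ `|B ^+ n - C| <= k.+1%:R^-1.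
  by move=> k; exact: ex.
have /choice[b bP] : forall k, exists n, (a k + a k + k <= n)%N /\
    `|B ^+ n - C| <= k.+1%:R^-1.
  by move=> k; exact: ex.
have aC : B ^+ a k @[k --> U] --> C.
  by apply: (@cvg_near_choice a (fun n => B ^+ n) C U _ Uoo) => k; exact: (aP k).2.
have bC : B ^+ b k @[k --> U] --> C.
  by apply: (@cvg_near_choice b (fun n => B ^+ n) C U _ Uoo) => k; exact: (bP k).2.
have [E BE] : exists E : 'M[R]_d, B ^+ (b k - a k) @[k --> U] --> E.
  by apply: (@ultra_cvg_mx _ _ _ _ _ _ _ c); apply: nearW => k.
have [G BG] : exists G : 'M[R]_d, B ^+ (b k - a k - a k) @[k --> U] --> G.
  by apply: (@ultra_cvg_mx _ _ _ _ _ _ _ c); apply: nearW => k.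
have ab k : (a k + a k + k <= b k)%N by case: (bP k).
have uniq_lim (u : nat -> 'M[R]_d) (l l' : 'M[R]_d) :
    u k @[k --> U] --> l -> u k @[k --> U] --> l' -> l = l'.
  by move=> ul ul'; exact: (cvg_unique (@norm_hausdorff _ _) ul ul').
have EC : E * C = C.
  apply: (uniq_lim (fun k => B ^+ b k)) => //.
  apply: (cvg_ext _ (cvg_mulmx BE aC)) => k.
  by rewrite mulmx_ring -exprD subnK// (leq_trans _ (ab k))// -addnA leq_addr.
have GC : G * C = E.
  apply: (uniq_lim (fun k => B ^+ (b k - a k))) => //.
  apply: (cvg_ext _ (cvg_mulmx BG aC)) => k.
  rewrite mulmx_ring -exprD subnK// leq_subRL ?(leq_trans _ (ab k)) ?leq_addr//.
  by rewrite -addnA leq_addr.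
have EG : E * G = G * E.
  apply: (uniq_lim (fun k => B ^+ (b k - a k) * B ^+ (b k - a k - a k))).
    exact: cvg_mulmx.
  apply: (cvg_ext _ (cvg_mulmx BG BE)) => k.
  by rewrite mulmx_ring -!exprD addnC.
exists U, (fun k => b k - a k)%N, E; split => //; first exact: ultra_proper.
- move=> N; apply: Uoo; exists N => // k /= Nk.
  rewrite (leq_trans Nk)// leq_subRL ?(leq_trans _ (ab k))//.
    by rewrite -addnA leq_addl.
  by rewrite -addnA leq_addr.
- by rewrite -{2}GC mulrA EG -mulrA EC GC.
Qed.

End idempotent_limit.

(** * Generators in the corner of an idempotent *)

Section semigroup.
Context (R : realType) (d : nat) (mu : probability 'cV[R]_d R).
Hypothesis full_mu : full mu.
Implicit Types A J g X : 'M[R]_d.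
Local Notation D A := (factor mu A 1).

Let DM A B : D A -> D B -> D (A * B).
Proof. exact: factor_mul. Qed.

Let fM A B C : factor mu B C -> factor mu (A * B) (A * C).
Proof. exact: factor_mull. Qed.

Let bounded_D : exists2 c : R, 0 <= c & forall A, D A -> `|A| <= c.
Proof.
have [c cP] := factor_bounded full_mu.
by exists `|c| => // A DA; rewrite (le_trans (cP A DA))// ler_norm.
Qed.

Let closed_D (I : Type) (F : set_system I) {FF : ProperFilter F}
    (A_ : I -> 'M[R]_d) A :
  (\forall k \near F, D (A_ k)) -> A_ k @[k --> F] --> A -> D A.
Proof.
by move=> DA cA; apply: (factor_closed DA cA); exact: cvg_cst.
Qed.

(* B m n stands for A_n A_m^-1, where A_n are the normalizing operators. *)
Variables (B : nat -> nat -> 'M[R]_d) (S : nat -> 'M[R]_d).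
Hypothesis B_diag : forall m, B m m = 1.
Hypothesis B_succ : forall m n, (m <= n)%N -> B m n.+1 = S n * B m n.
Hypothesis S_cvg : S n @[n --> \oo] --> (1 : 'M[R]_d).
Hypothesis B_cvg0 : forall m, B m n @[n --> \oo] --> (0 : 'M[R]_d).
Hypothesis B_limit : forall (F : set_system nat) (n_ : nat -> nat),
  UltraFilter F -> \oo `<=` F -> (forall k, (k <= n_ k)%N) ->
  exists2 A, D A & B k (n_ k) @[k --> F] --> A.

Section step.
Variable J : 'M[R]_d.
Hypothesis J_idem : J * J = J.
Hypothesis DJ : D J.
Hypothesis J_neq0 : J <> 0.

(** As [J * g = g], the clause [D g] makes [g mu] a factor of [J mu]; the last clause is the
    converse, so [g] is a symmetry of [J mu]. *)
Definition corner_symmetry g :=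
  [/\ D g, J * g = g, g * J = g & factor mu J g].

(** Multiplying [A] by [g], rather than comparing [A] with [g], makes the condition stable under
    [A |-> h * A] for corner symmetries [h]. *)
Definition far e A := forall g, corner_symmetry g -> e <= `|g * A - J|.

Let symJ : corner_symmetry J.
Proof. by split => //; exact: factor_refl. Qed.

Let symM g h : corner_symmetry g -> corner_symmetry h -> corner_symmetry (g * h).
Proof.
move=> [Dg Jg gJ fg] [Dh Jh hJ fh]; split.
- exact: DM.
- by rewrite mulrA Jg.
- by rewrite -mulrA hJ.
- by apply: (factor_trans fg); rewrite -{1}gJ; exact: fM.
Qed.

Let nJ : 0 < `|J|.
Proof. by rewrite normr_gt0; exact/eqP. Qed.

(** For fixed [m] the matrices J B(m, n) J start from [J], which is not far, and tend to [0], which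
    is far since [e < |J|]. At the first far index the previous matrix is moved within [e] of [J] by
    some symmetry, and both have the same limit as [m] grows because [S] tends to [1]. Multiplied by
    the limit symmetry, this limit is at distance at most and at least [e] from [J]. *)
Lemma exists_far e : 0 < e -> e < `|J| ->
  exists A, [/\ D A, J * A = A, A * J = A, far e A & `|A - J| = e].
Proof.
move=> e0 eJ; have [c c0 cP] := bounded_D.
have ev m : exists n, (m <= n)%N && `[< far e (J * B m n * J) >].
  (* The bound [c] on D(mu) makes the estimate uniform in the symmetry [g]. *)
  pose K := d%:R * c * (d%:R * (d%:R * `|J|) * `|J|) + 1.
  have K0 : 0 < K by rewrite ltr_wpDl// !mulr_ge0.
  have eK : 0 < (`|J| - e) / K by rewrite divr_gt0// subr_gt0.
  have /cvgrPdist_le/(_ _ eK)[N _ HN] := @B_cvg0 m.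
  exists (maxn m N); rewrite leq_maxl; apply/asboolP => g [Dg _ _ _].
  have := HN (maxn m N) (leq_maxr _ _); rewrite /= sub0r normrN => H.
  have H1 : `|g * (J * B m (maxn m N) * J)| <= `|J| - e.
    apply: (@le_trans _ _ (K * `|B m (maxn m N)|)).
      rewrite (le_trans (ler_mx_normM _ _))//.
      apply: (@le_trans _ _ (d%:R * c * (d%:R * (d%:R * `|J| * `|B m (maxn m N)|) * `|J|))).
        rewrite ler_pM ?mulr_ge0//; first by rewrite ler_wpM2l// cP.
        rewrite (le_trans (ler_mx_normM _ _))// ler_wpM2r// ler_wpM2l//.
        exact: ler_mx_normM.
      have -> : d%:R * c * (d%:R * (d%:R * `|J| * `|B m (maxn m N)|) * `|J|) =
        d%:R * c * (d%:R * (d%:R * `|J|) * `|J|) * `|B m (maxn m N)| by ring.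
      by rewrite ler_wpM2r// lerDl.
    by rewrite mulrC -ler_pdivlMr.
  have := lerB_dist J (g * (J * B m (maxn m N) * J)); rewrite distrC.
  by move: H1; lra.
have minP m : exists n, [/\ (m <= n)%N, far e (J * B m n.+1 * J) &
    ~ far e (J * B m n * J)].
  pose n := ex_minn (ev m).
  have := ex_minnP (ev m); case=> n0 /andP[mn /asboolP farn] minn.
  case: n0 => [|n0] in mn farn minn.
    move: mn; rewrite leqn0 => /eqP m0; exfalso.
    have := farn J symJ; rewrite m0 B_diag mulr1 J_idem J_idem subrr normr0.
    by rewrite leNgt e0.
  have mn0 : (m <= n0)%N.
    move: mn; rewrite leq_eqVlt => /orP[/eqP mE|//]; exfalso.
    have := farn J symJ; rewrite -mE B_diag mulr1 J_idem J_idem subrr normr0.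
    by rewrite leNgt e0.
  exists n0; split => // farn0.
  by have := minn n0; rewrite mn0 asboolT// => /(_ isT); rewrite ltnn.
have /choice[n_ nP] := minP.
have /choice[g_ gP] : forall m, exists g, corner_symmetry g /\
    `|g * (J * B m (n_ m) * J) - J| <= e.
  move=> m; have [_ _ /existsNP[g]] := nP m; rewrite not_implyE => -[sg /negP].
  by rewrite -ltNge => /ltW H; exists g.
have [F [UF Foo]] := ultraFilterLemma eventually_filter.
have [A DA BA] := B_limit UF Foo (fun k => let: And3 H _ _ := nP k in H).
have [g gg] : exists g : 'M[R]_d, g_ k @[k --> F] --> g.
  apply: (@ultra_cvg_mx _ _ _ _ _ _ _ c); apply: nearW => k.
  by have [[/cP]] := gP k.
have cJ : (J : 'M[R]_d) @[_ --> F] --> J by exact: cvg_cst.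
have sg : corner_symmetry g.
  have ug (u : nat -> 'M[R]_d) (l : 'M[R]_d) : (forall k, u k = g_ k) ->
      u k @[k --> F] --> l -> l = g.
    move=> uE ul; apply: (cvg_unique (@norm_hausdorff _ _) ul).
    by apply: (cvg_ext _ gg) => k; rewrite uE.
  split.
  - by apply: (closed_D _ gg); apply: nearW => k; case: (gP k) => -[].
  - apply: (ug (fun k => J * g_ k)); last exact: cvg_mulmxl.
    by move=> k; case: (gP k) => -[].
  - apply: (ug (fun k => g_ k * J)); last exact: cvg_mulmxr.
    by move=> k; case: (gP k) => -[].
  - apply: (@factor_closed _ _ mu _ F _ (fun=> J) g_) => //.
    by apply: nearW => k; case: (gP k) => -[].
have BA1 : B k (n_ k).+1 @[k --> F] --> A.
  rewrite -[A]mul1r; apply: (@cvg_ext _ _ _ (fun k => S (n_ k) *m B k (n_ k))).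
    by move=> k; rewrite B_succ//; case: (nP k).
  apply: cvg_mulmx => //; apply: cvg_trans S_cvg => V [N _ NV].
  apply: Foo; exists N => // k /= Nk; apply: NV => /=.
  by rewrite (leq_trans Nk)//; case: (nP k).
have farJAJ : far e (J * A * J).
  move=> h sh.
  have cc : h * (J * B k (n_ k).+1 * J) - J @[k --> F] --> h * (J * A * J) - J.
    apply: cvgB; last exact: cvg_cst.
    by apply: cvg_mulmxl; apply: cvg_mulmxr; exact: cvg_mulmxl.
  by apply: (lim_norm_ge cc); apply: nearW => k; case: (nP k) => _ + _; apply.
have closeA : `|g * (J * A * J) - J| <= e.
  have cc : g_ k * (J * B k (n_ k) * J) - J @[k --> F] --> g * (J * A * J) - J.
    apply: cvgB; last exact: cvg_cst.
    by apply: (cvg_mulmx gg); apply: cvg_mulmxr; exact: cvg_mulmxl.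
  by apply: (lim_norm_le cc); apply: nearW => k; case: (gP k).
have [Dg Jg gJ fg] := sg.
have far' : far e (g * (J * A * J)).
  by move=> h sh; rewrite mulrA; apply: farJAJ; exact: symM.
exists (g * (J * A * J)); split.
- exact: (DM Dg (DM (DM DJ DA) DJ)).
- by rewrite mulrA Jg.
- by rewrite -!mulrA J_idem.
- exact: far'.
- apply/eqP; rewrite eq_le closeA/=; have := far' J symJ.
  by rewrite mulrA Jg.
Qed.

(** [X] is a limit of [(A k - J) / s k] with [A k] far at distance [s k], so powers of [A k] of
    order [t / s k] tend to e^(tX) J. If these were all symmetries, so would be [h k], that is
    e^(-s_k X) J; but [h k * A k - J] is [o(s k)], its first-order terms cancelling, against
    [far (s k) (A k)]. *)
Lemma exists_generator : exists X, [/\ J * X = X, X * J = X,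
  forall t, 0 <= t -> D (expmx (t *: X) * J) &
  ~ forall t, 0 <= t -> factor mu J (expmx (t *: X) * J)].
Proof.
(* The shift [k.+2] keeps [s k < |J|] for [k = 0] as well. *)
pose s (k : nat) := `|J| / k.+2%:R.
have s0 k : 0 < s k by rewrite divr_gt0.
have sJ k : s k < `|J| by rewrite ltr_pdivrMr// ltr_pMr// ltr1n.
have /choice[A AP] : forall k, exists A,
    [/\ D A, J * A = A, A * J = A, far (s k) A & `|A - J| = s k].
  by move=> k; exact: exists_far.
pose E k := A k - J.
have [F [UF Foo]] := ultraFilterLemma eventually_filter.
have s_cvg : s k @[k --> F] --> (0 : R).
  apply/cvgrPdist_le => e e0; have [N Ne] := natSinv_lt (divr_gt0 e0 nJ).
  apply: Foo; exists N => // k /= Nk; rewrite sub0r normrN gtr0_norm//.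
  rewrite /s mulrC -ler_pdivlMr// (le_trans _ (ltW Ne))//.
  by rewrite lef_pV2 ?posrE ?ltr0Sn// ler_nat ltnS leqW.
have [X EX] : exists X : 'M[R]_d, (s k)^-1 *: E k @[k --> F] --> X.
  apply: (@ultra_cvg_mx _ _ _ _ _ _ _ 1); apply: nearW => k.
  have [_ _ _ _ nE] := AP k.
  by rewrite normrZ /E nE ger0_norm ?invr_ge0 ?(ltW (s0 k))// mulVf// gt_eqF.
have JE k : J * E k = E k by have [_ JA _ _ _] := AP k; rewrite /E mulrBr JA J_idem.
have EJ k : E k * J = E k by have [_ _ AJ _ _] := AP k; rewrite /E mulrBl AJ J_idem.
have JX : J * X = X.
  have H : J * ((s k)^-1 *: E k) @[k --> F] --> J * X by exact: cvg_mulmxl.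
  apply: (cvg_unique (@norm_hausdorff _ _) H).
  by apply: (cvg_ext _ EX) => k; rewrite -mulmx_ring -scalemxAr mulmx_ring JE.
have XJ : X * J = X.
  have H : ((s k)^-1 *: E k) * J @[k --> F] --> X * J by exact: cvg_mulmxr.
  apply: (cvg_unique (@norm_hausdorff _ _) H).
  by apply: (cvg_ext _ EX) => k; rewrite -mulmx_ring -scalemxAl mulmx_ring EJ.
(* As [A k = J + E k] with [J] a unit for [E k], positive powers of [1 + E k] times [J] are those of
   [A k]; the zeroth power of [A k] would be [1] instead of [J]. *)
have DAn k n : D ((1 + E k) ^+ n.+1 * J).
  have -> : (1 + E k) ^+ n.+1 * J = A k ^+ n.+1.
    have -> : A k = J + E k by rewrite /E addrC subrK.
    elim: n => [|n IH].
      by rewrite !expr1 mulrDl mul1r EJ.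
    rewrite exprS -mulrA IH [in RHS]exprS.
    rewrite mulrDl mul1r [in RHS]mulrDl; congr (_ + _).
    by rewrite exprS mulrA mulrDr J_idem JE.
  have [DAk _ _ _ _] := AP k.
  elim: n => [|n IH]; first by rewrite expr1; exact: DAk.
  rewrite exprS; exact: (DM DAk IH).
have DX t : 0 <= t -> D (expmx (t *: X) * J).
  rewrite le_eqVlt => /orP[/eqP <-|t0]; first by rewrite scale0r expmx0 mul1r.
  pose n_ k := Num.truncn (t / s k).
  have ns k : `|t - (n_ k)%:R * s k| <= s k.
    have /andP[h1 h2] := truncn_itv (ltW (divr_gt0 t0 (s0 k))).
    rewrite ger0_norm; last by rewrite subr_ge0 -ler_pdivlMr.
    rewrite lerBlDl -{2}[s k]mul1r -mulrDl natr1 -ler_pdivrMr//.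
    exact: ltW.
  have nsc : (n_ k)%:R * s k @[k --> F] --> t.
    apply/cvgrPdist_le => e e0; move/cvgrPdist_le : s_cvg => /(_ e e0).
    apply: filterS => k; rewrite sub0r normrN gtr0_norm// => sk.
    exact: le_trans (ns k) sk.
  have noo N : \forall k \near F, (N <= n_ k)%N.
    move/cvgrPdist_le : s_cvg => /(_ (t / N.+1%:R)) H.
    have {}H := H (divr_gt0 t0 (ltr0Sn R N)).
    apply: filterS H => k; rewrite sub0r normrN gtr0_norm// => sk.
    rewrite truncn_ge_nat ?divr_ge0 ?(ltW t0) ?(ltW (s0 k))//.
    rewrite ler_pdivlMr//; move: sk; rewrite ler_pdivlMr ?ltr0Sn// => sk.
    rewrite (le_trans _ sk)// mulrC ler_wpM2l ?(ltW (s0 k))// ler_nat.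
    exact: leqnSn.
  have nE : (n_ k)%:R *: E k @[k --> F] --> t *: X.
    apply: (@cvg_ext _ _ _ (fun k => ((n_ k)%:R * s k) *: ((s k)^-1 *: E k))).
      by move=> k; rewrite scalerA -mulrA mulfV ?mulr1// gt_eqF.
    exact: cvgZ.
  have EnX : (1 + E k) ^+ n_ k @[k --> F] --> expmx (t *: X).
    exact: cvg_exprD1_expmx.
  have EnJ : (1 + E k) ^+ n_ k * J @[k --> F] --> expmx (t *: X) * J.
    exact: cvg_mulmxr.
  suff Dn : \forall k \near F, D ((1 + E k) ^+ n_ k * J).
    by apply: (factor_closed Dn EnJ); exact: cvg_cst.
  by apply: filterS (noo 1%N) => k /prednK <-; exact: DAn.
exists X; split => // sym.
pose h k := expmx (- (s k *: X)) * J.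
have cXJ t : J * expmx (t *: X) = expmx (t *: X) * J.
  by apply: expmx_comm; rewrite -!mulmx_ring -scalemxAl -scalemxAr !mulmx_ring JX XJ.
have exps t : expmx (- (t *: X)) * expmx (t *: X) = 1.
  by rewrite -[X in _ * expmx X]opprK expmxN.
have symh k : corner_symmetry (h k).
  have sk := ltW (s0 k).
  have h1 : factor mu (h k) J.
    have := fM (expmx (- (s k *: X))) (sym _ sk).
    by rewrite mulrA exps mul1r.
  have h2 : factor mu J (h k).
    have := fM (expmx (- (s k *: X)) * J) (DX _ sk).
    rewrite mulr1 -[X in factor mu X]mulrA [J * (_ * J)]mulrA cXJ -!mulrA J_idem.
    by rewrite mulrA exps mul1r.
  have h3 : J * h k = h k by rewrite /h -scaleNr mulrA cXJ -mulrA J_idem.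
  have h4 : h k * J = h k by rewrite /h -mulrA J_idem.
  exact: And4 (factor_trans h1 DJ) h3 h4 h2.
pose K := expR 1 * (d%:R * `|X|) ^+ 2.
(* This is [s k <= |h k * A k - J|] divided by [s k]; the right-hand side tends to [0] along [F],
   which is absurd. *)
have bound k : d%:R * (s k * `|X|) <= 1 ->
   1 <= d%:R * (K * s k) * `|J| + `|(s k)^-1 *: E k - X| +
     d%:R * (K * s k) * s k + d%:R * `|X| * s k.
  move=> sX1; have [_ JA _ farA nE] := AP k.
  have sk0 := s0 k.
  pose R1 := expmx (- (s k *: X)) - 1 - - (s k *: X).
  have nR1 : `|R1| <= K * s k * s k.
    have nsX : `|- (s k *: X)| = s k * `|X| by rewrite normrN normrZ gtr0_norm.
    rewrite (le_trans (@expmx_small _ _ _ _)) ?nsX// /K.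
    by rewrite le_eqVlt; apply/orP; left; apply/eqP; ring.
  have eqA : h k * A k - J = R1 * J + s k *: ((s k)^-1 *: E k - X) + R1 * E k
      - (s k *: X) * E k.
    have e1 : expmx (- (s k *: X)) = R1 + (1 - s k *: X).
      by rewrite /R1; apply/matrixP => i j; rewrite !mxE; ring.
    have e2 : A k = J + E k by rewrite /E addrC subrK.
    have e3 : s k *: ((s k)^-1 *: E k - X) = E k - s k *: X.
      by rewrite scalerBr scalerA mulfV ?gt_eqF// scale1r.
    have e4 : (s k *: X) * J = s k *: X.
      by rewrite -mulmx_ring -scalemxAl mulmx_ring XJ.
    rewrite /h -mulrA JA e1 e2 e3.
    rewrite mulrDl [R1 * (J + E k)]mulrDr [(1 - _) * _]mulrBl mul1r.
    rewrite [(s k *: X) * (J + E k)]mulrDr e4.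
    set a := R1 * J; set b := R1 * E k; set c := (s k *: X) * E k.
    by apply/matrixP => i j; rewrite !mxE; ring.
  have /(farA _) : corner_symmetry (h k) by exact: symh.
  rewrite eqA => H.
  have : s k <= s k * (d%:R * (K * s k) * `|J| + `|(s k)^-1 *: E k - X| +
     d%:R * (K * s k) * s k + d%:R * `|X| * s k).
    rewrite (le_trans H)//.
    have n1 : `|R1 * J| <= d%:R * (K * s k * s k) * `|J|.
      rewrite (le_trans (ler_mx_normM _ _))// ler_wpM2r// ler_wpM2l//.
    have n2 : `|s k *: ((s k)^-1 *: E k - X)| = s k * `|(s k)^-1 *: E k - X|.
      by rewrite normrZ gtr0_norm.
    have n3 : `|R1 * E k| <= d%:R * (K * s k * s k) * s k.
      rewrite (le_trans (ler_mx_normM _ _))// -[E k]/(A k - J) nE.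
      by rewrite ler_wpM2r ?(ltW sk0)// ler_wpM2l.
    have n4 : `|(s k *: X) * E k| <= d%:R * (s k * `|X|) * s k.
      rewrite (le_trans (ler_mx_normM _ _))// -[E k]/(A k - J) nE.
      by rewrite normrZ gtr0_norm.
    apply: (@le_trans _ _ (d%:R * (K * s k * s k) * `|J| +
       s k * `|(s k)^-1 *: E k - X| + d%:R * (K * s k * s k) * s k +
       d%:R * (s k * `|X|) * s k)).
      rewrite (le_trans (ler_normB _ _))// lerD//.
      rewrite (le_trans (ler_normD _ _))// lerD//.
      by rewrite (le_trans (ler_normD _ _))// lerD// n2.
    by rewrite le_eqVlt; apply/orP; left; apply/eqP; ring.
  by rewrite -[X in X <= _ -> _]mulr1 ler_pM2l.
have sX : d%:R * (s k * `|X|) @[k --> F] --> (0 : R).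
  rewrite -[0](mulr0 d%:R); apply: cvgM; first exact: cvg_cst.
  by rewrite -[0](mul0r `|X|); apply: cvgM => //; exact: cvg_cst.
have Ks : d%:R * (K * s k) @[k --> F] --> (0 : R).
  rewrite -[0](mulr0 d%:R); apply: cvgM; first exact: cvg_cst.
  by rewrite -[0](mulr0 K); apply: cvgM => //; exact: cvg_cst.
have EX0 : `|(s k)^-1 *: E k - X| @[k --> F] --> (0 : R).
  have H : (s k)^-1 *: E k - X @[k --> F] --> X - X.
    by apply: cvgB => //; exact: cvg_cst.
  by move/cvg_norm : H; rewrite subrr normr0.
have RHS0 : d%:R * (K * s k) * `|J| + `|(s k)^-1 *: E k - X| +
     d%:R * (K * s k) * s k + d%:R * `|X| * s k @[k --> F] --> (0 : R).
  have -> : (0 : R) = 0 * `|J| + 0 + 0 * 0 + d%:R * `|X| * 0 by ring.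
  apply: cvgD; [apply: cvgD; [apply: cvgD => //|]|].
  - by apply: cvgM => //; exact: cvg_cst.
  - exact: cvgM.
  - by apply: cvgM => //; exact: cvg_cst.
have /filter_ex[k [h1 h2]] : \forall k \near F, d%:R * (s k * `|X|) <= 1 /\
    d%:R * (K * s k) * `|J| + `|(s k)^-1 *: E k - X| +
     d%:R * (K * s k) * s k + d%:R * `|X| * s k <= 2^-1.
  apply: filterI.
    move/cvgrPdist_le : sX => /(_ 1 ltr01); apply: filterS => k.
    by rewrite sub0r normrN; apply: le_trans; exact: ler_norm.
  have h20 : 0 < 2^-1 :> R by rewrite invr_gt0.
  move/cvgrPdist_le : RHS0 => /(_ _ h20); apply: filterS => k.
  by rewrite sub0r normrN; apply: le_trans; exact: ler_norm.
have := le_trans (bound k h1) h2.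
by rewrite leNgt invf_lt1 ?ltr1n.
Qed.

End step.
End semigroup.

(** * Descent on the rank of the idempotent *)

Section decaying_semigroup.
Context (R : realType) (d : nat) (mu : probability 'cV[R]_d R).
Hypothesis full_mu : full mu.
Implicit Types A J X : 'M[R]_d.
Local Notation D A := (factor mu A 1).

Hypothesis generator : forall J, J * J = J -> D J -> J <> 0 ->
  exists X, [/\ J * X = X, X * J = X,
    forall t, 0 <= t -> D (expmx (t *: X) * J) &
    ~ forall t, 0 <= t -> factor mu J (expmx (t *: X) * J)].

(** The semigroup is the identity on the image of [J] and decays on its kernel; the induction goes
    from [J = 1], [Q = 0] to [J = 0]. *)
Definition decays_to (J Q : 'M[R]_d) :=
  [/\ J * J = J, Q * J = 0, J * Q = 0,
    forall t, 0 <= t -> D (expmx (t *: Q)) &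
    expmx (t *: Q) @[t --> +oo] --> J].

Let sMl (t : R) A B : t *: (A * B) = (t *: A) * B.
Proof. exact: scalemxAl. Qed.

Let sMr (t : R) A B : t *: (A * B) = A * (t *: B).
Proof. exact: scalemxAr. Qed.

(** [E * J = E] puts the row space of [E] into that of [J]; with equal ranks [J = K E] for some [K],
    hence [E = J E = J]. *)
Lemma rank_idem_lt J E : J * E = E -> E * J = E -> E * E = E -> E <> J ->
  (\rank E < \rank J)%N.
Proof.
move=> JE EJ EE EneqJ.
have EsJ : (E <= J)%MS by rewrite -EJ submxMl.
rewrite ltn_neqAle mxrankS// andbT; apply/negP => /eqP rEJ; apply: EneqJ.
have /submxP[K JK] : (J <= E)%MS.
  by have := mxrank_leqif_eq EsJ => -[_]; rewrite rEJ eqxx => /esym/andP[].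
by rewrite -JE JK mulmx_ring -mulrA EE.
Qed.

(** One time at which [T P] is small suffices: later values arise from it by multiplication with a
    bounded [T (t - n_k)]. *)
Lemma semigroup_cvg0 (T : R -> 'M[R]_d) (P : 'M[R]_d) (c : R)
    (F : set_system nat) {FF : ProperFilter F} (n_ : nat -> nat) :
  (forall s t, T (s + t) = T s * T t) -> (forall t, 0 <= t -> `|T t| <= c) ->
  T (n_ k)%:R * P @[k --> F] --> (0 : 'M[R]_d) ->
  T t * P @[t --> +oo] --> (0 : 'M[R]_d).
Proof.
move=> TD Tc H; have c0 : 0 <= c by exact: le_trans (normr_ge0 _) (Tc 0 _).
apply/cvgrPdist_le => e e0.
have K0 : 0 < d%:R * c + 1 by rewrite ltr_wpDl// mulr_ge0.
move/cvgrPdist_le : H => /(_ _ (divr_gt0 e0 K0))/filter_ex[k].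
rewrite sub0r normrN => kP; near=> t; rewrite sub0r normrN.
have kt : (n_ k)%:R <= t by near: t; exact: nbhs_pinfty_ge.
have -> : T t = T (t - (n_ k)%:R) * T (n_ k)%:R by rewrite -TD subrK.
rewrite -mulrA (le_trans (ler_mx_normM _ _))//.
apply: (@le_trans _ _ ((d%:R * c + 1) * `|T (n_ k)%:R * P|)).
  rewrite ler_wpM2r// (@le_trans _ _ (d%:R * c)) ?lerDl//.
  by rewrite ler_wpM2l// Tc// subr_ge0.
by rewrite mulrC -ler_pdivlMr.
Unshelve. all: by end_near. Qed.

(** [E] is an idempotent limit of T(n_k), where T(t) = e^(tX) J, and [P = J - E] is the part of [J]
    on which decay is gained. [Q] and [X * P] annihilate each other, so the exponential of their sum
    is e^(tQ) (e^(tX) P + 1 - P), a product of two elements of D(mu). *)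
Lemma decays_to_step J Q : J <> 0 -> decays_to J Q ->
  exists J' Q', (\rank J' < \rank J)%N /\ decays_to J' Q'.
Proof.
move=> J0 [JJ QJ JQ DQ cQ].
have DJ : D J.
  apply: (@factor_closed _ _ mu _ +oo _ (fun t => expmx (t *: Q)) (fun=> 1)) => //.
    by near=> t; apply: DQ; near: t; exact: nbhs_pinfty_ge.
  exact: cvg_cst.
have [X [JX XJ DX nX]] := generator JJ DJ J0.
have [c cP] := factor_bounded full_mu.
have cXt A t : A * X = X * A -> A * expmx (t *: X) = expmx (t *: X) * A.
  move=> AX; apply: expmx_comm.
  by rewrite -!mulmx_ring -scalemxAl -scalemxAr !mulmx_ring AX.
have JXt t : J * expmx (t *: X) = expmx (t *: X) * J by apply: cXt; rewrite JX XJ.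
pose T t := expmx (t *: X) * J.
have TD s t : T (s + t) = T s * T t.
  rewrite /T scalerDl expmxD; last first.
    by rewrite -!mulmx_ring -!scalemxAl -!scalemxAr !scalerA mulrC.
  by rewrite mulrA -[_ * J * expmx _]mulrA JXt !mulrA -[RHS]mulrA JJ.
have TJ t : T t * J = T t by rewrite /T -mulrA JJ.
have JT t : J * T t = T t by rewrite /T mulrA JXt -mulrA JJ.
have Tn n : T 1 ^+ n.+1 = T n.+1%:R.
  elim: n => [|n IH]; first by rewrite expr1.
  by rewrite exprS IH -TD nat1r.
have Tbound n : `|T 1 ^+ n| <= c.
  case: n => [|n]; first by rewrite expr0; apply: cP; exact: factor_refl.
  by rewrite Tn; apply: cP; exact: DX.
have [F [n_ [E [FF noo TE EE]]]] := idempotent_limit Tbound.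
have TnE : T (n_ k)%:R @[k --> F] --> E.
  have H : \forall k \near F, T 1 ^+ n_ k = T (n_ k)%:R.
    by apply: filterS (noo 1%N) => k /prednK <-; rewrite Tn.
  by apply: cvg_trans TE; apply: near_eq_cvg.
have limU (u : nat -> 'M[R]_d) (l l' : 'M[R]_d) :
    u k @[k --> F] --> l -> u k @[k --> F] --> l' -> l = l'.
  by move=> ul ul'; exact: (cvg_unique (@norm_hausdorff _ _) ul ul').
have JE : J * E = E.
  apply: (limU (fun k => J * T (n_ k)%:R)); first exact: cvg_mulmxl.
  by apply: (cvg_ext _ TnE) => k; rewrite JT.
have EJ : E * J = E.
  apply: (limU (fun k => T (n_ k)%:R * J)); first exact: cvg_mulmxr.
  by apply: (cvg_ext _ TnE) => k; rewrite TJ.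
have EX : E * X = X * E.
  apply: (limU (fun k => T (n_ k)%:R * X)); first exact: cvg_mulmxr.
  have H : X * T (n_ k)%:R @[k --> F] --> X * E by exact: cvg_mulmxl.
  apply: (cvg_ext _ H) => k.
  by rewrite /T mulrA (cXt X _ erefl) -[LHS]mulrA XJ -[RHS]mulrA JX.
have DE : D E.
  have DT : \forall k \near F, D (T (n_ k)%:R) by apply: nearW => k; exact: DX.
  by apply: (factor_closed DT TnE); exact: cvg_cst.
have facT s t : 0 <= s -> factor mu (T (t + s)) (T t).
  by move=> s0; rewrite TD; have := factor_mull (T t) (DX s s0); rewrite mulmx1.
(* [T (n_k)] is a factor of [T t] once [t <= n_k]. If these tended to [J], then [J] would be a
   factor of every [T t], against the choice of [X]. *)
have EneqJ : E <> J.
  move=> EqJ; apply: nX => t t0.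
  apply: (@factor_closed _ _ mu _ F _ (fun k => T (n_ k)%:R) (fun=> T t)).
  - apply: filterS (noo (Num.truncn t).+1) => k nk.
    have tn : t <= (n_ k)%:R.
      rewrite (le_trans (ltW (truncnS_gt t)))// ler_nat//.
    have -> : (n_ k)%:R = t + ((n_ k)%:R - t) by rewrite addrC subrK.
    by apply: facT; rewrite subr_ge0.
  - by rewrite -EqJ.
  - exact: cvg_cst.
pose P := J - E.
have PP : P * P = P by rewrite /P mulrBr !mulrBl JJ JE EJ EE subrr subr0.
have JP : J * P = P by rewrite /P mulrBr JJ JE.
have PJ : P * J = P by rewrite /P mulrBl JJ EJ.
have EP : E * P = 0 by rewrite /P mulrBr EJ EE subrr.
have PE : P * E = 0 by rewrite /P mulrBl JE EE subrr.
have XP : X * P = P * X by rewrite /P mulrBr mulrBl XJ JX EX.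
have DP : D P.
  have -> : P = J * (1 - E) by rewrite mulrBr mulr1 JE.
  exact: (factor_mul DJ (factor_compl EE DE)).
have QP : Q * P = 0 by rewrite -JP mulrA QJ mul0r.
have PQ : P * Q = 0 by rewrite -PJ -mulrA JQ mulr0.
have expQ t : expmx (t *: (Q + X * P)) =
    expmx (t *: Q) * (expmx (t *: X) * P + (1 - P)).
  rewrite scalerDr expmxD.
    have tXP : (t *: X) * P = P * (t *: X) by rewrite -sMl -sMr XP.
    by rewrite sMl (expmx_idem tXP PP).
  by rewrite -!sMl -!sMr -mulrA PQ mulr0 XP mulrA QP mul0r.
have TP t : expmx (t *: X) * P = T t * P by rewrite /T -mulrA JP.
have PT t : T t * P = P * T t.
  by rewrite -TP /T mulrA cXt -?mulrA ?PJ.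
have DTP t : 0 <= t -> D (expmx (t *: X) * P + (1 - P)).
  move=> t0; have CP : expmx (t *: X) * P * P = expmx (t *: X) * P.
    by rewrite -mulrA PP.
  have fP : factor mu (expmx (t *: X) * P) P.
    by rewrite TP PT; have := factor_mull P (DX t t0); rewrite mulmx1.
  by rewrite addrA; exact: (factor_extend PP DP CP fP).
have cTP : T t * P @[t --> +oo] --> (0 : 'M[R]_d).
  apply: (semigroup_cvg0 (F := F) (n_ := n_) (c := c) TD).
    by move=> t t0; apply: cP; exact: DX.
  by rewrite -EP; exact: cvg_mulmxr.
exists E, (Q + X * P); split.
  exact: rank_idem_lt.
split; first exact: EE.
- by rewrite mulrDl -mulrA PE mulr0 addr0 -JE mulrA QJ mul0r.
- by rewrite mulrDr mulrA EX -mulrA EP mulr0 addr0 -EJ -mulrA JQ mulr0.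
- by move=> t t0; rewrite expQ; apply: factor_mul; [exact: DQ|exact: DTP].
- have EqE : E = J * (0 + (1 - P)).
    by rewrite add0r mulrBr mulr1 JP /P opprB addrC subrK.
  rewrite [X in _ --> X]EqE.
  apply: (@cvg_ext _ _ _ (fun t => expmx (t *: Q) *m (T t * P + (1 - P)))).
    by move=> t; rewrite expQ TP.
  apply: (cvg_mulmx cQ); apply: (cvgD cTP); exact: cvg_cst.
Unshelve. all: by end_near. Qed.

Theorem exists_decaying_semigroup : exists Q : 'M[R]_d,
  (forall t, 0 <= t -> D (expmx (t *: Q))) /\
  expmx (t *: Q) @[t --> +oo] --> (0 : 'M[R]_d).
Proof.
suff H r J Q : (\rank J <= r)%N -> decays_to J Q -> exists Q : 'M[R]_d,
    (forall t, 0 <= t -> D (expmx (t *: Q))) /\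
    expmx (t *: Q) @[t --> +oo] --> (0 : 'M[R]_d).
  apply: (H _ 1 0 (leqnn _)).
  have e0 (t : R) : expmx (t *: (0 : 'M[R]_d)) = 1 by rewrite scaler0 expmx0.
  split; rewrite ?mul1r ?mulr1 //.
    by move=> t _; rewrite e0; exact: factor_refl.
  have -> : (fun t : R => expmx (t *: (0 : 'M[R]_d))) = fun=> 1 by apply/funext.
  exact: cvg_cst.
have J0 J' Q' : J' = 0 -> decays_to J' Q' -> exists Q : 'M[R]_d,
    (forall t, 0 <= t -> D (expmx (t *: Q))) /\
    expmx (t *: Q) @[t --> +oo] --> (0 : 'M[R]_d).
  by move=> -> [_ _ _ DQ cQ]; exists Q'.
elim: r J Q => [|r IH] J Q rJ JQ.
  by apply: J0 JQ; apply/eqP; rewrite -mxrank_eq0 -leqn0.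
have [Jz|Jz] := pselect (J = 0); first exact: J0 JQ.
have [J' [Q' [rJ' J'Q']]] := decays_to_step Jz JQ.
by apply: IH J'Q'; rewrite -ltnS (leq_trans rJ').
Qed.

End decaying_semigroup.

(** * Strong mixing *)

Lemma four_dist_le (R : realFieldType) (p q p' q' u a : R) :
  `|p - q| <= 2 * u -> `|p' - q'| <= 2 * u -> `|q - q'| <= a ->
  `|p - p'| <= a + 4 * u.
Proof. by rewrite !ler_norml; lra. Qed.

Section covariance_bound.
Context (R : realType) d (T : measurableType d) (P : probability T R).
Implicit Types f g : T -> R.
Local Notation bm := (@bounded_measurable R _ T).

Definition cov f g := \int[P]_x (f x * g x) - \int[P]_x f x * \int[P]_x g x.

(** On [[0, 1]] this is the floor of [(N + 1) t] divided by [N + 1]. As a sum of indicators of upper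
    level sets it reduces covariances to the events that the mixing coefficient controls. *)
Let staircase N (t : R) := N.+1%:R^-1 * \sum_(i < N.+1) (i.+1%:R <= N.+1%:R * t)%R%:R : R.

Lemma staircase_close N t : 0 <= t <= 1 -> `|t - staircase N t| <= N.+1%:R^-1.
Proof.
move=> /andP[t0 t1]; have N0 : 0 < N.+1%:R :> R by [].
have s0 : 0 <= N.+1%:R * t by rewrite mulr_ge0.
have /andP[k1 k2] := truncn_itv s0.
set k := Num.truncn _ in k1 k2.
have kN : (k <= N.+1)%N by rewrite -(ler_nat R) (le_trans k1)// ler_piMr.
have -> : staircase N t = N.+1%:R^-1 * k%:R.
  congr (_ * _); rewrite (eq_bigr (fun i : 'I_N.+1 => if (i < k)%N then 1 else 0)); last first.
    by move=> i _; rewrite -truncn_ge_nat// -/k; case: ifP.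
  by rewrite -big_mkcond/= -(big_ord_widen _ (fun=> 1 : R) kN) sumr_const card_ord.
have -> : t - N.+1%:R^-1 * k%:R = N.+1%:R^-1 * (N.+1%:R * t - k%:R).
  by rewrite mulrBr mulKf// gt_eqF.
rewrite normrM gtr0_norm ?invr_gt0// ler_piMr ?invr_ge0//.
by rewrite ger0_norm ?subr_ge0// lerBlDl natr1 ltW.
Qed.

Lemma staircase_itv N t : 0 <= staircase N t <= 1.
Proof.
apply/andP; split; first by rewrite mulr_ge0 ?invr_ge0// sumr_ge0.
rewrite ler_pdivrMl// mulr1 (@le_trans _ _ (\sum_(i < N.+1) 1))//.
  by apply: ler_sum => i _; rewrite lern1 leq_b1.
by rewrite sumr_const card_ord.
Qed.

Lemma bm_staircase N f : measurable_fun setT f ->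
  bm (fun x => staircase N (f x)).
Proof.
move=> mf; apply: bmM; first exact: bm_cst.
apply: bm_sum => i _.
rewrite (_ : (fun x => _) = \1_[set x | i.+1%:R / N.+1%:R <= f x]).
  apply: bm_indic; rewrite (_ : [set x | _] = setT `&` f @^-1` `[i.+1%:R / N.+1%:R, +oo[%classic).
    by apply: mf => //; exact: measurable_itv.
  by apply/seteqP; split => x /=; rewrite in_itv/= andbT//; case.
apply/funext => x; rewrite indicE; congr ((nat_of_bool _)%:R).
by apply/idP/idP; rewrite inE /= ler_pdivrMr// mulrC.
Qed.

Variables (F G : set (set T)) (a : R).
Hypothesis FG : forall A B, F A -> G B ->
  [/\ measurable A, measurable B & `|fine (P (A `&` B)) - fine (P A) * fine (P B)| <= a].

(** The covariance is a mean over [(N + 1) ^ 2] pairs of level sets, each contributing at most [a];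
    the bound is free of [N] and survives the limit in [cov_unit_le]. *)
Lemma cov_staircase N f g : (forall c, F [set x | c <= f x]) ->
  (forall c, G [set x | c <= g x]) ->
  `|cov (fun x => staircase N (f x)) (fun x => staircase N (g x))| <= a.
Proof.
move=> Ff Gg.
pose A i := [set x | i.+1%:R / N.+1%:R <= f x].
pose B i := [set x | i.+1%:R / N.+1%:R <= g x].
have mA i : measurable (A i) by have [] := FG (Ff (i.+1%:R / N.+1%:R)) (Gg 0).
have mB i : measurable (B i) by have [] := FG (Ff 0) (Gg (i.+1%:R / N.+1%:R)).
have stE (h : T -> R) x : staircase N (h x) = N.+1%:R^-1 *
    \sum_(i < N.+1) \1_[set x | i.+1%:R / N.+1%:R <= h x] x.
  congr (_ * _); apply: eq_bigr => i _; rewrite indicE; congr ((nat_of_bool _)%:R).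
  by apply/idP/idP; rewrite inE /= ler_pdivrMr// mulrC.
have fE : (fun x => staircase N (f x)) = fun x => N.+1%:R^-1 * \sum_(i < N.+1) \1_(A i) x.
  by apply/funext => x; rewrite stE.
have gE : (fun x => staircase N (g x)) = fun x => N.+1%:R^-1 * \sum_(i < N.+1) \1_(B i) x.
  by apply/funext => x; rewrite stE.
rewrite /cov (_ : (fun x => staircase N (f x) * staircase N (g x)) =
    fun x => (N.+1%:R^-1 * N.+1%:R^-1) *
      \sum_(i < N.+1) \sum_(j < N.+1) \1_(A i `&` B j) x); last first.
  apply/funext => x; rewrite !stE mulrACA big_distrlr/=; congr (_ * _).
  by apply: eq_bigr => i _; apply: eq_bigr => j _; rewrite indicI.
rewrite fE gE !ExZ; try (by apply: bm_sum => i _; exact: bm_indic); last first.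
  by apply: bm_sum => i _; apply: bm_sum => j _; apply: bm_indic; exact: measurableI.
rewrite !Ex_sum; try (by move=> i; exact: bm_indic); last first.
  by move=> i; apply: bm_sum => j _; apply: bm_indic; exact: measurableI.
under eq_bigr do (rewrite Ex_sum; last by move=> j; apply: bm_indic; exact: measurableI).
rewrite [X in _ * X - _](eq_bigr (fun i : 'I_N.+1 => \sum_(j < N.+1) fine (P (A i `&` B j)))); last first.
  by move=> i _; apply: eq_bigr => j _; rewrite Ex_indic//; exact: measurableI.
under [X in _ - (_ * X) * _]eq_bigr do rewrite Ex_indic//.
under [X in _ - _ * (_ * X)]eq_bigr do rewrite Ex_indic//.
rewrite mulrACA -mulrBr big_distrlr/= -sumrB.
under eq_bigr do rewrite -sumrB.
rewrite normrM -invfM ger0_norm ?invr_ge0 ?mulr_ge0// ler_pdivrMl ?mulr_gt0//.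
rewrite (le_trans (ler_norm_sum _ _ _))//.
apply: (@le_trans _ _ (\sum_(i < N.+1) (N.+1%:R * a))).
  apply: ler_sum => i _; rewrite (le_trans (ler_norm_sum _ _ _))//.
  apply: (@le_trans _ _ (\sum_(i < N.+1) a)).
    by apply: ler_sum => j _; have [] := FG (Ff (i.+1%:R / N.+1%:R)) (Gg (j.+1%:R / N.+1%:R)).
  by rewrite sumr_const card_ord mulr_natl.
by rewrite sumr_const card_ord -[leLHS]mulr_natl mulrA.
Qed.

Lemma cov_unit_le f g : bm f -> bm g ->
  (forall x, 0 <= f x <= 1) -> (forall x, 0 <= g x <= 1) ->
  (forall c, F [set x | c <= f x]) ->
  (forall c, G [set x | c <= g x]) -> `|cov f g| <= a.
Proof.
move=> bf bg f01 g01 Ff Gg.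
have mf := bf.1; have mg := bg.1.
suff H N : `|cov f g| <= a + 4 * N.+1%:R^-1.
  apply/ler_addgt0Pr => e e0; have [N Ne] := natSinv_lt (divr_gt0 e0 (ltr0n R 4)).
  rewrite (le_trans (H N))// lerD2l mulrC -ler_pdivlMr// ltW//.
pose fN x := staircase N (f x); pose gN x := staircase N (g x).
have bfN : bm fN by exact: bm_staircase.
have bgN : bm gN by exact: bm_staircase.
have E1 : `|\int[P]_x (f x * g x) - \int[P]_x (fN x * gN x)| <= 2 * N.+1%:R^-1.
  rewrite -ExB; [|exact: bmM|exact: bmM].
  apply: norm_Ex_le; first by apply: bmB; exact: bmM.
  move=> x; have -> : f x * g x - fN x * gN x = (f x - fN x) * g x + fN x * (g x - gN x) by ring.
  have /andP[g0 g1] := g01 x; have /andP[h0 h1] := staircase_itv N (f x).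
  rewrite (le_trans (ler_normD _ _))// mulr_natl mulr2n lerD// normrM.
    by rewrite -[leRHS]mulr1 ler_pM// ?staircase_close// ger0_norm.
  by rewrite -[leRHS]mul1r ler_pM// ?staircase_close// ger0_norm.
have I1 (h h' : T -> R) : bm h -> bm h' -> (forall x, `|h x - h' x| <= N.+1%:R^-1) ->
    `|\int[P]_x h x - \int[P]_x h' x| <= N.+1%:R^-1.
  by move=> bh bh' H; rewrite -ExB//; apply: norm_Ex_le => //; exact: bmB.
have E2 : `|\int[P]_x f x * \int[P]_x g x - \int[P]_x fN x * \int[P]_x gN x|
    <= 2 * N.+1%:R^-1.
  set I := \int[P]_x f x; set J := \int[P]_x g x.
  set I' := \int[P]_x fN x; set J' := \int[P]_x gN x.
  have -> : I * J - I' * J' = (I - I') * J + I' * (J - J') by ring.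
  rewrite (le_trans (ler_normD _ _))// mulr_natl mulr2n lerD// normrM.
    rewrite -[leRHS]mulr1 ler_pM//; first by apply: I1 => // x; exact: staircase_close.
    by apply: norm_Ex_le => // x; have /andP[g0 g1] := g01 x; rewrite ger0_norm.
  rewrite -[leRHS]mul1r ler_pM//; last by apply: I1 => // x; exact: staircase_close.
  by apply: norm_Ex_le => // x; have /andP[g0 g1] := staircase_itv N (f x); rewrite ger0_norm.
have E3 := cov_staircase N Ff Gg.
exact: (four_dist_le E1 E2 E3).
Qed.

(** Reduction to [[0, 1]] by [h |-> (h + K) / (2 K)], which divides covariances by [4 K ^ 2]. *)
Lemma cov_le f g (K : R) : 0 < K -> bm f -> bm g ->
  (forall x, `|f x| <= K) -> (forall x, `|g x| <= K) ->
  (forall c, F [set x | c <= f x]) ->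
  (forall c, G [set x | c <= g x]) -> `|cov f g| <= 4 * K ^+ 2 * a.
Proof.
move=> K0 bf bg fK gK Ff Gg.
have K20 : 0 < 2 * K by rewrite mulr_gt0.
pose u (h : T -> R) x := (2 * K)^-1 * (h x + K).
have bu h : bm h -> bm (u h).
  by move=> bh; apply: bmM; [exact: bm_cst|apply: bmD => //; exact: bm_cst].
have u01 (h : T -> R) : (forall x, `|h x| <= K) -> forall x, 0 <= u h x <= 1.
  move=> hK x; have := hK x; rewrite ler_norml => /andP[h1 h2].
  rewrite /u mulr_ge0 ?invr_ge0 ?(ltW K20)//=; last by rewrite -lerBlDr sub0r.
  by rewrite ler_pdivrMl// mulr1 mulr_natl mulr2n lerD2r.
have uF (H : set (set T)) (h : T -> R) : (forall c, H [set x | c <= h x]) ->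
    forall c, H [set x | c <= u h x].
  move=> Hh c; rewrite (_ : [set x | _] = [set x | 2 * K * c - K <= h x])//.
  by apply/seteqP; split => x /=; rewrite /u ler_pdivlMl// lerBlDr.
have := cov_unit_le (bu _ bf) (bu _ bg) (u01 _ fK) (u01 _ gK) (uF _ _ Ff) (uF _ _ Gg).
have -> : cov f g = 4 * K ^+ 2 * cov (u f) (u g).
  rewrite /cov; have -> : (fun x => u f x * u g x) = fun x => ((2 * K)^-1 * (2 * K)^-1) *
    (f x * g x + K * f x + (K * g x + K * K)) by apply/funext => x; rewrite /u; ring.
  rewrite /u !ExZ//; do ?[apply: bmD|apply: bmM|exact: bm_cst]; rewrite ?ExD; 
    do ?[apply: bmD|apply: bmM|exact: bm_cst] => //.
  rewrite (ExZ P K bf) (ExZ P K bg) (Ex_cst P K) (Ex_cst P (K * K)); field; exact: lt0r_neq0.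
by move=> H; rewrite normrM ger0_norm ?ler_wpM2l// ?mulr_ge0 ?exprn_ge0 ?ltW.
Qed.

End covariance_bound.

Lemma dist_subB_le (R : realFieldType) (a b c e p : R) :
  `|a - b| <= p -> `|c - e| <= p -> `|a - c - (b - e)| <= p + p.
Proof. by rewrite !ler_norml; lra. Qed.

Section perturbation.
Context (R : realType) (n : nat) d (T : measurableType d) (P : probability T R).
Implicit Types U V e : T -> 'cV[R]_n.

Lemma bm_clip_vec (c : R) e : measurable_fun setT e ->
  bounded_measurable (fun w => clip (c * `|e w|)).
Proof.
move=> me; have -> : (fun w => clip (c * `|e w|)) = fun w => clip (0 + c * `|e w - 0|).
  by apply/funext => w; rewrite add0r subr0.
exact: (@bm_of_bl_comp _ _ _ _ e (fun x => clip (0 + c * `|x - 0|)) me (bl_clip_norm _ _ _)).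
Qed.

(** A displacement [e] changes [g] by at most [2 K clip |e|], by the slope when [e] is small and by
    the bound when it is large; each of the two terms of the covariance contributes [2 K ^ 2]. *)
Lemma cov_perturb U V e (f g : 'cV[R]_n -> R) (K : R) :
  measurable_fun setT U -> measurable_fun setT V -> measurable_fun setT e ->
  0 <= K -> bounded_lipschitz f -> bounded_lipschitz g ->
  (forall x, `|f x| <= K) -> (forall x, `|g x| <= K) ->
  (forall x y, `|g x - g y| <= K * `|x - y|) ->
  `|cov P (f \o U) (fun w => g (V w + e w)) - cov P (f \o U) (g \o V)|
    <= 4 * K ^+ 2 * \int[P]_w clip (`|e w|).
Proof.
move=> mU mV me K0 bf bg fK gK gL.
have bc : bounded_measurable (fun w => clip (`|e w|)).
  have := bm_clip_vec 1 me; congr bounded_measurable.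
  by apply/funext => w; rewrite mul1r.
have bfU : bounded_measurable (f \o U) by exact: bm_of_bl_comp.
have bgV : bounded_measurable (g \o V) by exact: bm_of_bl_comp.
have bgVe : bounded_measurable (fun w => g (V w + e w)).
  by apply: (@bm_of_bl_comp _ _ _ _ (fun w => V w + e w)) => //; exact: measurable_cVD.
have gD w : `|g (V w + e w) - g (V w)| <= 2 * K * clip (`|e w|).
  have [e1|e1] := leP (`|e w|) 1.
    rewrite clip_id ?normr_ge0//; apply: (@le_trans _ _ (K * `|e w|)).
      by rewrite (le_trans (gL _ _))// addrAC subrr add0r.
    by rewrite ler_wpM2r// ler_peMl// ler1n.
  rewrite (clip1 (ltW e1)) mulr1 (le_trans (ler_normB _ _))// mulr_natl mulr2n.
  by rewrite lerD.
have E1 : `|\int[P]_w (f (U w) * g (V w + e w)) - \int[P]_w (f (U w) * g (V w))|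
    <= 2 * K ^+ 2 * \int[P]_w clip (`|e w|).
  rewrite -(ExB P (bmM bfU bgVe) (bmM bfU bgV)).
  rewrite -(ExZ P (2 * K ^+ 2) bc); apply: le_norm_Ex.
  - by apply: bmB; exact: bmM.
  - by apply: bmM => //; exact: bm_cst.
  move=> w /=; rewrite -mulrBr normrM.
  rewrite (_ : 2 * K ^+ 2 * clip _ = K * (2 * K * clip `|e w|)); last by ring.
  by rewrite ler_pM.
have E2 : `|\int[P]_w f (U w) * \int[P]_w g (V w + e w) -
    \int[P]_w f (U w) * \int[P]_w g (V w)| <= 2 * K ^+ 2 * \int[P]_w clip (`|e w|).
  rewrite -mulrBr normrM (_ : 2 * K ^+ 2 * _ = K * (2 * K * \int[P]_w clip `|e w|)); last by ring.
  rewrite ler_pM//; first by apply: norm_Ex_le.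
  rewrite -(ExB P bgVe bgV) -(ExZ P (2 * K) bc); apply: le_norm_Ex => //.
  - exact: bmB.
  - by apply: bmM => //; exact: bm_cst.
move: E1 E2; rewrite /cov /comp.
set I := \int[P]_w clip `|e w|; set p := 2 * K ^+ 2 * I.
have -> : 4 * K ^+ 2 * I = p + p by rewrite /p; ring.
move=> E1 E2; exact: dist_subB_le.
Qed.

Lemma Ex_clip_sum (I : eqType) (r : seq I) (p : pred I) (e : I -> T -> 'cV[R]_n) (c : R) (dl : R) :
  (forall i, measurable_fun setT (e i)) -> 0 <= c ->
  (forall i, i \in r -> p i -> \int[P]_w clip (c * `|e i w|) <= dl) ->
  \int[P]_w clip (c * `|\sum_(i <- r | p i) e i w|) <= (count p r)%:R * dl.
Proof.
move=> me c0; elim: r => [|i r IH] ce.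
  under eq_Rintegral do rewrite big_nil normr0 mulr0 clip0//.
  by rewrite Ex_cst mul0r.
have {}IH : \int[P]_w clip (c * `|\sum_(i <- r | p i) e i w|) <= (count p r)%:R * dl.
  by apply: IH => j jr; apply: ce; rewrite inE jr orbT.
rewrite /=; have [pi|pi] := boolP (p i); last first.
  by under eq_Rintegral do rewrite big_cons (negbTE pi); rewrite add0n.
have ms : measurable_fun setT (fun w => \sum_(i <- r | p i) e i w).
  rewrite (_ : (fun w => _) = fun w => \sum_(i <- [seq i <- r | p i]) e i w).
    exact: measurable_cV_sum.
  by apply/funext => w; rewrite big_filter.
rewrite natrD mulrDl mul1r.
apply: (@le_trans _ _ (\int[P]_w (clip (c * `|e i w|) + clip (c * `|\sum_(i <- r | p i) e i w|)))).
  apply: le_Ex.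
  - have := bm_clip_vec c (measurable_cVD (me i) ms); congr bounded_measurable.
    by apply/funext => w; rewrite big_cons pi.
  - by apply: bmD; exact: bm_clip_vec.
  move=> w; rewrite big_cons pi; apply: le_trans (clip_subadd _ _).
  by apply: clip_homo; rewrite -mulrDr ler_wpM2l// ler_normD.
rewrite (ExD P (bm_clip_vec c (me i)) (bm_clip_vec c ms)).
exact: lerD (ce i (mem_head _ _) pi) IH.
Qed.

End perturbation.

Section mixing.
Context (R : realType) (n : nat) dO (Omega : measurableType dO).
Context (P : probability Omega R) (X : nat -> {RV P >-> 'cV[R]_n}).

Lemma sigma_of_sub (K : set nat) : sigma_of X K `<=` measurable.
Proof.
apply: smallest_sub; first exact: sigma_algebra_measurable.
move=> E [k _] [B mB <-]; rewrite setTI.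
by rewrite -[X in measurable X]setTI; exact: measurable_funP.
Qed.

Lemma sigma_of_sum (K : set nat) (r : seq nat) (p : pred nat) (M : 'M[R]_n) b B :
  (forall j, j \in r -> p j -> K j) -> measurable B ->
  sigma_of X K ((fun w => M *m (\sum_(j <- r | p j) X j w) + b) @^-1` B).
Proof.
move=> rK mB.
pose T := g_sigma_algebraType (\bigcup_(k in K) g_sigma_algebra_preimage (X k)).
have mX j : K j -> measurable_fun setT (X j : T -> 'cV[R]_n).
  move=> Kj _ C mC; apply: sub_sigma_algebra; exists j => //.
  by exists C.
(* Variables outside [K] are replaced by [0], so that every term is measurable for the generated
   sigma-field and the general lemma on sums applies. *)
pose Z j : T -> 'cV[R]_n := if `[< K j >] then (X j : Omega -> 'cV[R]_n) else fun=> 0.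
have mZ j : measurable_fun setT (Z j).
  rewrite /Z; case: asboolP => Kj; [exact: mX|exact: measurable_cst].
have mS : measurable_fun setT (fun w : T =>
    M *m (\sum_(j <- [seq j <- r | p j]) Z j w) + b).
  apply: measurable_cVD; last exact: measurable_cst.
  by apply: measurable_cV_mulmx; exact: measurable_cV_sum.
have := mS measurableT B mB; rewrite setTI.
congr (sigma_of X K _); apply/funext => w /=; congr B; congr (_ *m _ + _).
rewrite big_filter big_seq_cond [RHS]big_seq_cond; apply: eq_bigr => j /andP[jr pj].
by rewrite /Z asboolT//; exact: rK.
Qed.

Lemma cov_mixing (q m N : nat) (a : R) (M M' : 'M[R]_n) b b' (p : pred nat)
    (f g : 'cV[R]_n -> R) (K : R) : (1 <= m)%N ->
  (alpha_seq X q <= a%:E)%E ->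
  0 < K -> bounded_lipschitz f -> bounded_lipschitz g ->
  (forall x, `|f x| <= K) -> (forall x, `|g x| <= K) ->
  (forall j, p j -> (m + q <= j)%N) ->
  `|cov P (fun w => f (M *m partial_sum X m w + b))
          (fun w => g (M' *m (\sum_(m.+1 <= j < N.+1 | p j) X j w) + b'))|
    <= 4 * K ^+ 2 * a.
Proof.
move=> m1 aq K0 bf bg fK gK pm.
pose F1 := sigma_of X [set k | (1 <= k <= m)%N].
pose G1 := sigma_of X [set k | (m + q <= k)%N].
have FG A B : F1 A -> G1 B ->
  [/\ measurable A, measurable B & `|fine (P (A `&` B)) - fine (P A) * fine (P B)| <= a].
  move=> FA GB; have mA := sigma_of_sub FA; have mB := sigma_of_sub GB.
  have mAB := measurableI _ _ mA mB.
  split => //; rewrite -lee_fin.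
  have -> : (`|fine (P (A `&` B)) - fine (P A) * fine (P B)|%:E =
      `|P (A `&` B) - P A * P B|)%E.
    by rewrite -[in RHS](fineK (fin_num_measure P _ mAB))
      -[in RHS](fineK (fin_num_measure P _ mA)) -[in RHS](fineK (fin_num_measure P _ mB)).
  apply: le_trans aq; apply: (@le_trans _ _ (alpha_coef P F1 G1)).
    by apply: ereal_sup_ubound; exists (A, B).
  by apply: ereal_sup_ubound; exists m.
have lev (h : 'cV[R]_n -> R) c : bounded_lipschitz h -> measurable [set x | c <= h x].
  move=> /bl_bm[mh _]; rewrite (_ : [set x | _] = setT `&` h @^-1` `[c, +oo[%classic).
    by apply: mh => //; exact: measurable_itv.
  by apply/seteqP; split => x /=; rewrite in_itv/= andbT//; case.
have mX j : measurable_fun setT (X j) by exact: measurable_funP.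
apply: (cov_le FG) => //.
- apply: (bm_of_bl_comp (phi := fun w => M *m partial_sum X m w + b)) => //.
  apply: measurable_cVD; last exact: measurable_cst.
  by apply: measurable_cV_mulmx; exact: measurable_cV_sum.
- apply: (bm_of_bl_comp (phi := fun w =>
    M' *m (\sum_(m.+1 <= j < N.+1 | p j) X j w) + b')) => //.
  apply: measurable_cVD; last exact: measurable_cst.
  apply: measurable_cV_mulmx.
  rewrite (_ : (fun w => _) = fun w => \sum_(j <- [seq j <- index_iota m.+1 N.+1 | p j]) X j w).
    exact: measurable_cV_sum.
  by apply/funext => w; rewrite big_filter.
- move=> c; have := @sigma_of_sum [set k | (1 <= k <= m)%N] (index_iota 1 m.+1)
    xpredT M b [set x | c <= f x] _ (lev f c bf).
  apply => j; rewrite mem_index_iota /=; lia.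
- move=> c; apply: (@sigma_of_sum [set k | (m + q <= k)%N] (index_iota m.+1 N.+1)
    p M' b' [set x | c <= g x] _ (lev g c bg)).
  by move=> j _ /pm.
Qed.

End mixing.

Lemma cvge0_near_lt (R : realType) (u : nat -> \bar R) (e : R) : 0 < e ->
  u n @[n --> \oo] --> 0%E -> \forall n \near \oo, (u n < e%:E)%E.
Proof.
move=> e0 u0; have H := @nbhs_open_ereal_lt R 0 (fun=> e) e0.
exact: (u0 _ H).
Qed.

(** * Factors obtained from the normalized sums *)

Section normalization.
Context (R : realType) (n : nat) dO (Omega : measurableType dO).
Context (P : probability Omega R) (X : nat -> {RV P >-> 'cV[R]_n}).
Context (A : nat -> 'M[R]_n) (b : nat -> 'cV[R]_n).
Context (mu : probability 'cV[R]_n R).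
Hypothesis X_mixing : strongly_mixing X.
Hypothesis AX_infinitesimal : infinitesimal A X.
Hypothesis AS_cvg : cvg_in_law P (fun k w => A k *m partial_sum X k w + b k) mu.
Hypothesis mu_full : full mu.

Let Y k w := A k *m partial_sum X k w + b k.

Let mX j : measurable_fun setT (X j).
Proof. exact: measurable_funP. Qed.

Let mY k : measurable_fun setT (Y k).
Proof.
apply: measurable_cVD; last exact: measurable_cst.
by apply: measurable_cV_mulmx; exact: measurable_cV_sum.
Qed.

Let Y_law f : bounded_lipschitz f ->
  \int[P]_w f (Y k w) @[k --> \oo] --> \int[mu]_x f x.
Proof.
move=> bf; have [_ [K fK]] := bl_bm bf.
have bdf : bounded_fun f.
  exists K; split; first exact: num_real.
  by move=> M KM x _ /=; rewrite (le_trans (fK x))// ltW.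
have := AS_cvg (bl_continuous bf) bdf.
rewrite -EFin_Ex; last exact: bl_bm.
move/fine_cvgP => -[_]; apply: cvg_trans; apply: near_eq_cvg; apply: nearW => k.
by rewrite /= -EFin_Ex//; exact: (bm_of_bl_comp (mY k)).
Qed.

Let Y_law_along (F : set_system nat) {FF : ProperFilter F} (p_ : nat -> nat) f :
  (forall N, \forall k \near F, (N <= p_ k)%N) -> bounded_lipschitz f ->
  \int[P]_w f (Y (p_ k) w) @[k --> F] --> \int[mu]_x f x.
Proof.
move=> poo bf; have : p_ k @[k --> F] --> \oo.
  by move=> V [N _ NV]; apply: filterS (poo N) => k; exact: NV.
move=> cp; exact: (cvg_comp p_ _ cp (Y_law bf)).
Qed.

(** Split at [e = dl / 2 / (c + 1)]: below it [c * |x| <= dl / 2], and the event above it has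
    probability at most [dl / 2] for all [j <= k] at once. *)
Lemma infinitesimal_clip (c dl : R) : 0 <= c -> 0 < dl ->
  exists N, forall k j, (N <= k)%N -> (1 <= j <= k)%N ->
    \int[P]_w clip (c * `|A k *m X j w|) <= dl.
Proof.
move=> c0 dl0; pose e := dl / 2 / (c + 1).
have d20 : 0 < dl / 2 by rewrite divr_gt0.
have e0 : 0 < e by rewrite divr_gt0// ltr_wpDl.
have [N _ HN] := cvge0_near_lt d20 (AX_infinitesimal e0).
exists N => k j Nk jk.
have mA : measurable_fun setT (fun w => A k *m X j w) by exact: measurable_cV_mulmx.
pose E := [set w | e <= `|A k *m X j w|].
have mE : measurable E.
  have mn : measurable_fun setT (fun x : 'cV[R]_n => `|x|).
    by apply: continuous_measurable_cV; exact: norm_continuous.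
  rewrite (_ : E = setT `&` (fun w => `|A k *m X j w|) @^-1` `[e, +oo[%classic).
    by apply: (measurableT_comp mn mA) => //; exact: measurable_itv.
  by apply/seteqP; split => x /=; rewrite in_itv/= andbT//; case.
have PE : fine (P E) <= dl / 2.
  have := HN k Nk; rewrite -lee_fin fineK ?fin_num_measure// => H.
  apply: le_trans (ltW H).
  apply: (@le_bigmax_seq _ _ _ _ _ j xpredT (fun j => P [set w | e <= `|A k *m X j w|])) => //.
  by rewrite mem_index_iota ltnS.
apply: (@le_trans _ _ (\int[P]_w (dl / 2 + \1_E w))).
  apply: le_Ex; first exact: (bm_clip_vec c mA).
    by apply: bmD; [exact: bm_cst|exact: bm_indic].
  move=> w; rewrite indicE; have [Ew|Ew] := boolP (w \in E).
    by rewrite (le_trans (clip_le1 _))// lerDr ltW.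
  rewrite addr0; have {}Ew : `|A k *m X j w| < e.
    by rewrite ltNge; apply/negP => H; move/negP : Ew; apply; rewrite inE.
  have H : c * `|A k *m X j w| <= dl / 2.
    apply: (@le_trans _ _ (c * e)); first by rewrite ler_wpM2l// ltW.
    rewrite /e mulrA ler_pdivrMr ?ltr_wpDl//.
    by rewrite [leRHS]mulrC ler_wpM2r ?(ltW d20)// lerDl.
  have [h1|h1] := leP (dl / 2) 1.
    by rewrite clip_id// mulr_ge0//= (le_trans H).
  by rewrite (le_trans (clip_le1 _))// ltW.
rewrite ExD; [|exact: bm_cst|exact: bm_indic].
rewrite (Ex_cst P (dl / 2)) Ex_indic// [leRHS](splitr dl) lerD2l//.
Qed.

Section along_ultrafilter.
Context (F : set_system nat) {UF : UltraFilter F}.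
Hypothesis Foo : \oo `<=` F.

Let bl_bound2 (f g : 'cV[R]_n -> R) : bounded_lipschitz f -> bounded_lipschitz g ->
  exists K : R, [/\ 0 < K, forall x, `|f x| <= K, forall x, `|g x| <= K &
    forall x y, `|g x - g y| <= K * `|x - y|].
Proof.
move=> [K1 [K10 fK _]] [K2 [K20 gK gL]]; exists (K1 + K2 + 1); split.
- by rewrite ltr_wpDl// addr_ge0.
- by move=> x; rewrite (le_trans (fK x))// -addrA lerDl addr_ge0.
- by move=> x; rewrite (le_trans (gK x))// addrAC lerDr addr_ge0.
- move=> x y; rewrite (le_trans (gL x y))// ler_wpM2r// addrAC lerDr addr_ge0//.
Qed.

(* The block of [X_j] with [m < j < m + q] is dropped from [S_n - S_m]: it is
   negligible by infinitesimality, and what remains is [q] steps away from the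
   past up to [m]. *)
Lemma mixing_factor (m_ n_ : nat -> nat) (M_ L_ : nat -> 'M[R]_n) (M L : 'M[R]_n) :
  (forall N, \forall k \near F, (N <= m_ k)%N) ->
  (forall k, (0 < m_ k <= n_ k)%N) ->
  M_ k @[k --> F] --> M -> L_ k @[k --> F] --> L ->
  (forall k, {ae P, forall w, M_ k *m (A (n_ k) *m partial_sum X (m_ k) w) =
    L_ k *m (A (m_ k) *m partial_sum X (m_ k) w)}) ->
  factor mu L M.
Proof.
move=> moo mn cM cL ML.
have noo N : \forall k \near F, (N <= n_ k)%N.
  apply: filterS (moo N) => k /leq_trans; apply.
  by have /andP[] := mn k.
(* By the hypothesis relating [M_] and [L_], [U k + V k] is almost surely [M_ k *m Y (n_ k)]; [c k]
   gathers the centring vectors. *)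
pose U k w := L_ k *m Y (m_ k) w.
pose W k (p : pred nat) w := \sum_((m_ k).+1 <= j < (n_ k).+1 | p j) X j w.
pose c k := M_ k *m b (n_ k) - L_ k *m b (m_ k).
pose V k w := (M_ k *m A (n_ k)) *m W k xpredT w + c k.
have mW k p : measurable_fun setT (W k p).
  rewrite /W (_ : (fun w => _) = fun w =>
      \sum_(j <- [seq j <- index_iota (m_ k).+1 (n_ k).+1 | p j]) X j w).
    exact: measurable_cV_sum.
  by apply/funext => w; rewrite big_filter.
have mU k : measurable_fun setT (U k) by apply: measurable_cV_mulmx; exact: mY.
have mVp k p : measurable_fun setT (fun w => (M_ k *m A (n_ k)) *m W k p w + c k).
  apply: measurable_cVD; last exact: measurable_cst.
  exact: measurable_cV_mulmx.
have mV k : measurable_fun setT (V k) by exact: mVp.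
suff covUV (f g : 'cV[R]_n -> R) : bounded_lipschitz f -> bounded_lipschitz g ->
    cov P (f \o U k) (g \o V k) @[k --> F] --> (0 : R).
  have lawU f : bounded_lipschitz f ->
      \int[P]_w f (U k w) @[k --> F] --> \int[mu]_x f (L *m x).
    move=> bf.
    exact: (cvg_law_mulmx (fun k => mY (m_ k)) (fun f bf => Y_law_along moo bf) cL bf).
  have lawUV f : bounded_lipschitz f ->
      \int[P]_w f (U k w + V k w) @[k --> F] --> \int[mu]_x f (M *m x).
    move=> bf; have H : \int[P]_w f (M_ k *m Y (n_ k) w) @[k --> F] --> \int[mu]_x f (M *m x).
      exact: (cvg_law_mulmx (fun k => mY (n_ k)) (fun f bf => Y_law_along noo bf) cM bf).
    apply: (cvg_ext _ H) => k; apply: Ex_ae_eq.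
    - by apply: (@bm_of_bl_comp _ _ _ _ (fun w => M_ k *m Y (n_ k) w)) => //; exact: measurable_cV_mulmx.
    - by apply: (@bm_of_bl_comp _ _ _ _ (fun w => U k w + V k w)) => //; exact: measurable_cVD.
    apply: filterS (ML k) => w MLw; congr f.
    have /andP[_ mnk] := mn k.
    have SE : partial_sum X (n_ k) w = partial_sum X (m_ k) w + W k xpredT w.
      by rewrite /partial_sum /W (@big_cat_nat _ _ _ (m_ k).+1).
    rewrite /U /V /Y SE !mulmxDr MLw /c -!mulmxA.
    set s1 := L_ k *m _; set s2 := M_ k *m _; set s3 := M_ k *m b _; set s4 := L_ k *m b _.
    by apply/matrixP => i j; rewrite !mxE; ring.
  have [nu [_ nuE]] := factor_limit mU mV lawU lawUV covUV.
  by exists nu.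
move=> bf bg; have [K [K0 fK gK gL]] := bl_bound2 bf bg.
apply/cvgrPdist_le => e e0.
(* Mixing and the dropped block each cost [4 K ^ 2 a = e / 2]. *)
pose a := e / (8 * K ^+ 2).
have K20 : 0 < 8 * K ^+ 2 by rewrite mulr_gt0// exprn_gt0.
have a0 : 0 < a by rewrite divr_gt0.
have [q [_ aq]] : exists q, (0 <= q)%N /\ (alpha_seq X q <= a%:E)%E.
  have [N _ HN] := cvge0_near_lt a0 X_mixing.
  by exists N; split => //; apply/ltW/HN => /=.
pose cc := n%:R * (`|M| + 1).
have cc0 : 0 <= cc by rewrite mulr_ge0// addr_ge0.
(* At most [q] terms are dropped, each at the price [a / (q + 1)]; [q.+1] avoids a division by
   [0]. *)
have dl0 : 0 < a / q.+1%:R by rewrite divr_gt0.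
have [N HN] := infinitesimal_clip cc0 dl0.
have nM : \forall k \near F, `|M_ k| <= `|M| + 1.
  have /cvgrPdist_le/(_ 1 ltr01) := cM; apply: filterS => k H.
  by rewrite -[M_ k](subrK M) (le_trans (ler_normD _ _))// addrC lerD2l distrC.
apply: filterS2 nM (moo N) => k Mk Nk; rewrite sub0r normrN.
have /andP[mk0 mnk] := mn k.
pose p := [pred j | (m_ k + q <= j)%N].
pose er w := (M_ k *m A (n_ k)) *m W k (predC p) w.
have mer : measurable_fun setT er by exact: measurable_cV_mulmx.
have VE : V k = fun w => ((M_ k *m A (n_ k)) *m W k p w + c k) + er w.
  apply/funext => w; rewrite /V /er addrAC -mulmxDr; congr (_ *m _ + _).
  by rewrite /W [LHS](bigID p).
have H1 := cov_perturb P (mU k) (mVp k p) mer (ltW K0) bf bg fK gK gL.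
have H2 : `|cov P (f \o U k) (fun w => g ((M_ k *m A (n_ k)) *m W k p w + c k))|
    <= 4 * K ^+ 2 * a.
  have := @cov_mixing _ _ _ _ P X q (m_ k) (n_ k) a (L_ k *m A (m_ k))
    (M_ k *m A (n_ k)) (L_ k *m b (m_ k)) (c k) p f g K mk0 aq K0 bf bg fK gK (fun _ => id).
  have -> : f \o U k = fun w => f ((L_ k *m A (m_ k)) *m partial_sum X (m_ k) w + L_ k *m b (m_ k)).
    apply/funext => w; congr f.
    by rewrite /U /Y (mulmxDr (L_ k)) mulmxA.
  exact.
have H3 : \int[P]_w clip (`|er w|) <= a.
  apply: (@le_trans _ _ (\int[P]_w clip (cc * `|\sum_((m_ k).+1 <= j < (n_ k).+1 | predC p j)
      A (n_ k) *m X j w|))).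
    apply: le_Ex.
    - have := bm_clip_vec 1 mer; congr bounded_measurable.
      by apply/funext => w; rewrite mul1r.
    - have := bm_clip_vec cc (@measurable_cV_mulmx _ _ _ _ (A (n_ k)) _ (mW k (predC p))).
      by congr bounded_measurable; apply/funext => w; rewrite mulmx_sumr.
    move=> w; apply: clip_homo; rewrite /er -mulmxA -mulmx_sumr.
    rewrite (le_trans (ler_mx_normM _ _))// ler_wpM2r// /cc ler_wpM2l//.
  apply: (@le_trans _ _ ((count (predC p) (index_iota (m_ k).+1 (n_ k).+1))%:R * (a / q.+1%:R))).
    apply: Ex_clip_sum => //.
      by move=> i; exact: measurable_cV_mulmx.
    move=> j; rewrite mem_index_iota ltnS => /andP[mj jn] _; apply: HN.
      exact: leq_trans Nk mnk.
    by rewrite jn andbT (leq_trans _ mj).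
  rewrite mulrCA; apply: ler_piMr; first exact: ltW.
  rewrite ler_pdivrMr ?ltr0Sn// mul1r ler_nat -size_filter.
  rewrite (@leq_trans (size (iota (m_ k) q)))//; last by rewrite size_iota.
  apply: uniq_leq_size; first by rewrite filter_uniq ?iota_uniq.
  move=> j; rewrite mem_filter mem_index_iota mem_iota /= -ltnNge.
  by move=> /and3P[-> /ltnW -> _].
have : `|cov P (f \o U k) (g \o V k)| <= 4 * K ^+ 2 * a + 4 * K ^+ 2 * a.
  have -> : g \o V k = fun w => g (((M_ k *m A (n_ k)) *m W k p w + c k) + er w).
    by rewrite VE.
  rewrite -[X in `|X|](subrK (cov P (f \o U k) (fun w => g ((M_ k *m A (n_ k)) *m W k p w + c k)))).
  rewrite (le_trans (ler_normD _ _))// lerD// (le_trans H1)//.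
  by rewrite ler_wpM2l// mulr_ge0// exprn_ge0// ltW.
move/le_trans; apply; rewrite /a.
rewrite le_eqVlt; apply/orP; left; apply/eqP; field; exact: lt0r_neq0.
Qed.

(** From [Y k.+1] to [G_ k *m Y k] one adds a constant and [- A k.+1 *m X k.+1], which tends to [0]
    in probability. The added vector is asymptotically deterministic, hence uncorrelated with
    everything; this is the converse relation that makes a limit of the ratios a symmetry. *)
Lemma step_factor (G_ : nat -> 'M[R]_n) (G : 'M[R]_n) :
  G_ k @[k --> F] --> G -> (\forall k \near F, G_ k *m A k = A k.+1) ->
  factor mu 1%:M G.
Proof.
move=> cG GA.
pose c k := G_ k *m b k - b k.+1.
pose er k w := (- A k.+1) *m X k.+1 w.
pose V k w := c k + er k w.
have mer k : measurable_fun setT (er k) by exact: measurable_cV_mulmx.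
have mc k : measurable_fun setT (fun _ : Omega => c k) by exact: measurable_cst.
have mV k : measurable_fun setT (V k) by exact: measurable_cVD.
have koo N : \forall k \near F, (N <= k)%N by apply: Foo; exists N.
have k1oo N : \forall k \near F, (N <= k.+1)%N.
  by apply: filterS (koo N) => k; exact: leqW.
have lawU f : bounded_lipschitz f ->
    \int[P]_w f (Y k.+1 w) @[k --> F] --> \int[mu]_x f (1%:M *m x).
  move=> bf; under [X in _ --> X]eq_Rintegral do rewrite mul1mx.
  exact: (Y_law_along k1oo bf).
have lawUV f : bounded_lipschitz f ->
    \int[P]_w f (Y k.+1 w + V k w) @[k --> F] --> \int[mu]_x f (G *m x).
  move=> bf; have H : \int[P]_w f (G_ k *m Y k w) @[k --> F] --> \int[mu]_x f (G *m x).
    exact: (cvg_law_mulmx mY (fun f bf => Y_law_along koo bf) cG bf).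
  apply: cvg_trans H; apply: near_eq_cvg; apply: filterS GA => k GAk.
  apply: eq_Rintegral => w _; congr f.
  rewrite /V /er /c /Y mulNmx.
  have -> : partial_sum X k.+1 w = partial_sum X k w + X k.+1 w.
    by rewrite /partial_sum big_nat_recr.
  rewrite (mulmxDr (G_ k) (A k *m _)) mulmxA GAk (mulmxDr (A k.+1)).
  set s1 := A k.+1 *m _; set s2 := A k.+1 *m _; set s3 := G_ k *m _.
  by apply/matrixP => i j; rewrite !mxE; ring.
suff covUV (f g : 'cV[R]_n -> R) : bounded_lipschitz f -> bounded_lipschitz g ->
    cov P (f \o Y k.+1) (g \o V k) @[k --> F] --> (0 : R).
  have [nu [_ nuE]] := factor_limit (fun k => mY k.+1) mV lawU lawUV covUV.
  by exists nu.
move=> bf bg; have [K [K0 fK gK gL]] := bl_bound2 bf bg.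
apply/cvgrPdist_le => e e0.
have K20 : 0 < 4 * K ^+ 2 by rewrite mulr_gt0// exprn_gt0.
have [N HN] := infinitesimal_clip ler01 (divr_gt0 e0 K20).
apply: filterS (k1oo N) => k Nk; rewrite sub0r normrN.
have := cov_perturb P (mY k.+1) (mc k) (mer k) (ltW K0) bf bg fK gK gL.
have -> : cov P (f \o Y k.+1) (g \o fun=> c k) = 0.
  rewrite /cov /comp ExZr; last exact: bm_of_bl_comp.
  by rewrite (Ex_cst P (g (c k))) subrr.
rewrite subr0 => /le_trans; apply.
rewrite mulrC -ler_pdivlMr//; apply: le_trans (HN k.+1 k.+1 Nk _); last by rewrite /=.
rewrite le_eqVlt; apply/orP; left; apply/eqP; apply: eq_Rintegral => w _.
by rewrite mul1r /er mulNmx normrN.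
Qed.

End along_ultrafilter.
End normalization.

(** * Normalizing operators *)

Section symmetries.
Context (R : realType) (n : nat) (mu : probability 'cV[R]_n R).
Hypothesis mu_full : full mu.
Implicit Types g h : 'M[R]_n.

Definition symmetry g := factor mu g 1%:M /\ factor mu 1%:M g.

Lemma singular_annihilator (g : 'M[R]_n) : g \notin unitmx ->
  exists2 L : 'M[R]_n, `|L| = 1 & L *m g = 0.
Proof.
rewrite -row_free_unit -kermx_eq0 => k0.
have nk : 0 < `|kermx g| by rewrite normr_gt0.
exists (`|kermx g|^-1 *: kermx g); last by rewrite -scalemxAl mulmx_ker scaler0.
by rewrite normrZ normfV normr_id mulVf// gt_eqF.
Qed.

Lemma symmetry1 : symmetry 1%:M.
Proof. by split; exact: factor_refl. Qed.

(** If [L *m g = 0], then [mu] being a factor of [g mu] makes [L mu] a factor of the point mass at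
    [0], so [L = 0]. *)
Lemma symmetry_unit g : symmetry g -> g \in unitmx.
Proof.
move=> [_ g1]; apply/negP => /negP/singular_annihilator[L nL Lg].
have := factor_mull L g1; rewrite mulmx1 Lg => /(factor_0 mu_full) L0.
by move/eqP : nL; rewrite L0 normr0 eq_sym oner_eq0.
Qed.

Lemma symmetryV g : symmetry g -> symmetry (invmx g).
Proof.
move=> sg; have ug := symmetry_unit sg; have [g1 g2] := sg; split.
  by have := factor_mull (invmx g) g2; rewrite mulmx1 mulVmx.
by have := factor_mull (invmx g) g1; rewrite mulmx1 mulVmx.
Qed.

Lemma symmetryM g h : symmetry g -> symmetry h -> symmetry (g *m h).
Proof.
move=> [g1 g2] [h1 h2]; split; first exact: factor_mul.
by apply: (factor_trans g2); have := factor_mull g h2; rewrite mulmx1.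
Qed.

End symmetries.

Section normalizing_operators.
Context (R : realType) (n : nat) dO (Omega : measurableType dO).
Context (P : probability Omega R) (X : nat -> {RV P >-> 'cV[R]_n}).
Context (A : nat -> 'M[R]_n) (b : nat -> 'cV[R]_n).
Context (mu : probability 'cV[R]_n R).
Hypothesis X_mixing : strongly_mixing X.
Hypothesis AX_infinitesimal : infinitesimal A X.
Hypothesis AS_cvg : cvg_in_law P (fun k w => A k *m partial_sum X k w + b k) mu.
Hypothesis mu_full : full mu.

Let mX j : measurable_fun setT (X j).
Proof. exact: measurable_funP. Qed.

Let normalized (C : 'M[R]_n) : C <> 0 -> `| `|C|^-1 *: C| = 1.
Proof.
by move=> /eqP C0; rewrite normrZ normfV normr_id mulVf// normr_eq0.
Qed.

Let ultra_normalized (F : set_system nat) (L_ : nat -> 'M[R]_n) :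
  UltraFilter F -> (forall k, `|L_ k| = 1) ->
  exists2 L : 'M[R]_n, `|L| = 1 & L_ k @[k --> F] --> L.
Proof.
move=> UF L1; have [L cL] : exists L : 'M[R]_n, L_ k @[k --> F] --> L.
  by apply: (@ultra_cvg_mx _ _ _ _ _ _ _ 1); apply: nearW => k; rewrite L1.
exists L => //; apply/eqP; rewrite eq_le; apply/andP; split.
  by apply: (lim_norm_le cL); apply: nearW => k; rewrite L1.
by apply: (lim_norm_ge cL); apply: nearW => k; rewrite L1.
Qed.

(** [mixing_factor] with [n_ = m_] and zero matrices [M_]: a limit [L] of the [L_ k], of norm [1],
    would give a factor [L mu] of the point mass at [0]. *)
Lemma no_degenerate_sums (m_ : nat -> nat) (L_ : nat -> 'M[R]_n) :
  (forall k, (k < m_ k)%N) -> (forall k, `|L_ k| = 1) ->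
  ~ (forall k, {ae P, forall w, L_ k *m (A (m_ k) *m partial_sum X (m_ k) w) = 0}).
Proof.
move=> km L1 L0.
have [F [UF Foo]] := ultraFilterLemma eventually_filter.
have [L nL cL] := ultra_normalized UF L1.
have := @mixing_factor _ _ _ _ P X A b mu X_mixing AX_infinitesimal AS_cvg F UF
  m_ m_ (fun=> 0) L_ 0 L.
have moo N : \forall k \near F, (N <= m_ k)%N.
  by apply: Foo; exists N => // k /= Nk; rewrite (leq_trans Nk)// ltnW.
move=> /(_ moo) H.
have /(factor_0 mu_full) Lz : factor mu L 0.
  apply: H => //.
  - by move=> k; rewrite leqnn andbT (leq_ltn_trans _ (km k)).
  - exact: cvg_cst.
  - by move=> k; apply: filterS (L0 k) => w ->; rewrite mul0mx.
by move/eqP : nL; rewrite Lz normr0 eq_sym oner_eq0.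
Qed.

Lemma eventually_unitmx : exists N, forall k, (N <= k)%N -> A k \in unitmx.
Proof.
apply: contrapT => /forallNP H.
have /choice[m_ mP] : forall k, exists m, (k < m)%N /\ A m \notin unitmx.
  move=> k; have /existsNP[m] := H k.+1; rewrite not_implyE => -[km /negP Am].
  by exists m.
have /choice[L_ LP] : forall k, exists L : 'M[R]_n, `|L| = 1 /\ L *m A (m_ k) = 0.
  by move=> k; have [L nL LA] := singular_annihilator (mP k).2; exists L.
apply: (@no_degenerate_sums m_ L_).
- by move=> k; case: (mP k).
- by move=> k; case: (LP k).
by move=> k; apply: nearW => w; rewrite mulmxA; case: (LP k) => _ ->; rewrite mul0mx.
Qed.

(** The matrices [C *m invmx (A k)], normalized, would annihilate [A k *m partial_sum X k] almost
    surely. *)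
Lemma no_common_annihilator (C : 'M[R]_n) : C <> 0 ->
  ~ (forall j, (1 <= j)%N -> {ae P, forall w, C *m X j w = 0}).
Proof.
move=> C0 CX; have [N AU] := eventually_unitmx.
have CX' : {ae P, forall w, forall j, (1 <= j)%N -> C *m X j w = 0}.
  apply: ae_foralln => j; case: j => [|j]; first by apply: nearW.
  by apply: filterS (CX j.+1 isT).
pose L k := C *m invmx (A (N + k.+1)).
have L0 k : L k <> 0.
  move=> /(congr1 (mulmx^~ (A (N + k.+1)))); rewrite mul0mx -mulmxA mulVmx ?mulmx1//.
  by apply: AU; rewrite leq_addr.
apply: (@no_degenerate_sums (fun k => N + k.+1)%N (fun k => `|L k|^-1 *: L k)).
- by move=> k; rewrite addnS ltnS leq_addl.
- by move=> k; exact: normalized.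
move=> k; apply: filterS CX' => w Cw.
rewrite -scalemxAl mulmxA -[_ *m A _]mulmxA mulVmx ?mulmx1; last first.
  by apply: AU; rewrite leq_addr.
rewrite /partial_sum mulmx_sumr big_nat_cond big1 ?scaler0// => j.
by rewrite andbT => /andP[/Cw].
Qed.

(** If [|A m|] exceeds [e] infinitely often, let [C] be a limit, of norm [1], of the normalized
    [A m]. Dividing by a norm larger than [e] preserves infinitesimality, so [C *m X j = 0] almost
    surely for every [j], which [no_common_annihilator] excludes. *)
Lemma normalizer_cvg0 : A k @[k --> \oo] --> (0 : 'M[R]_n).
Proof.
apply/cvgrPdist_le => e e0; apply: contrapT => nA.
have /choice[m_ mP] : forall k, exists m, (k < m)%N /\ e < `|A m|.
  move=> k; apply: contrapT => /forallNP H; apply: nA; exists k.+1 => // m /= km.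
  by rewrite sub0r normrN leNgt; apply/negP => eA; apply: (H m).
have [F [UF Foo]] := ultraFilterLemma eventually_filter.
have A0 k : A (m_ k) <> 0.
  by move=> Ak; have [_] := mP k; rewrite Ak normr0 ltNge (ltW e0).
have [C nC cC] := ultra_normalized UF (fun k => normalized (A0 k)).
apply: (@no_common_annihilator C); first by move=> C0; move/eqP : nC; rewrite C0 normr0 eq_sym oner_eq0.
move=> j j1.
have [Q [_ QE]] := pushforward_prob P (mX j).
pose f (x : 'cV[R]_n) := clip (0 + 1 * `|x - 0|).
have bf : bounded_lipschitz f by exact: bl_clip_norm.
have fE x : f x = clip (`|x|) by rewrite /f add0r mul1r subr0.
have bfM (M : 'M[R]_n) : bounded_lipschitz (fun x => f (M *m x)) by exact: bl_mulmx.
have lim1 : \int[P]_w f ((`|A (m_ k)|^-1 *: A (m_ k)) *m X j w) @[k --> F]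
    --> \int[P]_w f (C *m X j w).
  rewrite -(QE (fun x => f (C *m x))); last exact: bl_bm.
  apply: (@cvg_law_mulmx _ _ _ F _ _ _ (fun=> P) (fun=> X j)) => //.
  by move=> g bg; rewrite (QE g); [exact: cvg_cst|exact: bl_bm].
have bfC : bounded_measurable (fun w => f (C *m X j w)).
  by apply: (@bm_of_bl_comp _ _ _ _ (fun w => C *m X j w)) => //; exact: measurable_cV_mulmx.
have lim0 : \int[P]_w f (C *m X j w) = 0.
  apply/eqP; rewrite eq_le; apply/andP; split; last first.
    by apply: Rintegral_ge0 => w _; rewrite fE clip_ge0.
  apply/ler_addgt0Pr => dl dl0; rewrite add0r.
  have ei0 : 0 <= e^-1 by rewrite invr_ge0 ltW.
  have [N HN] := infinitesimal_clip AX_infinitesimal ei0 dl0.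
  have := @cvg_norm_le R _ F _ _ (fun=> dl) _ dl lim1 (cvg_cst dl) _.
  move=> H; apply: le_trans (ler_norm _) _; apply: H.
  apply: Foo; exists (N + j)%N => // k /= Nk.
  have [km eA] := mP k.
  rewrite ger0_norm; last by apply: Rintegral_ge0 => w _; rewrite fE clip_ge0.
  have mk : (N + j <= m_ k)%N by rewrite (leq_trans Nk)// ltnW.
  apply: le_trans (HN (m_ k) j _ _); last 2 first.
    by rewrite (leq_trans _ mk)// leq_addr.
    by rewrite j1 (leq_trans _ mk)// leq_addl.
  apply: le_Ex; [|exact: bm_clip_vec (measurable_cV_mulmx _ (mX j))|].
    apply: (@bm_of_bl_comp _ _ _ _ (fun w => _ *m X j w)) => //; exact: measurable_cV_mulmx.
  move=> w; rewrite fE; apply: clip_homo; rewrite -scalemxAl normrZ ler_wpM2r//.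
  by rewrite normfV normr_id lef_pV2 ?posrE ?ltW// (lt_trans e0).
have := Ex_eq0 bfC _ lim0; move=> H.
have {}H : {ae P, forall x, f (C *m X j x) = 0}.
  by apply: H => w; rewrite fE clip_ge0.
apply: filterS H => w; rewrite fE => H.
apply/eqP; rewrite -normr_le0.
have [h1|h1] := leP (`|C *m X j w|) 1.
  by move: H; rewrite clip_id ?normr_ge0// => ->.
by move: H; rewrite clip1 ?(ltW h1)// => /eqP; rewrite oner_eq0.
Qed.

(** If the ratios are bounded along [F], [mixing_factor] applies to their limit with [M_ = 1].
    Otherwise their norms tend to infinity along the ultrafilter, and the normalized ratios, with
    [M_] the inverse norms, have a nonzero limit that would be a factor of [0]. *)
Lemma ratio_limit (F : set_system nat) (m_ n_ : nat -> nat) :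
  UltraFilter F -> (forall N, \forall k \near F, (N <= m_ k)%N) ->
  (forall k, (0 < m_ k <= n_ k)%N) -> (forall k, A (m_ k) \in unitmx) ->
  exists2 D : 'M[R]_n, factor mu D 1%:M &
    A (n_ k) *m invmx (A (m_ k)) @[k --> F] --> D.
Proof.
move=> UF moo mn mU; pose L k := A (n_ k) *m invmx (A (m_ k)).
have LA k : L k *m A (m_ k) = A (n_ k) by rewrite /L -mulmxA mulVmx ?mulmx1.
have [[c Lc]|/forallNP nb] := pselect (exists c, \forall k \near F, `|L k| <= c).
  have [D cD] := ultra_cvg_mx Lc; exists D => //.
  apply: (@mixing_factor _ _ _ _ P X A b mu X_mixing AX_infinitesimal AS_cvg F UF
    m_ n_ (fun=> 1%:M) L) => //; first exact: cvg_cst.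
  by move=> k; apply: nearW => w; rewrite mul1mx !mulmxA LA.
exfalso.
have big c : \forall k \near F, c < `|L k|.
  have [//|FB] := in_ultra_setVsetC [set k | `|L k| <= c] UF.
    by move/(nb c).
  by apply: filterS FB => k /= /negP; rewrite -ltNge.
pose L' k := `|L k|^-1 *: L k.
have nL' : \forall k \near F, `|L' k| = 1.
  apply: filterS (big 0) => k; rewrite normr_gt0 => /eqP; exact: normalized.
have [D cD] : exists D : 'M[R]_n, L' k @[k --> F] --> D.
  by apply: (@ultra_cvg_mx _ _ _ _ _ _ _ 1); apply: filterS nL' => k ->.
have nD : 1 <= `|D| by apply: (lim_norm_ge cD); apply: filterS nL' => k ->.
have cM : (`|L k|^-1)%:M @[k --> F] --> (0 : 'M[R]_n).
  have H0 : `|L k|^-1 @[k --> F] --> (0 : R).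
    apply/cvgrPdist_le => e e0; apply: filterS (big e^-1) => k Lk.
    have L0 : 0 < `|L k| by rewrite (lt_trans _ Lk)// invr_gt0.
    by rewrite sub0r normrN normfV normr_id -[e]invrK lef_pV2 ?posrE ?invr_gt0// ltW.
  have H1 : `|L k|^-1 *: (1%:M : 'M[R]_n) @[k --> F] --> (0 : R) *: (1%:M : 'M[R]_n).
    by apply: cvgZr_tmp.
  by move: H1; rewrite scale0r; apply: cvg_ext => k; rewrite scalemx1.
have /(factor_0 mu_full) Dz : factor mu D 0.
  apply: (@mixing_factor _ _ _ _ P X A b mu X_mixing AX_infinitesimal AS_cvg F UF
    m_ n_ (fun k => (`|L k|^-1)%:M) L') => //.
  move=> k; apply: nearW => w; rewrite /L' -scalemxAl (mulmxA (L k)) LA.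
  by rewrite mul_scalar_mx.
by move: nD; rewrite Dz normr0 ler10.
Qed.

Lemma step_limit (F : set_system nat) : UltraFilter F -> \oo `<=` F ->
  exists2 g : 'M[R]_n, symmetry mu g & A k.+1 *m invmx (A k) @[k --> F] --> g.
Proof.
move=> UF Foo; have [N AU] := eventually_unitmx.
(* Changes finitely many indices only, to have every [A (m k)] invertible. *)
pose m k := maxn k N.+1.
have [g fg cg] : exists2 g : 'M[R]_n, factor mu g 1%:M &
    A (m k).+1 *m invmx (A (m k)) @[k --> F] --> g.
  apply: (@ratio_limit F m (fun k => (m k).+1)) => //.
  - by move=> M; apply: Foo; exists M => // k /= Mk; rewrite /m (leq_trans Mk)// leq_maxl.
  - by move=> k; rewrite leqnSn andbT (leq_trans _ (leq_maxr _ _)).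
  - by move=> k; apply: AU; rewrite (leq_trans _ (leq_maxr _ _)).
have cg' : A k.+1 *m invmx (A k) @[k --> F] --> g.
  apply: cvg_trans cg; apply: near_eq_cvg; apply: Foo; exists N.+1 => // k /= Nk.
  by rewrite /m (maxn_idPl Nk).
exists g; last exact: cg'.
split; first exact: fg.
apply: (step_factor AX_infinitesimal AS_cvg Foo cg').
apply: Foo; exists N => // k /= Nk; rewrite -mulmxA mulVmx ?mulmx1//.
exact: AU.
Qed.

End normalizing_operators.

(** * Correction by symmetries and the decaying semigroup in D(mu) *)

Section exists_semigroup.
Context (R : realType) (n : nat) dO (Omega : measurableType dO).
Context (P : probability Omega R) (X : nat -> {RV P >-> 'cV[R]_n}).
Context (A : nat -> 'M[R]_n) (b : nat -> 'cV[R]_n).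
Context (mu : probability 'cV[R]_n R).
Hypothesis X_mixing : strongly_mixing X.
Hypothesis AX_infinitesimal : infinitesimal A X.
Hypothesis AS_cvg : cvg_in_law P (fun k w => A k *m partial_sum X k w + b k) mu.
Hypothesis mu_full : full mu.

Lemma symmetry_limit (F : set_system nat) (u : nat -> 'M[R]_n) :
  UltraFilter F -> (forall k, symmetry mu (u k)) ->
  exists2 D : 'M[R]_n, factor mu D 1%:M & u k @[k --> F] --> D.
Proof.
move=> UF su; have [c cP] := factor_bounded mu_full.
have [D cD] : exists D : 'M[R]_n, u k @[k --> F] --> D.
  by apply: (@ultra_cvg_mx _ _ _ _ _ _ _ c); apply: nearW => k; apply: cP; case: (su k).
exists D => //; apply: (@factor_closed _ _ mu _ F _ u (fun=> 1%:M)) => //.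
  by apply: nearW => k; case: (su k).
exact: cvg_cst.
Qed.

(** [g_ k] nearly realizes the distance from the ratio to the set of symmetries. If the errors did
    not vanish, the ratios would have a limit along an ultrafilter on the exceptional indices; it is
    a symmetry by [step_limit], a contradiction. *)
Lemma near_symmetries : exists g_ : nat -> 'M[R]_n,
  (forall k, symmetry mu (g_ k)) /\
  A k.+1 *m invmx (A k) - g_ k @[k --> \oo] --> (0 : 'M[R]_n).
Proof.
pose T k := A k.+1 *m invmx (A k).
pose E k : set R := [set `|T k - g| | g in symmetry mu].
have infE k : has_inf (E k).
  split; first by exists `|T k - 1%:M|, 1%:M => //; exact: symmetry1.
  by exists 0 => _ [g _ <-].
have /choice[g_ gP] : forall k, exists g, symmetry mu g /\
    `|T k - g| < inf (E k) + k.+1%:R^-1.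
  move=> k; have k0 : 0 < k.+1%:R^-1 :> R by rewrite invr_gt0.
  by have [_ [g sg <-] gk] := inf_adherent k0 (infE k); exists g.
exists g_; split=> [k|]; first by case: (gP k).
apply/cvgrPdist_le => e e0; apply: contrapT => nE.
pose B := [set k | e < `|T k - g_ k|].
have PB : ProperFilter (within B \oo).
  apply: Build_ProperFilter; move=> [N _ NB]; apply: nE; exists N => // k /= Nk.
  by rewrite sub0r normrN leNgt; apply/negP => /(NB k Nk).
have [F [UF FB]] := ultraFilterLemma PB.
have Foo : \oo `<=` F by move=> V [N _ NV]; apply: FB; exists N => // k /= Nk _; exact: NV.
have BF : F B by apply: FB; exists 0 => // k _.
have [g sg cg] := step_limit X_mixing AX_infinitesimal AS_cvg mu_full UF Foo.
have e20 : 0 < e / 2 by rewrite divr_gt0.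
have /cvgrPdist_le/(_ _ e20) H1 := cg.
have [N Ne] := natSinv_lt e20.
have H2 : F [set k | (N <= k)%N] by apply: Foo; exists N.
have H3 : \forall k \near F, [/\ B k, `|g - T k| <= e / 2 & (N <= k)%N].
  by apply: filterS3 BF H1 H2 => k.
have /filter_ex[k [eB H1k H2k]] := H3.
have [_ gk] := gP k.
have := lt_trans eB gk; apply/negP; rewrite -leNgt [leRHS](splitr e) lerD//.
  apply: le_trans H1k; apply: ge_inf; first by case: (infE k).
  by exists g => //; rewrite distrC.
by rewrite (le_trans _ (ltW Ne))// lef_pV2 ?posrE ?ltr0Sn// ler_nat ltnS.
Qed.

Theorem mixing_decaying_semigroup : exists Q : 'M[R]_n,
  (forall t, 0 <= t -> factor mu (expmx (t *: Q)) 1) /\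
  expmx (t *: Q) @[t --> +oo] --> (0 : 'M[R]_n).
Proof.
have [N AU] := eventually_unitmx X_mixing AX_infinitesimal AS_cvg mu_full.
have [g_ [sg cg]] := near_symmetries.
(* The shift makes all normalizers invertible and all indices positive. *)
pose a k := A (k + N.+1)%N.
have aU k : a k \in unitmx by apply: AU; rewrite (leq_trans (leqnSn N))// leq_addl.
(* Up to the shift of indices h_(k+1) g_k = h_k, so S_k - 1 = h_(k+1) T_k h_k^-1 with T_k the
   vanishing error of [near_symmetries]; as symmetries are bounded, S_k tends to 1. *)
pose h := fix h k := if k is k'.+1 then h k' *m invmx (g_ (k' + N.+1)%N) else 1%:M : 'M[R]_n.
have sh k : symmetry mu (h k).
  elim: k => [|k IH] /=; first exact: symmetry1.
  by apply: symmetryM => //; exact: symmetryV.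
have hU k : h k \in unitmx by exact: symmetry_unit (sh k).
pose a' k := h k *m a k.
have a'U k : a' k \in unitmx by rewrite unitmx_mul hU aU.
pose B m k := a' k *m invmx (a' m).
pose S k := a' k.+1 *m invmx (a' k).
have [c c0 cP] : exists2 c : R, 0 <= c & forall g, symmetry mu g -> `|g| <= c.
  have [c cP] := factor_bounded mu_full; exists `|c| => // g [g1 _].
  by rewrite (le_trans (cP g g1))// ler_norm.
have invM (M M' : 'M[R]_n) : M \in unitmx -> M' \in unitmx ->
    invmx (M *m M') = invmx M' *m invmx M.
  move=> uM uM'; have uMM : M *m M' \in unitmx by rewrite unitmx_mul uM uM'.
  have E : (M *m M') *m (invmx M' *m invmx M) = 1%:M.
    by rewrite mulmxA -(mulmxA M) mulmxV// mulmx1 mulmxV.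
  by rewrite -[RHS]mul1mx -(mulVmx uMM) -mulmxA E mulmx1.
have Bhh m k : B m k = h k *m (a k *m invmx (a m)) *m invmx (h m).
  by rewrite /B /a' invM// !mulmxA.
have B_diag m : B m m = 1 by rewrite /B mulmxV.
have B_succ m k : (m <= k)%N -> B m k.+1 = S k * B m k.
  by move=> _; rewrite /B /S -mulmx_ring mulmxA -(mulmxA (a' k.+1)) mulVmx// mulmx1.
have S_cvg : S k @[k --> \oo] --> (1 : 'M[R]_n).
  pose T k := a k.+1 *m invmx (a k) - g_ (k + N.+1)%N.
  have cT : T k @[k --> \oo] --> (0 : 'M[R]_n).
    have := cg; rewrite -(cvg_shiftn N.+1); apply: cvg_trans; apply: near_eq_cvg.
    by apply: nearW => k.
  have SE k : S k - 1 = h k.+1 *m T k *m invmx (h k).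
    rewrite /S -/(B k k.+1) Bhh /T mulmxBr mulmxBl; congr (_ - _).
    rewrite /= -(mulmxA (h k)) mulVmx; last exact: symmetry_unit (sg _).
    by rewrite mulmx1 mulmxV.
  have : S k - 1 @[k --> \oo] --> (0 : 'M[R]_n).
    apply/cvgrPdist_le => e e0.
    pose K := n%:R * (n%:R * c) * c + 1.
    have K0 : 0 < K by rewrite ltr_wpDl// !mulr_ge0.
    move/cvgrPdist_le : cT => /(_ _ (divr_gt0 e0 K0)); apply: filterS => k.
    rewrite !sub0r !normrN => Tk; rewrite SE.
    apply: (@le_trans _ _ (K * `|T k|)); last by rewrite mulrC -ler_pdivlMr.
    rewrite (le_trans (ler_mx_normM _ _))//.
    apply: (@le_trans _ _ (n%:R * (n%:R * c * `|T k|) * c)).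
      rewrite ler_pM ?mulr_ge0//; last by apply: cP; exact: symmetryV.
      rewrite ler_wpM2l// (le_trans (ler_mx_normM _ _))// ler_wpM2r// ler_wpM2l//.
      by apply: cP; exact: sh.
    rewrite /K; move: (normr_ge0 (T k)); set t := `|T k|; nra.
  move=> H; have H1 : S k - 1 + 1 @[k --> \oo] --> (0 + 1 : 'M[R]_n).
    by apply: (cvgD H); exact: cvg_cst.
  by move: H1; rewrite add0r; apply: cvg_ext => k; rewrite subrK.
have ca : a k @[k --> \oo] --> (0 : 'M[R]_n).
  have := normalizer_cvg0 X_mixing AX_infinitesimal AS_cvg mu_full.
  rewrite -(cvg_shiftn N.+1); apply: cvg_trans; apply: near_eq_cvg.
  by apply: nearW => k.
have B_cvg0 m : B m k @[k --> \oo] --> (0 : 'M[R]_n).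
  have ca' : a' k @[k --> \oo] --> (0 : 'M[R]_n).
    apply/cvgrPdist_le => e e0.
    have K0 : 0 < n%:R * c + 1 by rewrite ltr_wpDl// mulr_ge0.
    move/cvgrPdist_le : ca => /(_ _ (divr_gt0 e0 K0)); apply: filterS => k.
    rewrite !sub0r !normrN => ak.
    apply: (@le_trans _ _ ((n%:R * c + 1) * `|a k|)); last by rewrite mulrC -ler_pdivlMr.
    rewrite (le_trans (ler_mx_normM _ _))// ler_wpM2r//.
    by rewrite (@le_trans _ _ (n%:R * c)) ?lerDl// ler_wpM2l// cP.
  by rewrite -(mul0mx _ (invmx (a' m))); apply: cvg_mulmx => //; exact: cvg_cst.
have B_limit (F : set_system nat) (n_ : nat -> nat) :
    UltraFilter F -> \oo `<=` F -> (forall k, (k <= n_ k)%N) ->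
    exists2 D : 'M[R]_n, factor mu D 1 & B k (n_ k) @[k --> F] --> D.
  move=> UF Foo kn.
  have [D fD cD] : exists2 D : 'M[R]_n, factor mu D 1%:M &
      a (n_ k) *m invmx (a k) @[k --> F] --> D.
    apply: (ratio_limit X_mixing AX_infinitesimal AS_cvg mu_full (m_ := fun k => (k + N.+1)%N)
      (n_ := fun k => (n_ k + N.+1)%N) UF).
    - by move=> M; apply: Foo; exists M => // k /= Mk; rewrite (leq_trans Mk)// leq_addr.
    - by move=> k; rewrite leq_add2r kn andbT addnS.
    - exact: aU.
  have [D1 fD1 cD1] := symmetry_limit UF (fun k => sh (n_ k)).
  have [D2 fD2 cD2] := symmetry_limit UF (fun k => symmetryV mu_full (sh k)).
  exists (D1 *m D *m D2); first exact: (factor_mul (factor_mul fD1 fD) fD2).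
  apply: (cvg_ext (f := fun k => h (n_ k) *m (a (n_ k) *m invmx (a k)) *m invmx (h k))).
    by move=> k; rewrite Bhh.
  exact: (cvg_mulmx (cvg_mulmx cD1 cD) cD2).
apply: (exists_decaying_semigroup mu_full) => J JJ DJ J0.
exact: (exists_generator mu_full B_diag B_succ S_cvg B_cvg0 B_limit JJ DJ J0).
Qed.

End exists_semigroup.

(** * Construction of a self-decomposition *)

Section realization.
Context (R : realType).
Local Notation unit_space := (measurableTypeR R).
Local Notation leb := (@leb01 R).

Lemma eq_prob_Ex d (T : measurableType d) (P Q : probability T R) (f : T -> R) :
  (forall B, measurable B -> P B = Q B) -> \int[P]_x f x = \int[Q]_x f x.
Proof.
by move=> PQ; rewrite /Rintegral; congr fine; apply: eq_measure_integral => B mB _; exact: PQ.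
Qed.

Lemma bm_prod d (T : measurableType d) (I : Type) (r : seq I) (F : I -> T -> R) :
  (forall i, bounded_measurable (F i)) ->
  bounded_measurable (fun x => \prod_(i <- r) F i x).
Proof.
move=> bF; elim: r => [|i r IH].
  by under eq_fun do rewrite big_nil; exact: bm_cst.
by under eq_fun do rewrite big_cons; exact: bmM.
Qed.

(** Prokhorov's theorem for a constant sequence, whose limit law is [rho] itself. *)
Lemma realize_law n (rho : probability 'cV[R]_n R) :
  exists G : R -> 'cV[R]_n,
    measurable_fun (setT : set unit_space) G /\
    forall f, bounded_measurable f -> \int[rho]_x f x = \int[leb]_u f (G u).
Proof.
have [F [UF Foo]] := ultraFilterLemma eventually_filter.
have [||G [mG GE]] := @prokhorov R n _ F UF _ _ (fun=> rho) (fun=> id).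
- by move=> k; exact: measurable_id.
- move=> e e0; have [r [_ rP]] := tight_vector rho (@measurable_id _ _ setT) e0.
  by exists r; apply: nearW.
exists G; split=> // f bf.
have [Q [_ QE]] := pushforward_prob leb mG.
rewrite -QE//; apply: eq_prob_Ex; apply: eq_prob_bl => g bg.
rewrite QE; last exact: bl_bm.
by apply: (cvg_unique (@norm_hausdorff _ _) _ (GE g bg)); exact: cvg_cst.
Qed.

(** The uniform law on the square, carried to column vectors of size 2, is realized on [[0, 1[];
    [T1] and [T2] are the coordinates of the realizing map. *)
Lemma exists_splitting : exists T1 T2 : R -> R,
  [/\ measurable_fun (setT : set unit_space) (T1 : unit_space -> unit_space),
      measurable_fun (setT : set unit_space) (T2 : unit_space -> unit_space) &
    forall f : unit_space * unit_space -> R, bounded_measurable f ->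
      \int[leb]_u f (T1 u, T2 u) = \int[leb]_x \int[leb]_y f (x, y)].
Proof.
pose iota (z : unit_space * unit_space) : 'cV[R]_2 :=
  \col_(i < 2) if i == 0 then z.1 else z.2.
have miota : measurable_fun setT iota.
  apply/measurable_cVP => i; have [i0|i0] := eqVneq i 0.
    rewrite (_ : (fun z => _) = fst); first exact: measurable_fst.
    by apply/funext => z; rewrite mxE i0 eqxx.
  rewrite (_ : (fun z => _) = snd); first exact: measurable_snd.
  by apply/funext => z; rewrite mxE (negbTE i0).
have [rho [_ rhoE]] := pushforward_prob (leb \x leb)%E miota.
have [G [mG GE]] := realize_law rho.
have mGi i : measurable_fun (setT : set unit_space) (fun u => G u i 0 : unit_space).
  by have H := (measurable_cVP G).1 mG i; exact: H.
have mi i : measurable_fun (setT : set 'cV[R]_2) (fun v : 'cV[R]_2 => v i 0 : unit_space).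
  have /measurable_cVP : measurable_fun (setT : set 'cV[R]_2) (@id 'cV[R]_2).
    exact: measurable_id.
  by apply.
exists (fun u => G u 0 0), (fun u => G u 1 0); split => // f bf.
pose g (v : 'cV[R]_2) := f (v 0 0, v 1 0).
have bg : bounded_measurable g.
  apply: (bm_comp (phi := fun v : 'cV[R]_2 => (v 0 0 : unit_space, v 1 0 : unit_space)) _ bf).
  exact: measurable_fun_pair.
transitivity (\int[leb]_u g (G u)); first by [].
rewrite -(GE g bg) (rhoE g bg) -Ex_prod//.
by apply: eq_Rintegral => -[x y] _; rewrite /g /iota !mxE.
Qed.

End realization.

Section independent_sequence.
Context (R : realType).
Local Notation unit_space := (measurableTypeR R).
Local Notation leb := (@leb01 R).
Variables T1 T2 : R -> R.
Hypothesis mT1 : measurable_fun (setT : set unit_space) (T1 : unit_space -> unit_space).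
Hypothesis mT2 : measurable_fun (setT : set unit_space) (T2 : unit_space -> unit_space).
Hypothesis T12 : forall f : unit_space * unit_space -> R, bounded_measurable f ->
  \int[leb]_u f (T1 u, T2 u) = \int[leb]_x \int[leb]_y f (x, y).

(** A uniform variable split again and again: [T1] extracts one independent copy and [T2] keeps the
    rest for the next round. *)
Definition uniform_seq (j : nat) (u : R) : R := T1 (iter j T2 u).

Lemma uniform_seqS j u : uniform_seq j.+1 u = uniform_seq j (T2 u).
Proof. by rewrite /uniform_seq iterSr. Qed.

Lemma measurable_uniform_seq j :
  measurable_fun (setT : set unit_space) (uniform_seq j : unit_space -> unit_space).
Proof.
elim: j => [|j IH]; first exact: mT1.
rewrite (_ : uniform_seq _ = uniform_seq j \o T2); first exact: measurableT_comp IH mT2.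
by apply/funext => u; rewrite uniform_seqS.
Qed.

Lemma Ex_uniform_seq_prod N (g : nat -> unit_space -> R) :
  (forall j, bounded_measurable (g j)) ->
  \int[leb]_u \prod_(j < N) g j (uniform_seq j u) = \prod_(j < N) \int[leb]_u g j u.
Proof.
elim: N g => [|N IH] g bg.
  by rewrite big_ord0; under eq_Rintegral do rewrite big_ord0; rewrite Ex_cst.
rewrite big_ord_recl.
have bprod : bounded_measurable (fun u : unit_space => \prod_(j < N) g j.+1 (uniform_seq j u)).
  by apply: bm_prod => j; exact: bm_comp (measurable_uniform_seq j) (bg j.+1).
pose f (z : unit_space * unit_space) := g 0%N z.1 * \prod_(j < N) g j.+1 (uniform_seq j z.2).
have bf : bounded_measurable f.
  apply: bmM; first by apply: (bm_comp (phi := fst)) => //; exact: measurable_fst.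
  by apply: (bm_comp (phi := snd) _ bprod); exact: measurable_snd.
transitivity (\int[leb]_u f (T1 u, T2 u)).
  apply: eq_Rintegral => u _; rewrite big_ord_recl /f /=; congr (_ * _).
  by apply: eq_bigr => j _; rewrite -uniform_seqS.
rewrite T12//; under eq_Rintegral do rewrite /f /= ExZ//.
rewrite ExZr//; congr (_ * _).
exact: (IH (fun j => g j.+1)).
Qed.

Lemma Ex_uniform_seq j (g : unit_space -> R) : bounded_measurable g ->
  \int[leb]_u g (uniform_seq j u) = \int[leb]_u g u.
Proof.
elim: j g => [|j IH] g bg.
  have := T12 (f := fun z => g z.1) _ => /= ->; last first.
    by apply: (bm_comp (phi := fst)) => //; exact: measurable_fst.
  by apply: eq_Rintegral => x _; rewrite Ex_cst.
under eq_Rintegral do rewrite uniform_seqS.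
have bgj : bounded_measurable (fun u : unit_space => g (uniform_seq j u)).
  exact: (bm_comp (measurable_uniform_seq j) bg).
have := T12 (f := fun z => g (uniform_seq j z.2)) _ => /= ->; last first.
  by apply: (bm_comp (phi := snd) _ bgj); exact: measurable_snd.
by rewrite Ex_cst IH.
Qed.

(** Independence of the last variable from the earlier ones, as an integral identity. The induction
    removes the first variable by absorbing its term into a translate of [f]. *)
Lemma Ex_uniform_seq_last n N (a : nat -> unit_space -> 'cV[R]_n)
    (b : unit_space -> 'cV[R]_n) (f : 'cV[R]_n -> R) :
  (forall j, measurable_fun setT (a j)) -> measurable_fun setT b ->
  bounded_lipschitz f ->
  \int[leb]_u f (\sum_(j < N) a j (uniform_seq j u) + b (uniform_seq N u)) =
  \int[leb]_u \int[leb]_y f (\sum_(j < N) a j (uniform_seq j u) + b y).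
Proof.
elim: N a f => [|N IH] a f ma mb bf.
  under eq_Rintegral do rewrite big_ord0 add0r.
  under [RHS]eq_Rintegral do under eq_Rintegral do rewrite big_ord0 add0r.
  by rewrite Ex_cst (Ex_uniform_seq 0 (g := fun y => f (b y)))//; exact: bm_of_bl_comp.
pose s (u : unit_space) := \sum_(j < N) a j.+1 (uniform_seq j u).
have ms : measurable_fun setT s.
  by apply: measurable_cV_sum => j; exact: measurableT_comp (measurable_uniform_seq j).
have sE u : \sum_(j < N.+1) a j (uniform_seq j u) = a 0%N (T1 u) + s (T2 u).
  by rewrite big_ord_recl; congr (_ + _); apply: eq_bigr => j _; rewrite -uniform_seqS.
have mbN : measurable_fun setT (fun u : unit_space => b (uniform_seq N u)).
  exact: measurableT_comp mb (measurable_uniform_seq N).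
have ma1 : measurable_fun setT (fun z : unit_space * unit_space => a 0%N z.1).
  by apply: (measurableT_comp (ma 0%N)); exact: measurable_fst.
have ms2 : measurable_fun setT (fun z : unit_space * unit_space => s z.2).
  by apply: (measurableT_comp ms); exact: measurable_snd.
have mb2 : measurable_fun setT (fun z : unit_space * unit_space => b (uniform_seq N z.2)).
  by apply: (measurableT_comp mbN); exact: measurable_snd.
pose f1 (z : unit_space * unit_space) := f (a 0%N z.1 + s z.2 + b (uniform_seq N z.2)).
transitivity (\int[leb]_u f1 (T1 u, T2 u)).
  by apply: eq_Rintegral => u _; rewrite sE uniform_seqS.
rewrite (T12 (f := f1)); last first.
  exact: (bm_of_bl_comp (measurable_cVD (measurable_cVD ma1 ms2) mb2) bf).
have [Q [_ QE]] := pushforward_prob leb mb.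
have QfE v : \int[leb]_y f (v + b y) = \int[Q]_y f (v + y).
  by rewrite QE//; exact: bl_bm (bl_shift v bf).
have bQ : bounded_lipschitz (fun v => \int[Q]_y f (v + y)) by exact: bl_Ex.
pose f2 (z : unit_space * unit_space) := \int[Q]_y f (a 0%N z.1 + s z.2 + y).
transitivity (\int[leb]_u f2 (T1 u, T2 u)); last first.
  by apply: eq_Rintegral => u _; rewrite sE QfE.
rewrite (T12 (f := f2)); last exact: (bm_of_bl_comp (measurable_cVD ma1 ms2) bQ).
apply: eq_Rintegral => x _.
under eq_Rintegral do rewrite /f1 /= -addrA.
rewrite (IH (fun j => a j.+1) (fun v => f (a 0%N x + v)))//; last exact: bl_shift.
apply: eq_Rintegral => u _; rewrite /f2 /= -QfE; apply: eq_Rintegral => y _.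
by rewrite addrA.
Qed.

End independent_sequence.

Section noise.
Context (R : realType) (n : nat) (mu : probability 'cV[R]_n R).
Local Notation unit_space := (measurableTypeR R).
Local Notation leb := (@leb01 R).

Lemma cvg_expmx1 (I : Type) (F : set_system I) {FF : ProperFilter F}
    (t : I -> R) (Q : 'M[R]_n) :
  t k @[k --> F] --> (0 : R) -> expmx (t k *: Q) @[k --> F] --> (1 : 'M[R]_n).
Proof.
move=> t0; pose q := n%:R * `|Q|.
have q0 : 0 <= q by rewrite mulr_ge0.
have H (e : R) : 0 < e -> \forall k \near F, `|t k| <= e.
  by move=> e0; move/cvgrPdist_le : t0 => /(_ e e0); apply: filterS => k; rewrite sub0r normrN.
apply/cvgrPdist_le => e e0.
pose c := expR 1 * q + `|Q| + 1.
have c0 : 0 < c by rewrite ltr_wpDl// addr_ge0// mulr_ge0// ltW// expR_gt0.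
have q10 : 0 < (q + 1)^-1 by rewrite invr_gt0 ltr_wpDl.
apply: filterS2 (H _ q10) (H _ (divr_gt0 e0 c0)) => k tq te.
have tQ : n%:R * `|t k *: Q| = `|t k| * q by rewrite normrZ mulrCA.
have tq1 : `|t k| * q <= 1.
  rewrite (@le_trans _ _ ((q + 1)^-1 * q))//; first by rewrite ler_wpM2r.
  by rewrite ler_pdivrMl ?ltr_wpDl// mulr1 lerDl.
have := @expmx_small _ _ (t k *: Q); rewrite tQ => /(_ tq1) E1.
rewrite distrC; set E := expmx _ in E1 *.
have -> : E - 1 = (E - 1 - t k *: Q) + t k *: Q by rewrite subrK.
rewrite (le_trans (ler_normD _ _))//.
apply: (@le_trans _ _ (`|t k| * c)); last by rewrite -ler_pdivlMr.
apply: (le_trans (lerD E1 (lexx _))); rewrite normrZ /c !mulrDr mulr1.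
rewrite -[leLHS]addr0 lerD// lerD2r [leRHS]mulrCA ler_wpM2l ?(ltW (expR_gt0 _))//.
by rewrite expr2 ler_piMr// mulr_ge0.
Qed.

(** In the limit [mu = mu * nu], with [nu] the limit law of the noises; cancellation forces [nu] to
    be the point mass at [0]. *)
Lemma noise_cvg0 (F : set_system nat) (M_ : nat -> 'M[R]_n)
    (G : nat -> R -> 'cV[R]_n) (c : R) : UltraFilter F ->
  (forall k, measurable_fun (setT : set unit_space) (G k)) ->
  M_ k @[k --> F] --> (1%:M : 'M[R]_n) ->
  (\forall k \near F, forall f, bounded_lipschitz f ->
     \int[mu]_x f x = \int[mu]_x \int[leb]_u f (M_ k *m x + G k u)) ->
  \int[leb]_u clip (c * `|G k u|) @[k --> F] --> (0 : R).
Proof.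
move=> UF mG cM GE.
have m1 k : measurable_fun setT (fun z : 'cV[R]_n * unit_space => M_ k *m z.1).
  exact: measurable_cV_mulmx.
have m2 k : measurable_fun setT (fun z : 'cV[R]_n * unit_space => G k z.2).
  by apply: (measurableT_comp (mG k)); exact: measurable_snd.
have lawU f : bounded_lipschitz f ->
    \int[(mu \x leb)%E]_z f (M_ k *m z.1) @[k --> F] --> \int[mu]_x f (1%:M *m x).
  move=> bf; have H : \int[mu]_x f (M_ k *m x) @[k --> F] --> \int[mu]_x f (1%:M *m x).
    apply: (@cvg_law_mulmx R n _ F _ _ _ (fun=> mu) (fun=> id)) => //.
    by move=> g bg; exact: cvg_cst.
  apply: (cvg_ext _ H) => k; rewrite Ex_prod; last exact: bm_of_bl_comp (m1 k) bf.
  by apply: eq_Rintegral => x _ /=; rewrite Ex_cst.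
have lawUV f : bounded_lipschitz f ->
    \int[(mu \x leb)%E]_z f (M_ k *m z.1 + G k z.2) @[k --> F] --> \int[mu]_x f (1%:M *m x).
  move=> bf; have H : \int[mu]_x f x @[_ --> F] --> \int[mu]_x f (1%:M *m x).
    by under [X in _ --> X]eq_Rintegral do rewrite mul1mx; exact: cvg_cst.
  apply: cvg_trans H; apply: near_eq_cvg; apply: filterS GE => k -> //.
  by rewrite Ex_prod//; exact: (bm_of_bl_comp (measurable_cVD (m1 k) (m2 k)) bf).
have covUV f g : bounded_lipschitz f -> bounded_lipschitz g ->
    \int[(mu \x leb)%E]_z (f (M_ k *m z.1) * g (G k z.2)) -
    \int[(mu \x leb)%E]_z f (M_ k *m z.1) * \int[(mu \x leb)%E]_z g (G k z.2)
      @[k --> F] --> (0 : R).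
  move=> bf bg; apply/cvgrPdist_le => e e0; apply: nearW => k.
  have b1 := bm_of_bl_comp (m1 k) bf; have b2 := bm_of_bl_comp (m2 k) bg.
  suff -> : \int[(mu \x leb)%E]_z (f (M_ k *m z.1) * g (G k z.2)) =
      \int[(mu \x leb)%E]_z f (M_ k *m z.1) * \int[(mu \x leb)%E]_z g (G k z.2).
    by rewrite subrr subrr normr0 ltW.
  rewrite !Ex_prod//=; last exact: bmM.
  under [X in _ = X * _]eq_Rintegral do rewrite Ex_cst.
  rewrite Ex_cst -ExZr; last exact: (bm_of_bl_comp (measurable_mulmx (M_ k)) bf).
  by apply: eq_Rintegral => x _; rewrite ExZ//; exact: (bm_of_bl_comp (mG k) bg).
have [nu [nuV nuE]] := @factor_limit R n nat F _ _ _ (fun=> (mu \x leb)%E)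
  (fun k z => M_ k *m z.1) (fun k z => G k z.2) mu 1%:M 1%:M m1 m2 lawU lawUV covUV.
have nu0 : {ae nu, forall y, 1%:M *m y = 0 :> 'cV[R]_n}.
  apply: (convolution_cancel (mu := mu) (J := 1%:M)) => f bf; rewrite (nuE f bf).
  by apply: eq_Rintegral => x _; apply: eq_Rintegral => y _; rewrite [in RHS](mul1mx y).
pose f (x : 'cV[R]_n) := clip (0 + c * `|x - 0|).
have bf : bounded_lipschitz f by exact: bl_clip_norm.
have fE x : f x = clip (c * `|x|) by rewrite /f add0r subr0.
have <- : \int[nu]_x f x = 0.
  rewrite (Ex_ae_eq (g := fun=> 0)) ?Ex_cst//; [exact: bl_bm|exact: bm_cst|].
  by apply: filterS nu0 => x; rewrite mul1mx => ->; rewrite fE normr0 mulr0 clip0.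
apply: (cvg_ext _ (nuV f bf)) => k; rewrite Ex_prod; last exact: bm_of_bl_comp (m2 k) bf.
rewrite /= Ex_cst; apply: eq_Rintegral => u _; exact: fE.
Qed.

End noise.

(** * Independent summands from a decaying semigroup *)

Section self_decomposition.
Context (R : realType) (n : nat) (mu : probability 'cV[R]_n R).
Local Notation unit_space := (measurableTypeR R).
Local Notation leb := (@leb01 R).
Hypothesis mu_full : full mu.
Variable Q : 'M[R]_n.
Hypothesis DQ : forall t, 0 <= t -> factor mu (expmx (t *: Q)) 1.
Hypothesis cQ : expmx (t *: Q) @[t --> +oo] --> (0 : 'M[R]_n).

(** The clock of the construction: e^((tau k - tau j) Q) is the power (k / j)^Q. Its steps vanish,
    which makes late noises small, and it diverges, which damps the early ones. *)
Let tau (j : nat) : R := ln j%:R.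

Let tau_le i j : (0 < i)%N -> (i <= j)%N -> tau i <= tau j.
Proof. by move=> i0 ij; rewrite ler_ln ?posrE ?ltr0n ?ler_nat// (leq_trans i0). Qed.

Let tau_pinfty j : tau k - tau j @[k --> \oo] --> +oo.
Proof.
apply/cvgryPge => a; pose N := (Num.truncn (expR (a + tau j))).+1.
exists N => // k /= Nk; rewrite lerBrDr -[leLHS]expRK ler_ln ?posrE ?expR_gt0//.
  by rewrite (le_trans (ltW (truncnS_gt _)))// ler_nat.
by rewrite ltr0n (leq_trans _ Nk).
Qed.

Let tau_step_cvg0 : tau k.+1 - tau k @[k --> \oo] --> (0 : R).
Proof.
apply/cvgrPdist_le => e e0; have [N Ne] := natSinv_lt e0.
exists N.+1 => // k /= Nk; have k0 : (0 < k)%N by exact: leq_trans Nk.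
rewrite sub0r normrN ger0_norm; last by rewrite subr_ge0 tau_le.
rewrite /tau -ln_div ?posrE ?ltr0n//.
have -> : k.+1%:R / k%:R = 1 + k%:R^-1 :> R.
  by rewrite -natr1 mulrDl mul1r mulfV// pnatr_eq0 -lt0n.
rewrite (le_trans (le_ln1Dx _))//; first by rewrite (lt_le_trans (ltrN10 _))// invr_ge0.
by rewrite (le_trans _ (ltW Ne))// lef_pV2 ?posrE ?ltr0n// ler_nat.
Qed.

(** Index [1] carries [mu] itself, so that the first normalized sum already has law [mu]; later
    noises are the cofactors of the steps of the clock. Index [0] is null because sums start at
    [1]. *)
Definition noise_of (j : nat) (G : R -> 'cV[R]_n) := match j with
  | 0 => G = fun=> 0
  | 1 => forall f, bounded_lipschitz f -> \int[leb]_u f (G u) = \int[mu]_x f x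
  | j'.+1 => forall f, bounded_lipschitz f -> \int[mu]_x f x =
      \int[mu]_x \int[leb]_u f (expmx ((tau j'.+1 - tau j') *: Q) *m x + G u)
  end.

Lemma exists_noise j : exists G : R -> 'cV[R]_n,
  measurable_fun (setT : set unit_space) G /\ noise_of j G.
Proof.
case: j => [|[|j]].
- by exists (fun=> 0); split => //; exact: measurable_cst.
- have [G [mG GE]] := realize_law mu; exists G; split => // f bf.
  by rewrite GE//; exact: bl_bm.
have h0 : 0 <= tau j.+2 - tau j.+1 by rewrite subr_ge0 tau_le.
have [rho rhoE] := DQ h0; have [G [mG GE]] := realize_law rho.
exists G; split => // f bf; have := rhoE f bf.
under eq_Rintegral do rewrite mul1mx.
move=> ->; apply: eq_Rintegral => x _; rewrite GE//.
exact: bl_bm (bl_shift _ bf).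
Qed.

(** The summands are e^(-tau_j Q) applied to independent noises, so the normalized sum for [k + 1]
    is the step matrix applied to that for [k], plus a fresh noise: its law is exactly [mu] for
    every [k >= 1]. *)
Lemma selfdecomposition : operator_selfdecomposable mu.
Proof.
have /choice[G GP] := exists_noise.
have mG j : measurable_fun (setT : set unit_space) (G j) by case: (GP j).
have [T1 [T2 [mT1 mT2 T12]]] := exists_splitting R.
pose U := uniform_seq T1 T2.
have mU j : measurable_fun (setT : set unit_space) (U j : unit_space -> unit_space).
  exact: measurable_uniform_seq.
pose H j (u : unit_space) : 'cV[R]_n := expmx (- tau j *: Q) *m G j u.
have mH j : measurable_fun setT (H j) by exact: measurable_cV_mulmx.
have mX j : measurable_fun setT (fun u : unit_space => H j (U j u)).
  exact: measurableT_comp (mH j) (mU j).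
pose X j : {RV leb >-> 'cV[R]_n} := mfun_Sub (mem_set (mX j)).
have XE j u : X j u = H j (U j u) by [].
pose A (k : nat) : 'M[R]_n := expmx (tau k *: Q).
have AH k j u : A k *m H j u = expmx ((tau k - tau j) *: Q) *m G j u.
  rewrite /A /H mulmxA scalerBl expmxD ?scaleNr//.
  by rewrite mulrN mulNr -!mulmx_ring -!scalemxAl -!scalemxAr !scalerA mulrC.
have indep : mutually_independent X.
  move=> J B _ mB.
  have [N JN] : exists N, forall j, j \in J -> (j < N)%N.
    exists (\max_(j <- enum_fset J) j).+1 => j jJ; rewrite ltnS.
    exact: (@leq_bigmax_seq _ _ xpredT (fun j => j)).
  (* Indices outside [J] get the whole space, which turns the product over [J] into one over an
     initial segment. *)
  pose B' j := if j \in J then B j else setT.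
  have mB' j : measurable (H j @^-1` B' j).
    rewrite -[X in measurable X]setTI; apply: (mH j) => //.
    by rewrite /B'; case: ifP.
  have bg j : bounded_measurable (\1_(H j @^-1` B' j) : unit_space -> R) by exact: bm_indic.
  have Ecap := Ex_uniform_seq_prod mT1 mT2 T12 N bg.
  pose cap := \bigcap_(j in [set` J]) X j @^-1` B j.
  have mXB j : measurable (X j @^-1` B j).
    by rewrite -[X in measurable X]setTI; exact: (mX j).
  have mcap : measurable cap by apply: fin_bigcap_measurable.
  have capE u : \prod_(j < N) \1_(H j @^-1` B' j) (U j u) = \1_cap u :> R.
    have [ucap|ucap] := pselect (cap u).
      rewrite big1 ?indicE ?mem_set// => j _; rewrite indicE mem_set//=.
      rewrite /B'; case: ifP => // jJ; exact: (ucap j jJ).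
    rewrite [RHS]indicE memNset//=; move/existsNP : ucap => [j]; rewrite not_implyE => -[jJ nj].
    rewrite (bigD1 (Ordinal (JN j jJ)))//= indicE memNset ?mul0r//=.
    by rewrite /B' ifT.
  have PXB j : j \in J -> leb (X j @^-1` B j) = (fine (leb (H j @^-1` B' j)))%:E.
    move=> jJ; have := @Ex_uniform_seq _ _ _ mT1 mT2 T12 j _ (bg j).
    rewrite (Ex_indic leb (mB' j)) => <-.
    rewrite -(fineK (fin_num_measure leb _ (mXB j))) -(Ex_indic leb (mXB j)).
    congr (_%:E); apply: eq_Rintegral => u _; rewrite !indicE; congr ((nat_of_bool _)%:R).
    by apply/idP/idP; rewrite !inE /= /B' jJ.
  rewrite -/cap -(fineK (fin_num_measure leb _ mcap)) -(Ex_indic leb mcap).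
  under eq_Rintegral do rewrite -capE.
  rewrite Ecap (eq_big_seq (fun j => (fine (leb (H j @^-1` B' j)))%:E))//.
  rewrite -(big_morph EFin EFinM (erefl _)); congr (_%:E).
  rewrite (eq_bigr (fun j : 'I_N => if val j \in J then fine (leb (H j @^-1` B' j)) else 1)); last first.
    move=> j _; rewrite (Ex_indic leb (mB' j)); case: ifPn => // jJ.
    by rewrite /B' (negbTE jJ) preimage_setT probability_setT.
  rewrite -(big_mkord xpredT (fun j => if j \in J then fine (leb (H j @^-1` B' j)) else 1)).
  rewrite -big_mkcond -big_filter; apply: perm_big; apply: uniq_perm.
  - by rewrite filter_uniq// iota_uniq.
  - exact: fset_uniq.
  move=> j; rewrite mem_filter mem_index_iota /=.
  by case: (boolP (j \in J)) => // jJ; rewrite (JN j jJ).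
have law k f : bounded_lipschitz f ->
    \int[leb]_u f (A k.+1 *m partial_sum X k.+1 u) = \int[mu]_x f x.
  elim: k f => [|k IH] f bf.
    have [_ GE] := GP 1%N; rewrite -(GE f bf).
    have G1 : bounded_measurable (fun u : unit_space => f (G 1%N u)) by exact: bm_of_bl_comp.
    rewrite -(@Ex_uniform_seq _ _ _ mT1 mT2 T12 1%N _ G1).
    apply: eq_Rintegral => u _; congr f; rewrite /partial_sum big_nat1 XE AH subrr scale0r.
    by rewrite expmx0 mul1mx.
  have sumE m u : A m *m partial_sum X k.+1 u = \sum_(j < k.+2) A m *m H j (U j u).
    have [_ G0] := GP 0%N.
    rewrite mulmx_sumr -(big_mkord xpredT (fun j => A m *m H j (U j u))) [RHS]big_ltn//.
    by rewrite /H G0 !mulmx0 add0r.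
  have [_ GE] := GP k.+2.
  pose M := expmx ((tau k.+2 - tau k.+1) *: Q).
  have AM : A k.+2 = M *m A k.+1.
    rewrite /M /A -[tau k.+2 in LHS](subrK (tau k.+1)) scalerDl expmxD//.
    by rewrite -!mulmx_ring -!scalemxAl -!scalemxAr !scalerA mulrC.
  have [rho [_ rhoE]] := pushforward_prob leb (mG k.+2).
  pose g (v : 'cV[R]_n) := \int[leb]_y f (M *m v + G k.+2 y).
  have gE v : g v = \int[rho]_y f (M *m v + y).
    by rewrite rhoE//; exact: bl_bm (bl_shift _ bf).
  have bg : bounded_lipschitz g.
    rewrite (_ : g = fun v => (fun w => \int[rho]_y f (w + y)) (M *m v)).
      exact: bl_mulmx (bl_Ex rho bf).
    by apply/funext.
  pose a j (w : unit_space) := A k.+2 *m H j w.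
  have ma j : measurable_fun setT (a j) by exact: measurable_cV_mulmx.
  transitivity (\int[leb]_u f (\sum_(j < k.+2) a j (U j u) + G k.+2 (U k.+2 u))).
    apply: eq_Rintegral => u _; congr f; rewrite -(sumE k.+2 u).
    have -> : partial_sum X k.+2 u = partial_sum X k.+1 u + X k.+2 u.
      by rewrite /partial_sum big_nat_recr.
    rewrite !mulmxDr; congr (_ + _); rewrite XE AH subrr scale0r expmx0.
    exact: mul1mx.
  transitivity (\int[leb]_u \int[leb]_y f (\sum_(j < k.+2) a j (U j u) + G k.+2 y)).
    exact: (Ex_uniform_seq_last mT1 mT2 T12 k.+2 ma (mG k.+2) bf).
  transitivity (\int[leb]_u g (A k.+1 *m partial_sum X k.+1 u)).
    apply: eq_Rintegral => u _; rewrite -(sumE k.+2 u) /g.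
    by rewrite AM -mulmxA.
  by rewrite (IH g bg) (GE f bf).
have [c c0 cP] : exists2 c : R, 0 <= c & forall t, 0 <= t -> `|expmx (t *: Q)| <= c.
  have [c cP] := factor_bounded mu_full; exists `|c| => // t t0.
  by rewrite (le_trans (cP _ (DQ t0)))// ler_norm.
have noise0 a e : 0 < e -> exists N, forall j, (N <= j)%N ->
    \int[leb]_u clip (a * `|G j u|) <= e.
  move=> e0; apply: contrapT => /forallNP nN.
  (* An infinite set of exceptional indices would carry an ultrafilter finer than [\oo], along which
     [noise_cvg0] applies. *)
  pose B := [set j | e < \int[leb]_u clip (a * `|G j u|)].
  have PB : ProperFilter (within B \oo).
    apply: Build_ProperFilter; move=> [N _ NB]; apply: (nN N) => j Nj.
    by rewrite leNgt; apply/negP => /(NB j Nj).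
  have [F [UF FB]] := ultraFilterLemma PB.
  have Foo : \oo `<=` F by move=> V [N _ NV]; apply: FB; exists N => // k /= Nk _; exact: NV.
  have BF : F B by apply: FB; exists 0 => // k _.
  have cM : expmx ((tau k - tau k.-1) *: Q) @[k --> F] --> (1%:M : 'M[R]_n).
    apply: cvg_expmx1; apply/cvgrPdist_le => e' e'0; move/cvgrPdist_le : tau_step_cvg0.
    move=> /(_ e' e'0)[N _ HN]; apply: Foo; exists N.+1 => // -[|k] //= Nk; exact: HN.
  have H0 : \int[leb]_u clip (a * `|G k u|) @[k --> F] --> (0 : R).
    have HE : \forall k \near F, forall f, bounded_lipschitz f -> \int[mu]_x f x =
        \int[mu]_x \int[leb]_u f (expmx ((tau k - tau k.-1) *: Q) *m x + G k u).
      apply: Foo; exists 2%N => // -[|[|k]] //= _ f bf.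
      by have [_ GE] := GP k.+2; exact: GE.
    exact: (@noise_cvg0 R n mu F _ G a UF mG cM HE).
  have e20 : 0 < e / 2 by rewrite divr_gt0.
  move/cvgrPdist_le : H0 => /(_ _ e20) H0.
  have /filter_ex[k [kB]] : \forall k \near F, B k /\
      `|0 - \int[leb]_u clip (a * `|G k u|)| <= e / 2 by exact: filterI.
  rewrite sub0r normrN => /(le_trans (ler_norm _)).
  by move=> /(lt_le_trans kB); rewrite ltNge ler_piMr ?(ltW e0)// invf_le1 ?ler1n.
have small (e dl : R) : 0 < e -> 0 < dl -> \forall k \near \oo,
    forall j, (1 <= j <= k)%N -> (leb [set w | (e <= `|A k *m X j w|)%R] <= dl%:E)%E.
  move=> e0 dl0.
  have markov k j : leb [set w | (e <= `|A k *m X j w|)%R] =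
      (fine (leb [set w | (e <= `|A k *m X j w|)%R]))%:E /\
    fine (leb [set w | (e <= `|A k *m X j w|)%R]) <=
    \int[leb]_u clip (e^-1 * `|expmx ((tau k - tau j) *: Q) *m G j u|).
    pose E := [set w | (e <= `|A k *m X j w|)%R].
    have mAX : measurable_fun (setT : set unit_space) (fun w : unit_space => A k *m X j w).
      exact: measurable_cV_mulmx.
    have mE : measurable E.
      have mn : measurable_fun setT (fun x : 'cV[R]_n => `|x|).
        by apply: continuous_measurable_cV; exact: norm_continuous.
      rewrite (_ : E = setT `&` (fun w : unit_space => `|A k *m X j w|) @^-1` `[e, +oo[%classic).
        by apply: (measurableT_comp mn mAX) => //; exact: measurable_itv.
      by apply/seteqP; split => x /=; rewrite in_itv/= andbT//; case.
    rewrite -/E (fineK (fin_num_measure leb _ mE)); split; first by [].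
    pose phi (u : unit_space) := clip (e^-1 * `|expmx ((tau k - tau j) *: Q) *m G j u|).
    have bphi : bounded_measurable phi.
      by apply: bm_clip_vec; exact: measurable_cV_mulmx.
    rewrite -(Ex_indic leb mE) -/(phi _) -(@Ex_uniform_seq _ _ _ mT1 mT2 T12 j _ bphi).
    apply: le_Ex; [exact: bm_indic|exact: (bm_comp (mU j) bphi)|].
    move=> w; rewrite indicE; have [Ew|Ew] := boolP (w \in E); last exact: clip_ge0.
    have ew : e <= `|A k *m H j (U j w)| by move: Ew; rewrite inE.
    rewrite AH in ew; rewrite /phi clip1//.
    by rewrite ler_pdivlMl// mulr1.
  (* Noises of index at least [J] are small and the semigroup is bounded by [c]; the finitely many
     earlier ones are damped by e^((tau k - tau j) Q), which tends to [0]. *)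
  have [J HJ] := noise0 (e^-1 * (n%:R * c)) dl dl0.
  have fixed (j : nat) : \forall k \near \oo,
      \int[leb]_u clip (e^-1 * `|expmx ((tau k - tau j) *: Q) *m G j u|) <= dl.
    have [rho [_ rhoE]] := pushforward_prob leb (mG j).
    pose f (x : 'cV[R]_n) := clip (0 + e^-1 * `|x - 0|).
    have bf : bounded_lipschitz f by exact: bl_clip_norm.
    have fE x : f x = clip (e^-1 * `|x|) by rewrite /f add0r subr0.
    have cM : expmx ((tau k - tau j) *: Q) @[k --> \oo] --> (0 : 'M[R]_n).
      exact: (cvg_comp (fun k => tau k - tau j) (fun t => expmx (t *: Q)) (tau_pinfty j) cQ).
    have cG g : bounded_lipschitz g ->
        \int[leb]_x g (G j x) @[_ --> \oo] --> \int[rho]_x g x.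
      by move=> bg; rewrite (rhoE g (bl_bm bg)); exact: cvg_cst.
    have f0 : \int[rho]_x f (0 *m x) = 0.
      under eq_Rintegral do rewrite fE mul0mx normr0 mulr0 clip0//.
      by rewrite Ex_cst.
    have H1 : \int[leb]_x f (expmx ((tau k - tau j) *: Q) *m G j x) @[k --> \oo] --> (0 : R).
      rewrite -f0.
      exact: (@cvg_law_mulmx R n _ \oo _ _ _ (fun=> leb) (fun=> G j) rho _ _ (fun=> mG j) cG cM f bf).
    move/cvgrPdist_le : H1 => /(_ dl dl0); apply: filterS => k.
    rewrite sub0r normrN => /(le_trans (ler_norm _)).
    by under eq_Rintegral do rewrite fE.
  have /filter_forall fixedJ : forall j : 'I_J, \forall k \near \oo,
      \int[leb]_u clip (e^-1 * `|expmx ((tau k - tau j) *: Q) *m G j u|) <= dl.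
    by move=> j; exact: fixed.
  apply: filterS fixedJ => k Hk j /andP[j1 jk].
  have [-> Hm] := markov k j; rewrite lee_fin (le_trans Hm)//.
  have [jJ|Jj] := ltnP j J; first exact: (Hk (Ordinal jJ)).
  apply: le_trans (HJ j Jj); apply: le_Ex.
  - by apply: bm_clip_vec; exact: measurable_cV_mulmx.
  - exact: bm_clip_vec.
  move=> u; apply: clip_homo; rewrite -mulrA ler_wpM2l ?invr_ge0 ?(ltW e0)//.
  rewrite (le_trans (ler_mx_normM _ _))// ler_wpM2r// ler_wpM2l//.
  by apply: cP; rewrite subr_ge0 tau_le.
exists _, unit_space, leb, X, A, (fun=> 0); split; first exact: indep.
- move=> e e0.
  pose m k := \big[maxe/0%E]_(1 <= j < k.+1) leb [set w | e <= `|A k *m X j w|].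
  have m0 k : (0 <= m k)%E by exact: bigmax_ge_id.
  have msmall (dl : R) : 0 < dl -> \forall k \near \oo, (m k <= dl%:E)%E.
    move=> dl0; apply: filterS (small e dl e0 dl0) => k Hk.
    rewrite /m big_nat_cond; apply: bigmax_le; first by rewrite lee_fin ltW.
    by move=> j; rewrite andbT ltnS => /Hk.
  have mfin k (dl : R) : (m k <= dl%:E)%E -> m k \is a fin_num.
    by move=> mk; rewrite (ge0_fin_numE (m0 k)) (le_lt_trans mk)// ltry.
  suff : m k @[k --> \oo] --> 0%E by [].
  apply/fine_cvgP; split.
    by apply: filterS (msmall 1 ltr01) => k; exact: mfin.
  apply/cvgrPdist_le => dl dl0; apply: filterS (msmall dl dl0) => k mk.
  rewrite sub0r normrN ger0_norm; last exact: fine_ge0 (m0 k).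
  by rewrite -lee_fin (fineK (mfin k dl mk)).
move=> f cf bf.
have mf : bounded_measurable f.
  split; first exact: continuous_measurable_cV.
  case: bf => M [_ HM]; exists (M + 1) => x; apply: (HM (M + 1)) => //.
  by rewrite ltrDl.
have mS k : measurable_fun (setT : set unit_space) (fun w : unit_space => A k *m partial_sum X k w).
  by apply: measurable_cV_mulmx; exact: measurable_cV_sum.
(* Equality on Lipschitz functions gives equality of laws, hence equality on bounded continuous
   functions. *)
have lawf k : \int[leb]_u f (A k.+1 *m partial_sum X k.+1 u) = \int[mu]_x f x.
  have [Z [_ ZE]] := pushforward_prob leb (mS k.+1).
  rewrite -(ZE f mf); apply: eq_prob_Ex; apply: eq_prob_bl => g bg.
  by rewrite (ZE g (bl_bm bg)) law.
rewrite -(EFin_Ex mu mf).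
have H0 : (\int[mu]_x f x)%:E @[_ --> \oo] --> (\int[mu]_x f x)%:E by exact: cvg_cst.
apply: cvg_trans H0; apply: near_eq_cvg; exists 1%N => // -[|k] //= _.
rewrite -(lawf k) EFin_Ex; last exact: (bm_comp (mS k.+1) mf).
by apply: eq_integral => w _; rewrite addr0.
Qed.

End self_decomposition.

(** Bounded Lipschitz functions determine the law of a sum, which turns the integral identity into
    one on Borel sets. *)
Lemma factor_decomposability (R : realType) (n : nat)
    (mu : probability 'cV[R]_n R) (M : 'M[R]_n) :
  factor mu M 1%:M -> decomposability mu M.
Proof.
move=> [nu nuE]; exists nu => B mB.
have madd : measurable_fun setT (fun z : 'cV[R]_n * 'cV[R]_n => z.1 + z.2).
  exact: measurable_cVD.
have [Z [ZB ZE]] := pushforward_prob (distribution mu (mulmx M) \x nu)%E madd.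
rewrite /convolution -[RHS](ZB B); apply: eq_prob_bl mB => f bf.
rewrite (ZE f (bl_bm bf)) Ex_prod; last exact: (bm_of_bl_comp madd bf).
have [W [WB WE]] := pushforward_prob mu (measurable_mulmx M).
rewrite (@eq_prob_Ex _ _ _ _ W); last by move=> C _; rewrite WB.
rewrite (WE (fun x => \int[nu]_y f (x + y))); last exact: bl_bm (bl_Ex nu bf).
by rewrite -nuE//; apply: eq_Rintegral => x _; rewrite mul1mx.
Qed.

Theorem theorem1 (R : realType) (d : nat) (d_ge1 : (1 <= d)%N)
    (dO : measure_display) (Omega : measurableType dO)
    (P : probability Omega R) (X : nat -> {RV P >-> 'cV[R]_d})
    (A : nat -> 'M[R]_d) (b : nat -> 'cV[R]_d)
    (mu : probability 'cV[R]_d R)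
    (X_mixing : strongly_mixing X)
    (AX_infinitesimal : infinitesimal A X)
    (AS_cvg : cvg_in_law P (fun n w => A n *m partial_sum X n w + b n) mu)
    (mu_full : full mu) :
  operator_selfdecomposable mu /\
  exists Q : 'M[R]_d,
    [set expmx (- t *: Q) | t in [set t : R | 0 <= t]]
      `<=` decomposability mu /\
    expmx (- t *: Q) @[t --> +oo] --> (0 : 'M[R]_d).
Proof.
have [Q [DQ cQ]] := mixing_decaying_semigroup X_mixing AX_infinitesimal AS_cvg mu_full.
split; first exact: (selfdecomposition mu_full DQ cQ).
(* The semigroup was built as e^(tQ) and the conclusion is about e^(-tQ), hence the opposite
   generator. *)
have NQ t : - t *: - Q = t *: Q by rewrite scaleNr scalerN opprK.
exists (- Q); split; last by apply: (cvg_ext _ cQ) => t; rewrite NQ.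
move=> _ [t t0 <-]; rewrite NQ; apply: factor_decomposability; exact: DQ.
Qed.
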